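(* For every integer $n\ge0$, \begin{align*} t^\star(3,\{2\}^n,3) = {} & \Big(\frac{1}{4}\Big)^{n+2} \Big\{ \frac{9+6n}{2} \zeta(2) \zeta(2n+4) \\ & \quad\quad + \sum_{\substack{r+s+q=n+2 \\ r,s,q\geq 1}} 2 r s (2 - 2^{-2r} - 2^{-2s}) \zeta(2r + 1)\zeta(2s+1) \cdot (-1)^q \frac{E_{2q} \pi^{2q}}{(2q)!} \\ & \quad\quad + \sum_{\substack{r + s = n+2 \\ r,s \geq 1}} 2 r s (2 - 2^{-2r})(2 - 2^{-2s}) \zeta(2r+1) \zeta(2s+1) \Big\} \,, \end{align*} where the Euler numbers $E_n$ are defined by $\frac{1}{\cosh(z)} = \frac{2}{e^z+e^{-z}} = \sum_{n=0}^\infty \frac{E_n}{n!} z^n$.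
   Context: The multiple $t$-star value is $t^\star(n_1,\dots,n_\ell)=\sum_{1\le k_1\le k_2\le\dots\le k_\ell}\prod_i (2k_i-1)^{-n_i}$, equivalently the sum of $t$-values over all compositions obtained by combining adjacent arguments of $(n_1,\dots,n_\ell)$ by addition (e.g. $t^\star(2,1,3)=t(2,1,3)+t(3,3)+t(2,4)+t(6)$), where $t(n_1,\dots,n_\ell)=\sum_{1\le k_1<\dots<k_\ell}\prod_i(2k_i-1)^{-n_i}$. $\zeta$ is the Riemann zeta function and $\{2\}^n$ denotes $2,\dots,2$ with $n$ repetitions. *)

(* Defs.v *)
From Stdlib Require Import Reals Factorial List.
From Coquelicot Require Import Coquelicot.
Open Scope R_scope.

(* [tstar_trunc N m (n_1, ..., n_l)] is the finite sum of
   prod_i (2 k_i - 1)^(- n_i) over all m <= k_1 <= k_2 <= ... <= k_l <= N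
   ([sum_n_m] is 0 on an empty range). *)
Fixpoint tstar_trunc (N m : nat) (ns : list nat) : R :=
  match ns with
  | nil => 1
  | n :: ns' =>
      sum_n_m (fun k => / (2 * INR k - 1) ^ n * tstar_trunc N k ns') m N
  end.

(* All terms with k_1 >= 1 are positive, so the truncations increase with N and
   the limit is the unordered multiple sum; it is [p_infty] exactly when that
   sum diverges, so an equation [tstar ns = Finite x] asserts convergence. *)
Definition tstar (ns : list nat) : Rbar :=
  Lim_seq (fun N => tstar_trunc N 1 ns).

(* The Riemann zeta function at integers s >= 2. *)
Definition zeta (s : nat) : R := Series (fun k => / INR (S k) ^ s).

(* The generating function 1 / cosh z = sum_n E_n / n! z^n is only asserted
   near 0: its radius of convergence is PI / 2, and it determines E. *)
Definition is_euler_numbers (E : nat -> R) : Prop :=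
  locally 0 (fun z => is_pseries (fun n => E n / INR (fact n)) z (/ cosh z)).

Definition sum_compositions2 (N : nat) (f : nat -> nat -> R) : R :=
  sum_n_m (fun r => sum_n_m (fun s =>
    if Nat.eqb (r + s) N then f r s else 0) 1 N) 1 N.

Definition sum_compositions3 (N : nat) (f : nat -> nat -> nat -> R) : R :=
  sum_n_m (fun r => sum_n_m (fun s => sum_n_m (fun q =>
    if Nat.eqb (r + s + q) N then f r s q else 0) 1 N) 1 N) 1 N.

(* Main.v *)
(** The partial sums factor: expanding prod_(a <= j <= b) (1 - x^2 / (2j-1)^2)^-1 in partial
    fractions separates the outer summations, and the odd-weight sums on both sides telescope,
    so that t*(3,{2}^n,3) = sum_m a_m / m^(2n+2) over odd m, where a_m is, up to a sign and a
    constant, m times the product at t = m^2 of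
      Xi(t) = sum_L L / (L^2 - t)^2  and  Eta(t) = sum_L (-1)^(L/2-1) L / (L^2 - t)^2
    (L even). The generating function sum_m a_m / (m^2 - t) is then computed without complex
    analysis. Splitting Xi and Eta into the sums O, E over L/2 odd and even, and writing
    sigma(t) = sec(pi sqrt t / 2) ([secant] below) as a partial fraction series
    with poles m^2, one multiplies partial fractions term by term. As sigma takes the value -1 (resp. 1), with zero derivative,
    at all poles of O (resp. E), only the second and third Taylor coefficients of sigma at L^2
    survive, and
      sum_m a_m / (m^2 - t) = 16 (O^2 (sigma + 1) - E^2 (sigma - 1)) + 16 lam R(t),
    with R(t) = sum_L (1 / (8 L^2 (L^2 - t)) + 1 / (4 (L^2 - t)^2)) and
    lam = sum_m 1 / m^2 = 3/4 zeta(2). Comparing coefficients of t^n gives the formula; the Euler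
    numbers enter through sigma(-x^2) cosh(pi x / 2) = 1, which follows from the recurrence of
    the integrals of cosh(x u) cos(u)^k over [0, pi/2]. *)

(* In place of a comparison of poles, each product of two partial fraction series is computed by
   exchanging a double sum, and the exchange needs the inner sums in closed form. This forces the
   splitting by the parity of L/2: Xi Eta = O^2 - E^2, and in O^2 (sigma + 1) the double poles L^2
   of one factor O meet double zeros of sigma + 1, so that O (sigma + 1) has poles m^2 only and the
   second factor O can be multiplied in; likewise for E with sigma - 1. The infinite product of the
   factors 1 - t / m^2 is evaluated only at t = L^2, where shifting the root of t by 2 changes its
   sign, and at t = -x^2. The constant [kap] stays a limit: in the Taylor coefficients it is
   multiplied by the alternating sum [beta3] of the 1 / m^3, and that product is lam. The two sums
   over zeta products come from 16 (O^2 (sigma + 1) - E^2 (sigma - 1)) = 8 (Xi + Eta)^2 + 16 Xi Eta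
   (sigma - 1): the constant term of sigma is absorbed by the square, and sigma - 1 carries the
   Euler numbers with q >= 1. *)
Require Import Defs.
From Stdlib Require Import Reals Arith Factorial List Lra Lia.
From Coquelicot Require Import Coquelicot.
Open Scope R_scope.

(* Sums and series of Coquelicot yield equations typed in a structure carrier, which [ring]
   and [field] do not recognize as R. *)
Ltac as_R := match goal with |- @eq _ ?a ?b => change (@eq R a b) end.

(** * Dominated convergence and double series *)

Lemma sum_n_S_R (a : nat -> R) n : sum_n a (S n) = sum_n a n + a (S n).
Proof. exact (sum_Sn a n). Qed.

Lemma is_lim_seq_unique_R (u : nat -> R) (a b : R) :
  is_lim_seq u a -> is_lim_seq u b -> a = b.
Proof.
  intros Ha Hb; apply is_lim_seq_unique in Ha, Hb.
  change (real a = real b); congruence.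
Qed.

Lemma ex_series_dominated (f g : nat -> R) :
  ex_series g -> (forall k, Rabs (f k) <= g k) -> ex_series f.
Proof. intros Hg H; exact (ex_series_le f g H Hg). Qed.

Lemma ex_series_Rabs_dominated (f g : nat -> R) :
  ex_series g -> (forall k, Rabs (f k) <= g k) -> ex_series (fun k => Rabs (f k)).
Proof.
  intros Hg H; apply (ex_series_dominated _ g Hg).
  intros k; rewrite Rabs_Rabsolu; apply H.
Qed.

Lemma ex_series_scal_R (c : R) (a : nat -> R) :
  ex_series a -> ex_series (fun k => c * a k).
Proof. intros H; apply (ex_series_scal_l c a H). Qed.

Lemma Series_dominated (f g : nat -> R) :
  ex_series g -> (forall k, Rabs (f k) <= g k) -> Rabs (Series f) <= Series g.
Proof.
  intros Hg H.
  apply Rle_trans with (Series (fun k => Rabs (f k))).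
  - apply Series_Rabs, (ex_series_Rabs_dominated f g Hg H).
  - apply Series_le; [|exact Hg].
    intros k; split; [apply Rabs_pos | apply H].
Qed.

Lemma Rabs_limit_le (u : nat -> R) (l b : R) :
  is_lim_seq u l -> (forall n, Rabs (u n) <= b) -> Rabs l <= b.
Proof.
  intros Hu H.
  apply (is_lim_seq_le (fun n => Rabs (u n)) (fun _ => b) (Rabs l) b H).
  - apply (is_lim_seq_abs u l Hu).
  - apply is_lim_seq_const.
Qed.

Lemma is_lim_seq_sum_f_R0 (f : nat -> nat -> R) (F : nat -> R) (K : nat) :
  (forall k, is_lim_seq (fun N => f N k) (F k)) ->
  is_lim_seq (fun N => sum_f_R0 (f N) K) (sum_f_R0 F K).
Proof.
  intros H; induction K as [|K IH]; simpl; [apply H|].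
  apply (is_lim_seq_plus' _ _ _ _ IH (H (S K))).
Qed.

Lemma is_lim_seq_eps (u : nat -> R) (l : R) :
  (forall eps, 0 < eps -> exists N, forall n, (N <= n)%nat -> Rabs (u n - l) < eps) ->
  is_lim_seq u l.
Proof.
  intros H; apply is_lim_seq_spec; intros [eps He]; simpl.
  destruct (H eps He) as [N HN]; exists N; exact HN.
Qed.

Lemma is_lim_seq_eps_inv (u : nat -> R) (l : R) :
  is_lim_seq u l ->
  forall eps, 0 < eps -> exists N, forall n, (N <= n)%nat -> Rabs (u n - l) < eps.
Proof.
  intros H eps He; apply is_lim_seq_spec in H.
  destruct (H (mkposreal eps He)) as [N HN]; exists N; exact HN.
Qed.

(** Tannery's theorem. The common majorant [g] makes the tails beyond one index [K] uniformly small,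
    which leaves the convergence of a finite sum. *)
Lemma tannery (f : nat -> nat -> R) (F g : nat -> R) :
  ex_series g ->
  (forall N k, Rabs (f N k) <= g k) ->
  (forall k, is_lim_seq (fun N => f N k) (F k)) ->
  is_lim_seq (fun N => Series (f N)) (Series F).
Proof.
  intros Hg Hdom Hlim.
  assert (HF : forall k, Rabs (F k) <= g k).
  { intros k; apply (Rabs_limit_le (fun N => f N k)); auto. }
  apply is_lim_seq_eps; intros eps He.
  assert (Hs : is_lim_seq (sum_n g) (Series g)) by (apply Series_correct; exact Hg).
  destruct (is_lim_seq_eps_inv _ _ Hs (eps / 4)) as [K HK]; [lra|].
  specialize (HK K (le_n K)); rewrite sum_n_Reals in HK.
  assert (Htail : forall h, (forall k, Rabs (h k) <= g k) ->
    Rabs (Series h - sum_f_R0 h K) < eps / 4).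
  { intros h Hh.
    rewrite (Series_incr_n h (S K)); [| lia | apply (ex_series_dominated h g Hg Hh)].
    simpl Init.Nat.pred.
    replace (sum_f_R0 h K + Series (fun k => h (S K + k)%nat) - sum_f_R0 h K)
      with (Series (fun k => h (S K + k)%nat)) by ring.
    apply Rle_lt_trans with (Series (fun k => g (S K + k)%nat)).
    - apply Series_dominated; [|intros k; apply Hh].
      apply (ex_series_incr_n g (S K)); exact Hg.
    - rewrite (Series_incr_n g (S K)) in HK; [|lia|exact Hg].
      simpl Init.Nat.pred in HK.
      rewrite Rabs_minus_sym in HK.
      apply Rle_lt_trans with (2 := HK).
      replace (sum_f_R0 g K + Series (fun k => g (S K + k)%nat) - sum_f_R0 g K)
        with (Series (fun k => g (S K + k)%nat)) by ring.
      apply Rle_abs. }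
  destruct (is_lim_seq_eps_inv _ _ (is_lim_seq_sum_f_R0 f F K Hlim) (eps / 4))
    as [N0 HN0]; [lra|].
  exists N0; intros N HN.
  specialize (HN0 N HN).
  pose proof (Htail (f N) (Hdom N)) as H1.
  pose proof (Htail F HF) as H2.
  apply Rabs_def2 in H1, H2, HN0; apply Rabs_def1; lra.
Qed.

Lemma is_series_of_is_lim_seq (a : nat -> R) (l : R) :
  is_lim_seq (sum_n a) l -> is_series a l.
Proof. intros H; exact H. Qed.

Lemma Series_finite_sum (a : nat -> nat -> R) (N : nat) :
  (forall j, ex_series (fun k => a k j)) ->
  is_series (fun k => sum_n (a k) N) (sum_n (fun j => Series (fun k => a k j)) N).
Proof.
  intros H; induction N as [|N IH].
  - apply (is_series_ext (fun k => a k 0%nat)).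
    + intros k; rewrite sum_O; reflexivity.
    + rewrite sum_O; apply Series_correct, H.
  - apply (is_series_ext (fun k => plus (sum_n (a k) N) (a k (S N)))).
    + intros k; rewrite sum_Sn; reflexivity.
    + rewrite sum_Sn.
      apply (is_series_plus (fun k => sum_n (a k) N) (fun k => a k (S N))); [exact IH|].
      apply Series_correct, H.
Qed.

Lemma Rabs_le_sum_n_Rabs (a : nat -> R) (j : nat) :
  Rabs (a j) <= sum_n (fun i => Rabs (a i)) j.
Proof.
  destruct j as [|j]; [rewrite sum_O; apply Rle_refl|].
  rewrite sum_Sn; unfold plus; simpl.
  assert (0 <= sum_n (fun i => Rabs (a i)) j); [|lra].
  rewrite sum_n_Reals; apply cond_pos_sum; intros; apply Rabs_pos.
Qed.

(** Tannery's theorem for the partial sums over [j], of which [g] is a common majorant; the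
    convergence of each row follows from the bound on its finite sums of absolute values. *)
Lemma fubini_series (a : nat -> nat -> R) (g : nat -> R) :
  ex_series g ->
  (forall k N, sum_n (fun j => Rabs (a k j)) N <= g k) ->
  is_series (fun j => Series (fun k => a k j)) (Series (fun k => Series (a k))).
Proof.
  intros Hg Hdom.
  assert (Hentry : forall k j, Rabs (a k j) <= g k).
  { intros k j; apply Rle_trans with (2 := Hdom k j).
    apply Rabs_le_sum_n_Rabs. }
  assert (Hrow : forall k, ex_series (a k)).
  { intros k; apply ex_series_Rabs, ex_finite_lim_seq_incr with (M := g k).
    - intros n; rewrite sum_Sn; unfold plus; simpl.
      pose proof (Rabs_pos (a k (S n))); lra.
    - apply Hdom. }
  assert (Hcol : forall j, ex_series (fun k => a k j)).
  { intros j; apply (ex_series_dominated _ g Hg); intros k; apply Hentry. }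
  assert (HT : is_lim_seq (fun N => Series (fun k => sum_n (a k) N))
                          (Series (fun k => Series (a k)))).
  { apply (tannery _ _ g Hg).
    - intros N k; apply Rle_trans with (2 := Hdom k N).
      rewrite !sum_n_Reals; apply sum_f_R0_triangle.
    - intros k; apply (Series_correct _ (Hrow k)). }
  apply is_series_of_is_lim_seq.
  apply (is_lim_seq_ext _ _ _ (fun N => is_series_unique _ _ (Series_finite_sum a N Hcol))).
  exact HT.
Qed.

Lemma is_series_telescope (c : nat -> R) :
  is_lim_seq c 0 -> is_series (fun k => c k - c (S k)) (c 0%nat).
Proof.
  intros H; apply is_series_of_is_lim_seq.
  apply (is_lim_seq_ext (fun n => c 0%nat - c (S n))).
  - intros n; induction n as [|n IH].
    + rewrite sum_O; reflexivity.
    + rewrite sum_Sn, <- IH; unfold plus; simpl; ring.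
  - replace (Finite (c 0%nat)) with (Finite (c 0%nat - 0)) by (f_equal; ring).
    apply is_lim_seq_minus'; [apply is_lim_seq_const|].
    apply (is_lim_seq_incr_1 c); exact H.
Qed.

Lemma Series_plus_R (a b : nat -> R) : ex_series a -> ex_series b ->
  Series (fun k => a k + b k) = Series a + Series b.
Proof. exact (Series_plus a b). Qed.

Lemma is_series_single (a : nat -> R) (i : nat) :
  (forall j, j <> i -> a j = 0) -> is_series a (a i).
Proof.
  intros H; apply is_series_of_is_lim_seq.
  apply (is_lim_seq_ext_loc (fun _ => a i)); [|apply is_lim_seq_const].
  exists i; intros n Hn; rewrite sum_n_Reals.
  assert (H0 : forall m, (m < i)%nat -> sum_f_R0 a m = 0).
  { intros m; induction m as [|m IH]; intros Hm; simpl.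
    - apply H; lia.
    - rewrite IH, H by lia; ring. }
  induction Hn as [|n Hn IH].
  - destruct i as [|i]; simpl; [reflexivity|].
    rewrite H0 by lia; ring.
  - simpl; rewrite <- IH, (H (S n)) by lia; ring.
Qed.

Lemma Series_single (a : nat -> R) (i : nat) :
  (forall j, j <> i -> a j = 0) -> Series a = a i.
Proof. intros H; apply is_series_unique, is_series_single, H. Qed.

(** * Lagrange coefficients at the odd squares *)

Definition od (k : nat) : R := 2 * INR k + 1.
Definition ev (j : nat) : R := 2 * INR j + 2.

Lemma od_ge_1 k : 1 <= od k.
Proof. unfold od; pose proof (pos_INR k); lra. Qed.

Lemma od_neq_0 k : od k <> 0.
Proof. pose proof (od_ge_1 k); lra. Qed.

Lemma od_0 : od 0 = 1.
Proof. unfold od; simpl; ring. Qed.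

Lemma od_S k : od (S k) = od k + 2.
Proof. unfold od; rewrite S_INR; ring. Qed.

Lemma od_le a b : (a <= b)%nat -> od a <= od b.
Proof. intros H; unfold od; apply le_INR in H; lra. Qed.

Lemma od_lt a b : (a < b)%nat -> od a + 2 <= od b.
Proof. intros H; rewrite <- od_S; apply od_le; lia. Qed.

Lemma ev_ge_2 j : 2 <= ev j.
Proof. unfold ev; pose proof (pos_INR j); lra. Qed.

Lemma ev_S j : ev (S j) = ev j + 2.
Proof. unfold ev; rewrite S_INR; ring. Qed.

(** The finite product whose limit is cos (pi x / 2). *)
Fixpoint odd_prod (a : nat) (x : R) : R :=
  match a with
  | O => 1
  | S a' => odd_prod a' x * (1 - x ^ 2 / od a' ^ 2)
  end.

Lemma odd_prod_S a x : odd_prod (S a) x = odd_prod a x * (1 - x ^ 2 / od a ^ 2).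
Proof. reflexivity. Qed.

(** Each factor is (od j - x) (od j + x) / od j ^ 2. Adding 2 to [x] moves the two linear families
    along by one index in opposite directions, so only end factors change. *)
Lemma odd_prod_shift (a : nat) (x : R) :
  odd_prod a (x + 2) * (x + 2 - od a) = odd_prod a x * (x + od a).
Proof.
  induction a as [|a IH]; rewrite ?odd_prod_S.
  - unfold od; simpl; ring.
  - rewrite od_S.
    pose proof (od_neq_0 a) as Ha.
    replace (odd_prod a (x + 2) * (1 - (x + 2) ^ 2 / od a ^ 2) * (x + 2 - (od a + 2)))
      with (- (odd_prod a (x + 2) * (x + 2 - od a)) * (x + 2 + od a) * (x - od a) / od a ^ 2)
      by (field; exact Ha).
    rewrite IH; field; exact Ha.
Qed.

Lemma odd_prod_at_odd_eq_0 (a k : nat) : (k < a)%nat -> odd_prod a (od k) = 0.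
Proof.
  intros H; induction H as [|a Ha IH]; rewrite odd_prod_S.
  - replace (od k ^ 2 / od k ^ 2) with 1 by (field; apply od_neq_0); ring.
  - rewrite IH; ring.
Qed.

Fixpoint odd_square_fact (b : nat) : R :=
  match b with
  | O => 1
  | S b' => odd_square_fact b' * od (S b') ^ 2
  end.

Lemma odd_square_fact_S b : odd_square_fact (S b) = odd_square_fact b * od (S b) ^ 2.
Proof. reflexivity. Qed.

Lemma odd_square_fact_pos b : 0 < odd_square_fact b.
Proof.
  induction b as [|b IH]; [simpl; lra | rewrite odd_square_fact_S].
  apply Rmult_lt_0_compat; [exact IH|].
  apply pow_lt; pose proof (od_ge_1 (S b)); lra.
Qed.

(* For [k <= b], [(-1)^k * omega b k / od k] is the residue-type coefficient
   prod_{j <= b, j <> k} (1 - od k ^ 2 / od j ^ 2)^-1. *)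
Definition omega (b k : nat) : R :=
  if Nat.leb k b
  then odd_square_fact b / (4 ^ b * (INR (fact (b - k)) * INR (fact (b + k + 1))))
  else 0.

Lemma omega_gt b k : (b < k)%nat -> omega b k = 0.
Proof.
  intros H; unfold omega; destruct (Nat.leb_spec k b); [lia|reflexivity].
Qed.

Lemma omega_le b k : (k <= b)%nat -> omega b k =
  odd_square_fact b / (4 ^ b * (INR (fact (b - k)) * INR (fact (b + k + 1)))).
Proof.
  intros H; unfold omega; destruct (Nat.leb_spec k b); [reflexivity|lia].
Qed.

Lemma omega_nonneg b k : 0 <= omega b k.
Proof.
  destruct (le_lt_dec k b) as [H|H]; [|rewrite omega_gt by exact H; lra].
  rewrite omega_le by exact H.
  left; apply Rdiv_lt_0_compat; [apply odd_square_fact_pos|].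
  repeat apply Rmult_lt_0_compat; try apply INR_fact_lt_0.
  apply pow_lt; lra.
Qed.

Lemma omega_0_0 : omega 0 0 = 1.
Proof. rewrite omega_le by lia; simpl; field. Qed.

Lemma INR_fact_S n : INR (fact (S n)) = (INR n + 1) * INR (fact n).
Proof. rewrite fact_simpl, mult_INR, S_INR; reflexivity. Qed.

Lemma pow4_neq_0 b : 4 ^ b <> 0.
Proof. apply pow_nonzero; lra. Qed.

(** The new node contributes the factor (1 - od k ^ 2 / od (S b) ^ 2)^-1. Cleared of denominators,
    the relation also holds for [k > b], where both sides are 0. *)
Lemma omega_succ_b b k :
  omega (S b) k * (od (S b) ^ 2 - od k ^ 2) = od (S b) ^ 2 * omega b k.
Proof.
  destruct (le_lt_dec k b) as [H|H].
  - rewrite !omega_le by lia.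
    replace (S b - k)%nat with (S (b - k)) by lia.
    replace (S b + k + 1)%nat with (S (b + k + 1)) by lia.
    rewrite !INR_fact_S, odd_square_fact_S.
    rewrite minus_INR, !plus_INR by lia.
    change (INR 1) with 1.
    change (4 ^ S b) with (4 * 4 ^ b).
    replace (od (S b) ^ 2 - od k ^ 2)
      with (4 * (INR b - INR k + 1) * (INR b + INR k + 1 + 1))
      by (unfold od; rewrite S_INR; ring).
    pose proof (INR_fact_neq_0 (b - k)) as H1.
    pose proof (INR_fact_neq_0 (b + k + 1)) as H2.
    pose proof (pow4_neq_0 b) as H3.
    pose proof (pos_INR k) as Hk; apply le_INR in H.
    field; repeat split; trivial; lra.
  - rewrite (omega_gt b k) by exact H.
    destruct (Nat.eq_dec k (S b)) as [->|Hk]; [ring|].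
    rewrite omega_gt by lia; ring.
Qed.

Lemma omega_succ_k b k :
  omega b (S k) * (INR b + INR k + 2) = omega b k * (INR b - INR k).
Proof.
  destruct (le_lt_dec (S k) b) as [H|H].
  - rewrite !omega_le by lia.
    replace (b - k)%nat with (S (b - S k)) by lia.
    replace (b + S k + 1)%nat with (S (b + k + 1)) by lia.
    rewrite !INR_fact_S.
    rewrite minus_INR, !plus_INR by lia.
    change (INR 1) with 1; rewrite (S_INR k).
    pose proof (INR_fact_neq_0 (b - S k)) as H1.
    pose proof (INR_fact_neq_0 (b + k + 1)) as H2.
    pose proof (pow4_neq_0 b) as H3.
    pose proof (pos_INR k) as Hk; apply le_INR in H; rewrite (S_INR k) in H.
    field; repeat split; trivial; lra.
  - rewrite (omega_gt b (S k)) by exact H.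
    destruct (Nat.eq_dec k b) as [->|Hk]; [ring|].
    rewrite omega_gt by lia; ring.
Qed.

(** The normalization for a single node, where the Lagrange coefficient has to be 1. One step
    combines [odd_prod_shift] with the recurrences of [omega] in both indices. *)
Lemma odd_prod_omega_diag a :
  odd_prod a (od a) * omega a a = (-1) ^ a * od a.
Proof.
  induction a as [|a IH].
  - rewrite omega_0_0; unfold od; simpl; ring.
  - pose proof (od_ge_1 a) as Ha.
    assert (H1 : odd_prod a (od (S a)) * 2 = odd_prod a (od a) * (2 * od a)).
    { pose proof (odd_prod_shift a (od a)) as H; rewrite od_S.
      replace (od a + 2 - od a) with 2 in H by ring.
      rewrite H; ring. }
    assert (H2 : omega (S a) a * (4 * (od a + 1)) = od (S a) ^ 2 * omega a a).
    { rewrite <- omega_succ_b, od_S; ring. }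
    assert (H3 : omega (S a) (S a) * od (S a) = omega (S a) a).
    { pose proof (omega_succ_k (S a) a) as H; rewrite od_S; rewrite S_INR in H.
      unfold od; nra. }
    rewrite odd_prod_S.
    apply Rmult_eq_reg_r with (od (S a) * (4 * (od a + 1)));
      [|rewrite od_S; apply Rmult_integral_contrapositive_currified; lra].
    replace (odd_prod a (od (S a)) * (1 - od (S a) ^ 2 / od a ^ 2) * omega (S a) (S a) *
      (od (S a) * (4 * (od a + 1)))) with
      ((odd_prod a (od (S a)) * 2 / 2) * (1 - od (S a) ^ 2 / od a ^ 2) *
       ((omega (S a) (S a) * od (S a)) * (4 * (od a + 1)))) by (field; lra).
    rewrite H3, H2, H1.
    replace (odd_prod a (od a) * (2 * od a) / 2 * (1 - od (S a) ^ 2 / od a ^ 2) *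
      (od (S a) ^ 2 * omega a a)) with
      ((odd_prod a (od a) * omega a a) * (od a * (1 - od (S a) ^ 2 / od a ^ 2) * od (S a) ^ 2))
      by (field; lra).
    change ((-1) ^ S a) with (-1 * (-1) ^ a); rewrite IH, od_S; field; lra.
Qed.

Lemma sum_n_plus_R (a b : nat -> R) n :
  sum_n (fun k => a k + b k) n = sum_n a n + sum_n b n.
Proof. exact (sum_n_plus a b n). Qed.

Lemma sum_n_scal_R (c : R) (a : nat -> R) n :
  sum_n (fun k => c * a k) n = c * sum_n a n.
Proof. exact (sum_n_mult_l c a n). Qed.

Lemma sum_n_ext_le (a b : nat -> R) n :
  (forall k, (k <= n)%nat -> a k = b k) -> sum_n a n = sum_n b n.
Proof. exact (sum_n_ext_loc a b n). Qed.

Lemma sum_n_minus_R (a b : nat -> R) n :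
  sum_n (fun k => a k - b k) n = sum_n a n - sum_n b n.
Proof.
  induction n as [|n IH]; [rewrite !sum_O; reflexivity|].
  rewrite !sum_Sn, IH; unfold plus; simpl; ring.
Qed.

Lemma sum_n_telescope (c : nat -> R) n :
  sum_n (fun k => c k - c (S k)) n = c 0%nat - c (S n).
Proof.
  induction n as [|n IH]; [rewrite sum_O; reflexivity|].
  rewrite sum_Sn, IH; unfold plus; simpl; ring.
Qed.

Lemma sum_n_zero (a : nat -> R) n :
  (forall k, (k <= n)%nat -> a k = 0) -> sum_n a n = 0.
Proof.
  intros H; rewrite (sum_n_ext_le a (fun _ => 0) n H), sum_n_const.
  apply Rmult_0_r.
Qed.

Lemma sum_n_single (a : nat -> R) i n :
  (i <= n)%nat -> (forall k, (k <= n)%nat -> k <> i -> a k = 0) -> sum_n a n = a i.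
Proof.
  intros Hi H; induction n as [|n IH].
  - replace i with 0%nat by lia; apply sum_O.
  - rewrite sum_Sn; unfold plus; simpl.
    destruct (Nat.eq_dec i (S n)) as [->|Hne].
    + rewrite sum_n_zero by (intros k Hk; apply H; lia); ring.
    + rewrite IH by first [lia | intros; apply H; lia].
      rewrite (H (S n)) by lia; ring.
Qed.

(** For a <= k <= b this is the product of the (1 - od k ^ 2 / od j ^ 2)^-1 over a <= j <= b with j
    <> k, since [odd_prod a] removes the factors with j < a; for other [k] it is 0. As [a] and [b]
    occur in separate factors, the first and the last summation can be carried out independently. *)
Definition lagrange_term (a b k : nat) : R :=
  (-1) ^ k * odd_prod a (od k) * omega b k / od k.

(** Passing to the shorter range restores a factor 1 - od k ^ 2 / od j ^ 2, with j = a on the left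
    and j = b + 1 on the right; both sides equal [od k ^ 2 * lagrange_term a (S b) k]. *)
Lemma lagrange_term_sub (a b k : nat) :
  od a ^ 2 * (lagrange_term a (S b) k - lagrange_term (S a) (S b) k) =
  od (S b) ^ 2 * (lagrange_term a (S b) k - lagrange_term a b k).
Proof.
  unfold lagrange_term; rewrite !odd_prod_S.
  pose proof (od_neq_0 a); pose proof (od_neq_0 k); pose proof (od_neq_0 (S b)).
  replace (omega b k) with (omega (S b) k * (od (S b) ^ 2 - od k ^ 2) / od (S b) ^ 2)
    by (rewrite omega_succ_b; field; assumption).
  field; auto.
Qed.

Lemma sum_lagrange_diag a N : (a <= N)%nat -> sum_n (lagrange_term a a) N = 1.
Proof.
  intros H; rewrite (sum_n_single _ a N H).
  - unfold lagrange_term.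
    replace ((-1) ^ a * odd_prod a (od a) * omega a a / od a)
      with ((-1) ^ a * (odd_prod a (od a) * omega a a) / od a)
      by (field; apply od_neq_0).
    rewrite odd_prod_omega_diag.
    replace ((-1) ^ a * ((-1) ^ a * od a) / od a) with ((-1) ^ a * (-1) ^ a)
      by (field; apply od_neq_0).
    rewrite <- Rpow_mult_distr; replace (-1 * -1) with 1 by ring; apply pow1.
  - intros k _ Hk; unfold lagrange_term.
    destruct (le_lt_dec a k).
    + rewrite omega_gt by lia; unfold Rdiv; ring.
    + rewrite odd_prod_at_odd_eq_0 by lia; unfold Rdiv; ring.
Qed.

(* Lagrange interpolation of the constant function 1 at the nodes od k ^ 2, a <= k <= b. *)
Lemma sum_lagrange a n N : (a + n <= N)%nat -> sum_n (lagrange_term a (a + n)) N = 1.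
Proof.
  revert a; induction n as [|n IH]; intros a H.
  - rewrite Nat.add_0_r in *; apply sum_lagrange_diag; exact H.
  - replace (a + S n)%nat with (S (a + n)) by lia.
    (* Once the two shorter ranges are known to sum to 1, this is a linear equation for the longer
       one, with leading coefficient [od a ^ 2 - od (S (a + n)) ^ 2], which is not 0. *)
    assert (E : od a ^ 2 * (sum_n (lagrange_term a (S (a + n))) N
                  - sum_n (lagrange_term (S a) (S (a + n))) N) =
                od (S (a + n)) ^ 2 * (sum_n (lagrange_term a (S (a + n))) N
                  - sum_n (lagrange_term a (a + n)) N)).
    { rewrite <- !sum_n_minus_R, <- !sum_n_scal_R.
      apply sum_n_ext; intros k; apply lagrange_term_sub. }
    rewrite (IH a) in E by lia.
    replace (S (a + n)) with (S a + n)%nat in * by lia.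
    rewrite (IH (S a)) in E by lia.
    assert (od a ^ 2 < od (S a + n) ^ 2).
    { pose proof (od_lt a (S a + n) ltac:(lia)); pose proof (od_ge_1 a); nra. }
    nra.
Qed.

Lemma sum_lagrange_gt a b N : (b < a)%nat -> sum_n (lagrange_term a b) N = 0.
Proof.
  intros H; apply sum_n_zero; intros k _; unfold lagrange_term.
  destruct (le_lt_dec a k).
  - rewrite omega_gt by lia; unfold Rdiv; ring.
  - rewrite odd_prod_at_odd_eq_0 by lia; unfold Rdiv; ring.
Qed.

(** The coefficients sum to 1 for a <= b and to 0 for a > b, so the difference in [a] detects a =
    b. *)
Lemma sum_lagrange_orthogonal a b N : (a <= N)%nat -> (b <= N)%nat ->
  sum_n (lagrange_term a b) N - sum_n (lagrange_term (S a) b) N =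
  if Nat.eqb a b then 1 else 0.
Proof.
  intros Ha Hb; destruct (Nat.eqb_spec a b) as [<-|Hne].
  - rewrite sum_lagrange_diag, sum_lagrange_gt by lia; ring.
  - destruct (le_lt_dec a b).
    + replace b with (a + (b - a))%nat at 1 by lia.
      replace b with (S a + (b - S a))%nat at 2 by lia.
      rewrite !sum_lagrange by lia; ring.
    + rewrite !sum_lagrange_gt by lia; ring.
Qed.

(** The terms for a = 0 and a = 1 differ by the factor [od k ^ 2], so this is orthogonality at a =
    0. It expresses that the reciprocal of a product of at least two factors 1 - t / od j ^ 2 decays
    faster than 1 / t. *)
Lemma sum_omega_odd b N : (S b <= N)%nat ->
  sum_n (fun k => (-1) ^ k * omega (S b) k * od k) N = 0.
Proof.
  intros H.
  assert (E : sum_n (lagrange_term 0 (S b)) N - sum_n (lagrange_term 1 (S b)) N = 0).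
  { rewrite sum_lagrange_orthogonal by lia; reflexivity. }
  rewrite <- sum_n_minus_R in E.
  rewrite <- E; apply sum_n_ext; intros k; unfold lagrange_term; rewrite odd_prod_S; simpl odd_prod.
  pose proof (od_neq_0 k); unfold od at 4; simpl; field; assumption.
Qed.

(** * Finite truncations *)

(** Equal to 2 (1 / od 0 ^ 2 + ... + 1 / od k ^ 2) - 1 / od k ^ 2. The recursion shows the
    increments that appear both in the first summation and in the sum over even integers. *)
Fixpoint hsum (k : nat) : R :=
  match k with
  | O => 1
  | S k' => hsum k' + / od k' ^ 2 + / od (S k') ^ 2
  end.

Lemma hsum_S k : hsum (S k) = hsum k + / od k ^ 2 + / od (S k) ^ 2.
Proof. reflexivity. Qed.

Lemma sum_odd_prod_sq k N : (k <= N)%nat ->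
  sum_n (fun a => odd_prod a (od k) / od a ^ 2) N = / od k ^ 2.
Proof.
  intros H; pose proof (od_neq_0 k) as Hk.
  rewrite (sum_n_ext _ (fun a => / od k ^ 2 * (odd_prod a (od k) - odd_prod (S a) (od k)))).
  - rewrite sum_n_scal_R, sum_n_telescope, (odd_prod_at_odd_eq_0 (S N)) by lia.
    simpl odd_prod; as_R; ring.
  - intros a; rewrite odd_prod_S; pose proof (od_neq_0 a); as_R; field; auto.
Qed.

(** With the odd exponent it is the dependence on [k] that telescopes: by [odd_prod_shift], [od k]
    times the sum changes from [k] to [k + 1] by sums with exponent 2, which [sum_odd_prod_sq]
    evaluates. *)
Lemma sum_odd_prod_cube k N : (k <= N)%nat ->
  sum_n (fun a => odd_prod a (od k) / od a ^ 3) N = hsum k / od k.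
Proof.
  induction k as [|k IH]; intros H.
  - rewrite (sum_n_single _ 0 N H).
    + unfold od; simpl; field.
    + intros a _ Ha; rewrite odd_prod_at_odd_eq_0 by lia; unfold Rdiv; ring.
  - pose proof (od_ge_1 k).
    assert (E : od (S k) * sum_n (fun a => odd_prod a (od (S k)) / od a ^ 3) N
                - od k * sum_n (fun a => odd_prod a (od k) / od a ^ 3) N
              = / od k ^ 2 + / od (S k) ^ 2).
    { rewrite <- (sum_odd_prod_sq k N), <- (sum_odd_prod_sq (S k) N) by lia.
      rewrite <- !sum_n_scal_R, <- sum_n_minus_R, <- sum_n_plus_R.
      apply sum_n_ext; intros a; pose proof (od_neq_0 a).
      as_R; pose proof (odd_prod_shift a (od k)) as E; rewrite <- od_S in E.
      replace (od (S k) * (odd_prod a (od (S k)) / od a ^ 3) - od k * (odd_prod a (od k) / od a ^ 3))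
        with ((odd_prod a (od (S k)) * (od (S k) - od a) + odd_prod a (od (S k)) * od a
               - od k * odd_prod a (od k)) / od a ^ 3) by (field; assumption).
      rewrite E; field; assumption. }
    rewrite IH in E by lia.
    replace (od k * (hsum k / od k)) with (hsum k) in E by (field; lra).
    rewrite hsum_S; rewrite od_S in *.
    apply Rmult_eq_reg_l with (od k + 2); [|lra].
    replace ((od k + 2) * ((hsum k + / od k ^ 2 + / (od k + 2) ^ 2) / (od k + 2)))
      with (hsum k + (/ od k ^ 2 + / (od k + 2) ^ 2)) by (field; lra).
    rewrite <- E; ring.
Qed.

Lemma sum_n_m_telescope (F : nat -> R) (U : nat -> R) (a N : nat) :
  (a <= S N)%nat -> U (S N) = 0 ->
  (forall i, (a <= i <= N)%nat -> F (S i) = U i - U (S i)) ->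
  sum_n_m F (S a) (S N) = U a.
Proof.
  intros Ha HU; remember (S N - a)%nat as m eqn:Hm; revert a Ha Hm.
  induction m as [|m IH]; intros a Ha Hm H.
  - replace a with (S N) by lia; rewrite HU.
    apply (sum_n_m_zero F); lia.
  - rewrite sum_Sn_m by lia.
    rewrite (IH (S a)) by first [lia | intros; apply H; lia].
    rewrite H by lia; unfold plus; simpl; ring.
Qed.

Definition omega_sum (N k : nat) : R := sum_n (fun b => omega b k / od b ^ 3) N.

Lemma two_INR_S_sub_1 i : 2 * INR (S i) - 1 = od i.
Proof. unfold od; rewrite S_INR; ring. Qed.

(** The truncated sum for the arguments {2}^n, 3 with indices from [a] on: each 2 contributes
    [/ od k ^ 2], and the final 3 is contained in [omega_sum]. *)
Definition trunc_expansion (N n a : nat) : R :=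
  sum_n (fun k => (-1) ^ k * odd_prod a (od k) / od k * omega_sum N k / od k ^ (2 * n)) N.

Lemma trunc_expansion_end N n : trunc_expansion N n (S N) = 0.
Proof.
  apply sum_n_zero; intros k Hk; rewrite odd_prod_at_odd_eq_0 by lia; unfold Rdiv; ring.
Qed.

Lemma trunc_expansion_0_sub N a : (a <= N)%nat ->
  trunc_expansion N 0 a - trunc_expansion N 0 (S a) = / od a ^ 3.
Proof.
  intros H.
  assert (E : forall c, trunc_expansion N 0 c =
    sum_n (fun b => / od b ^ 3 * sum_n (lagrange_term c b) N) N).
  { intros c; unfold trunc_expansion, omega_sum.
    rewrite (sum_n_ext _ (fun k => sum_n (fun b => / od b ^ 3 * lagrange_term c b k) N)).
    - rewrite sum_n_switch; apply sum_n_ext; intros b.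
      apply sum_n_scal_R.
    - intros k; as_R; simpl pow.
      replace ((-1) ^ k * odd_prod c (od k) / od k *
        sum_n (fun b => omega b k / (od b * (od b * (od b * 1)))) N / 1)
      with ((-1) ^ k * odd_prod c (od k) / od k *
        sum_n (fun b => omega b k / (od b * (od b * (od b * 1)))) N) by (field; apply od_neq_0).
      rewrite <- sum_n_scal_R; apply sum_n_ext; intros b; as_R; unfold lagrange_term.
      pose proof (od_neq_0 b); pose proof (od_neq_0 k); field; auto. }
  rewrite !E, <- sum_n_minus_R, (sum_n_single _ a N H).
  - pose proof (sum_lagrange_orthogonal a a N H H) as O.
    rewrite Nat.eqb_refl in O.
    rewrite <- Rmult_minus_distr_l, O; ring.
  - intros b Hb Hne.
    rewrite <- Rmult_minus_distr_l, sum_lagrange_orthogonal by assumption.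
    destruct (Nat.eqb_spec a b); [congruence|ring].
Qed.

Lemma trunc_expansion_S_sub N n a :
  trunc_expansion N (S n) a - trunc_expansion N (S n) (S a) =
  / od a ^ 2 * trunc_expansion N n a.
Proof.
  unfold trunc_expansion; rewrite <- sum_n_minus_R, <- sum_n_scal_R.
  apply sum_n_ext; intros k; as_R; rewrite odd_prod_S.
  replace (2 * S n)%nat with (S (S (2 * n))) by lia.
  change (od k ^ S (S (2 * n))) with (od k * (od k * od k ^ (2 * n))).
  pose proof (od_neq_0 a); pose proof (od_neq_0 k).
  assert (od k ^ (2 * n) <> 0) by (apply pow_nonzero; assumption).
  field; auto.
Qed.

(** Both sides vanish at a = S N and have the same differences in [a]. The offset by one between the
    two index conventions is that of 2 k - 1 with k >= 1 against [od], which starts at 0. *)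
Lemma tstar_trunc_tail_eq N n a : (a <= S N)%nat ->
  tstar_trunc (S N) (S a) (repeat 2%nat n ++ 3%nat :: nil) = trunc_expansion N n a.
Proof.
  revert a; induction n as [|n IH]; intros a Ha.
  - simpl repeat; simpl app; cbn [tstar_trunc].
    apply sum_n_m_telescope; [exact Ha | apply trunc_expansion_end |].
    intros i Hi; rewrite two_INR_S_sub_1, trunc_expansion_0_sub by lia; ring.
  - simpl repeat; simpl app; cbn [tstar_trunc].
    apply sum_n_m_telescope; [exact Ha | apply trunc_expansion_end |].
    intros i Hi; rewrite two_INR_S_sub_1, trunc_expansion_S_sub, IH by lia; ring.
Qed.

Lemma tstar_trunc_eq N n :
  tstar_trunc (S N) 1 (3%nat :: repeat 2%nat n ++ 3%nat :: nil) =
  sum_n (fun k => (-1) ^ k * hsum k * omega_sum N k / od k ^ (2 * n + 2)) N.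
Proof.
  cbn [tstar_trunc].
  transitivity (sum_n (fun a => / od a ^ 3 * trunc_expansion N n a) N).
  - change 1%nat with (S 0) at 1; rewrite <- sum_n_m_S; unfold sum_n.
    apply sum_n_m_ext_loc; intros i Hi.
    rewrite two_INR_S_sub_1, tstar_trunc_tail_eq by lia; reflexivity.
  - unfold trunc_expansion.
    rewrite (sum_n_ext _ (fun a => sum_n (fun k => / od a ^ 3 * ((-1) ^ k * odd_prod a (od k) /
       od k * omega_sum N k / od k ^ (2 * n))) N))
      by (intros a; symmetry; apply sum_n_scal_R).
    rewrite sum_n_switch; apply sum_n_ext_le; intros k Hk.
    rewrite (sum_n_ext _ (fun a => ((-1) ^ k / od k * omega_sum N k / od k ^ (2 * n)) *
       (odd_prod a (od k) / od a ^ 3))).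
    + rewrite sum_n_scal_R, sum_odd_prod_cube by exact Hk.
      rewrite pow_add; pose proof (od_neq_0 k).
      assert (od k ^ (2 * n) <> 0) by (apply pow_nonzero; assumption).
      field; auto.
    + intros a; as_R; pose proof (od_neq_0 a); pose proof (od_neq_0 k).
      assert (od k ^ (2 * n) <> 0) by (apply pow_nonzero; assumption).
      field; auto.
Qed.

(** * Passage to the limit *)

Lemma Rabs_sign_mult k x : Rabs ((-1) ^ k * x) = Rabs x.
Proof. rewrite Rabs_mult, pow_1_abs; ring. Qed.

Lemma sign_S k : (-1) ^ S k = - (-1) ^ k.
Proof. simpl; ring. Qed.

Lemma is_lim_seq_inv_INR_plus c : is_lim_seq (fun n => / (INR n + c)) 0.
Proof.
  replace (Finite 0) with (Rbar_inv p_infty) by reflexivity.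
  apply is_lim_seq_inv; [|discriminate].
  apply (is_lim_seq_plus _ _ p_infty c); [apply is_lim_seq_INR | apply is_lim_seq_const |].
  reflexivity.
Qed.

Lemma is_series_Rscal (c : R) (a : nat -> R) l :
  is_series a l -> is_series (fun k => c * a k) (c * l).
Proof. exact (is_series_scal_l c a l). Qed.

Lemma ex_series_inv_od_sq : ex_series (fun k => / od k ^ 2).
Proof.
  apply (ex_series_dominated _ (fun k => 2 * (/ (INR k + 1) - / (INR (S k) + 1)))).
  - apply ex_series_scal_R; exists (/ (INR 0 + 1)).
    apply (is_series_telescope (fun k => / (INR k + 1))), is_lim_seq_inv_INR_plus.
  - intros k; unfold od; rewrite S_INR; pose proof (pos_INR k).
    assert (0 < (2 * INR k + 1) ^ 2) by nra.
    rewrite Rabs_pos_eq by (left; apply Rinv_0_lt_compat; assumption).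
    replace (2 * (/ (INR k + 1) - / (INR k + 1 + 1)))
      with (/ ((INR k + 1) * (INR k + 2) / 2)) by (field; lra).
    apply Rinv_le_contravar; nra.
Qed.

Definition lam : R := Series (fun k => / od k ^ 2).

Lemma inv_od_sq_pos k : 0 < / od k ^ 2.
Proof. apply Rinv_0_lt_compat, pow_lt; pose proof (od_ge_1 k); lra. Qed.

(** The subtracted term makes the bound inductive: an increment of [hsum] is at most 4 / (k + 1) - 4
    / (k + 2). *)
Lemma hsum_bounds k : 0 < hsum k <= 5 - 4 / (INR k + 1).
Proof.
  induction k as [|k IH]; [simpl; lra|].
  rewrite hsum_S.
  pose proof (inv_od_sq_pos k); pose proof (inv_od_sq_pos (S k)).
  split; [lra|].
  pose proof (pos_INR k) as Hk.
  assert (/ od k ^ 2 <= / ((INR k + 1) * (INR k + 2) / 2)).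
  { unfold od; apply Rinv_le_contravar; nra. }
  assert (/ od (S k) ^ 2 <= / od k ^ 2).
  { rewrite od_S; pose proof (od_ge_1 k); apply Rinv_le_contravar; nra. }
  assert (4 / (INR k + 1) - 4 / (INR (S k) + 1) = 2 * / ((INR k + 1) * (INR k + 2) / 2)).
  { rewrite S_INR; field; lra. }
  lra.
Qed.

Lemma hsum_le_5 k : Rabs (hsum k) <= 5.
Proof.
  pose proof (hsum_bounds k); pose proof (pos_INR k).
  assert (0 < 4 / (INR k + 1)) by (apply Rdiv_lt_0_compat; lra).
  rewrite Rabs_pos_eq; lra.
Qed.

Lemma omega_succ_b_le b k : omega b k <= omega (S b) k.
Proof.
  destruct (le_lt_dec k b) as [H|H].
  - pose proof (omega_succ_b b k) as E; pose proof (omega_nonneg (S b) k).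
    pose proof (od_lt k (S b) ltac:(lia)); pose proof (od_ge_1 k).
    assert (0 < od (S b) ^ 2) by nra.
    apply Rmult_le_reg_l with (od (S b) ^ 2); [assumption|].
    rewrite <- E; nra.
  - rewrite omega_gt by lia; apply omega_nonneg.
Qed.

Lemma omega_succ_k_le b k : omega b (S k) <= omega b k.
Proof.
  destruct (le_lt_dec k b) as [H|H].
  - pose proof (omega_succ_k b k) as E; pose proof (omega_nonneg b k).
    pose proof (pos_INR k); apply le_INR in H.
    apply Rmult_le_reg_r with (INR b + INR k + 2); [lra|].
    rewrite E; nra.
  - rewrite omega_gt by lia; apply omega_nonneg.
Qed.

(** As [omega b 0] increases with [b], the plain bound 2 would not pass through an induction. The
    bound 2 (b + 1) / (b + 2) does, because 4 (b + 2)^3 - (2 b + 3)^2 (b + 3) = 3 b + 5 is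
    positive. *)
Lemma omega_0_le b : omega b 0 * (INR b + 2) <= 2 * (INR b + 1).
Proof.
  induction b as [|b IH]; [rewrite omega_0_0; simpl; lra|].
  pose proof (omega_succ_b b 0) as E; pose proof (pos_INR b) as Hb.
  unfold od in E; simpl (INR 0) in E; rewrite S_INR in *.
  replace ((2 * (INR b + 1) + 1) ^ 2 - (2 * 0 + 1) ^ 2)
    with (4 * (INR b + 1) * (INR b + 2)) in E by ring.
  apply Rmult_le_reg_l with (4 * (INR b + 1) * (INR b + 2)); [nra|].
  replace (4 * (INR b + 1) * (INR b + 2) * (omega (S b) 0 * (INR b + 1 + 2)))
    with ((omega (S b) 0 * (4 * (INR b + 1) * (INR b + 2))) * (INR b + 3)) by ring.
  rewrite E.
  set (x := INR b) in *.
  apply Rmult_le_reg_l with (x + 2); [lra|].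
  replace ((x + 2) * ((2 * (x + 1) + 1) ^ 2 * omega b 0 * (x + 3)))
    with ((omega b 0 * (x + 2)) * ((2 * (x + 1) + 1) ^ 2 * (x + 3))) by ring.
  apply Rle_trans with (2 * (x + 1) * ((2 * (x + 1) + 1) ^ 2 * (x + 3))).
  - apply Rmult_le_compat_r; [|exact IH].
    apply Rmult_le_pos; [apply pow2_ge_0 | lra].
  - assert (0 <= (x + 1) * (3 * x + 5)) by nra; nra.
Qed.

Lemma omega_le_2 b k : omega b k <= 2.
Proof.
  induction k as [|k IH].
  - pose proof (omega_0_le b); pose proof (pos_INR b); nra.
  - pose proof (omega_succ_k_le b k); lra.
Qed.

Lemma Rabs_omega_le b k : Rabs (omega b k) <= 2.
Proof. rewrite Rabs_pos_eq by apply omega_nonneg; apply omega_le_2. Qed.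

(* kap = 4/PI by Wallis' product, but its value is never needed. *)
Definition kap : R := Lim_seq (fun b => omega b 0).

(** Monotone and bounded for k = 0; the ratio (b - k) / (b + k + 2) of neighbours tends to 1, so all
    [k] share the limit. *)
Lemma is_lim_seq_omega k : is_lim_seq (fun b => omega b k) kap.
Proof.
  induction k as [|k IH].
  - apply (Lim_seq_correct' (fun b => omega b 0)), (ex_finite_lim_seq_incr _ 2).
    + intros b; apply omega_succ_b_le.
    + intros b; apply omega_le_2.
  - apply (is_lim_seq_ext
      (fun b => omega b k * (1 - (2 * INR k + 2) * / (INR b + (INR k + 2))))).
    + intros b; pose proof (omega_succ_k b k) as E.
      pose proof (pos_INR b); pose proof (pos_INR k).
      apply Rmult_eq_reg_r with (INR b + INR k + 2); [|lra].
      rewrite E; field; lra.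
    + replace (Finite kap) with (Finite (kap * (1 - (2 * INR k + 2) * 0))) by (f_equal; ring).
      apply is_lim_seq_mult'; [exact IH|].
      apply is_lim_seq_minus'; [apply is_lim_seq_const|].
      apply is_lim_seq_mult'; [apply is_lim_seq_const|].
      apply is_lim_seq_inv_INR_plus.
Qed.

Lemma Rabs_kap_le : Rabs kap <= 2.
Proof.
  apply (Rabs_limit_le _ _ _ (is_lim_seq_omega 0)); intros b; apply Rabs_omega_le.
Qed.

Lemma omega_div_od3_le b k : Rabs (omega b k / od b ^ 3) <= 2 * / od b ^ 2.
Proof.
  pose proof (od_ge_1 b); pose proof (omega_nonneg b k); pose proof (omega_le_2 b k).
  assert (Hp : 0 < od b ^ 3) by (apply pow_lt; lra).
  rewrite Rabs_pos_eq by (apply Rmult_le_pos; [assumption | left; apply Rinv_0_lt_compat; exact Hp]).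
  unfold Rdiv; apply Rmult_le_compat; try lra.
  - left; apply Rinv_0_lt_compat; exact Hp.
  - apply Rinv_le_contravar; [apply pow_lt; lra|].
    apply Rle_pow; [lra|lia].
Qed.

Definition omega_series (k : nat) : R := Series (fun b => omega b k / od b ^ 3).

Lemma ex_series_2_inv_od_sq : ex_series (fun b => 2 * / od b ^ 2).
Proof. apply ex_series_scal_R, ex_series_inv_od_sq. Qed.

Lemma is_lim_seq_omega_sum k : is_lim_seq (fun N => omega_sum N k) (omega_series k).
Proof.
  apply (Series_correct (fun b => omega b k / od b ^ 3)).
  apply (ex_series_dominated _ _ ex_series_2_inv_od_sq).
  intros b; apply omega_div_od3_le.
Qed.

Lemma sum_n_Rabs_le_Series (a g : nat -> R) N :
  ex_series g -> (forall k, Rabs (a k) <= g k) -> sum_n (fun k => Rabs (a k)) N <= Series g.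
Proof.
  intros Hg H.
  apply Rle_trans with (sum_n g N).
  - rewrite !sum_n_Reals; apply sum_Rle; intros; apply H.
  - apply (is_lim_seq_incr_compare (sum_n g) (Series g)).
    + apply Series_correct; exact Hg.
    + intros n; rewrite sum_Sn; unfold plus; simpl.
      pose proof (H (S n)); pose proof (Rabs_pos (a (S n))); lra.
Qed.

Lemma Rabs_omega_sum_le N k : Rabs (omega_sum N k) <= 2 * lam.
Proof.
  apply Rle_trans with (Series (fun b => 2 * / od b ^ 2)).
  - apply Rle_trans with (sum_n (fun b => Rabs (omega b k / od b ^ 3)) N).
    + unfold omega_sum; rewrite !sum_n_Reals; apply sum_f_R0_triangle.
    + apply sum_n_Rabs_le_Series; [apply ex_series_2_inv_od_sq|].
      intros b; apply omega_div_od3_le.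
  - rewrite Series_scal_l; apply Rle_refl.
Qed.

Lemma omega_sum_gt N k : (N < k)%nat -> omega_sum N k = 0.
Proof.
  intros H; apply sum_n_zero; intros b Hb; rewrite omega_gt by lia; unfold Rdiv; ring.
Qed.

Lemma Series_finite_support (a : nat -> R) N :
  (forall k, (N < k)%nat -> a k = 0) -> Series a = sum_n a N.
Proof.
  intros H; apply is_series_unique, is_series_of_is_lim_seq.
  apply (is_lim_seq_ext_loc (fun _ => sum_n a N)); [|apply is_lim_seq_const].
  exists N; intros n Hn; induction Hn as [|n Hn IH]; [reflexivity|].
  rewrite sum_Sn, <- IH, H by lia; symmetry; apply Rplus_0_r.
Qed.

Lemma Rabs_hsum_mult_div_le k n x C : Rabs x <= C ->
  Rabs ((-1) ^ k * hsum k * x / od k ^ (2 * n + 2)) <= 5 * C * / od k ^ 2.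
Proof.
  intros Hx; unfold Rdiv; rewrite !Rmult_assoc, Rabs_sign_mult, <- Rmult_assoc, !Rabs_mult.
  pose proof (Rabs_pos x); pose proof (Rabs_pos (hsum k)); pose proof (hsum_le_5 k).
  pose proof (od_ge_1 k).
  assert (Hp : 0 < od k ^ (2 * n + 2)) by (apply pow_lt; lra).
  rewrite <- Rmult_assoc; apply Rmult_le_compat.
  - apply Rmult_le_pos; assumption.
  - apply Rabs_pos.
  - apply Rmult_le_compat; assumption.
  - rewrite Rabs_pos_eq by (left; apply Rinv_0_lt_compat; exact Hp).
    apply Rinv_le_contravar; [apply pow_lt; lra | apply Rle_pow; [lra|lia]].
Qed.

(** Since [omega_sum N k] is 0 for k > N, the truncation is already an infinite series in [k], and
    [tannery] applies with a majorant independent of [N]. *)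
Lemma tstar_eq_Series n :
  tstar (3%nat :: repeat 2%nat n ++ 3%nat :: nil) =
  Finite (Series (fun k => (-1) ^ k * hsum k * omega_series k / od k ^ (2 * n + 2))).
Proof.
  apply is_lim_seq_unique, is_lim_seq_incr_1.
  apply (is_lim_seq_ext
    (fun N => Series (fun k => (-1) ^ k * hsum k * omega_sum N k / od k ^ (2 * n + 2)))).
  - intros N; rewrite tstar_trunc_eq; apply Series_finite_support.
    intros k Hk; rewrite omega_sum_gt by exact Hk; unfold Rdiv; ring.
  - apply (tannery _ _ (fun k => 5 * (2 * lam) * / od k ^ 2)).
    + apply ex_series_scal_R, ex_series_inv_od_sq.
    + intros N k; apply Rabs_hsum_mult_div_le, Rabs_omega_sum_le.
    + intros k; unfold Rdiv.
      apply is_lim_seq_mult'; [|apply is_lim_seq_const].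
      apply is_lim_seq_mult'; [apply is_lim_seq_const|].
      apply is_lim_seq_omega_sum.
Qed.

(** * Sums over even integers evaluated at odd squares *)

Lemma is_lim_seq_inv_linear_pow c p :
  is_lim_seq (fun j => / (2 * INR j + c) ^ S p) 0.
Proof.
  apply (is_lim_seq_ext (fun j => (/ 2 * / (INR j + c / 2)) ^ S p)).
  - intros j; rewrite <- Rinv_mult, pow_inv; do 2 f_equal; field.
  - assert (H : is_lim_seq (fun j => / 2 * / (INR j + c / 2)) 0).
    { replace (Finite 0) with (Finite (/ 2 * 0)) by (f_equal; ring).
      apply is_lim_seq_mult'; [apply is_lim_seq_const | apply is_lim_seq_inv_INR_plus]. }
    induction p as [|p IH].
    + apply (is_lim_seq_ext _ _ _ (fun j => eq_sym (pow_1 _))); exact H.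
    + apply (is_lim_seq_ext (fun j => (/ 2 * / (INR j + c / 2)) * (/ 2 * / (INR j + c / 2)) ^ S p)).
      * intros j; reflexivity.
      * replace (Finite 0) with (Finite (0 * 0)) by (f_equal; ring).
        apply is_lim_seq_mult'; assumption.
Qed.

Lemma is_lim_seq_sign_mult_0 (u : nat -> R) :
  is_lim_seq u 0 -> is_lim_seq (fun j => (-1) ^ j * u j) 0.
Proof.
  intros H; apply is_lim_seq_abs_0.
  apply (is_lim_seq_ext (fun j => Rabs (u j))).
  - intros j; symmetry; apply Rabs_sign_mult.
  - apply (is_lim_seq_abs_0 u); exact H.
Qed.

Lemma is_series_Rplus (a b : nat -> R) la lb :
  is_series a la -> is_series b lb -> is_series (fun k => a k + b k) (la + lb).
Proof. exact (is_series_plus a b la lb). Qed.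

Lemma is_series_Rminus (a b : nat -> R) la lb :
  is_series a la -> is_series b lb -> is_series (fun k => a k - b k) (la - lb).
Proof. exact (is_series_minus a b la lb). Qed.

Lemma ev_od_gap j k : 1 <= Rabs (ev j - od k).
Proof.
  unfold ev, od; destruct (le_lt_dec k j) as [H|H].
  - apply le_INR in H; rewrite Rabs_pos_eq; lra.
  - apply (le_INR (S j) k) in H; rewrite S_INR in H; rewrite Rabs_left1; lra.
Qed.

Lemma ev_sub_od_neq_0 j k : ev j - od k <> 0.
Proof. intros E; pose proof (ev_od_gap j k) as H; rewrite E, Rabs_R0 in H; lra. Qed.

Lemma ev_add_od_neq_0 j k : ev j + od k <> 0.
Proof. pose proof (ev_ge_2 j); pose proof (od_ge_1 k); lra. Qed.

(** With L = ev j and m = od k this is 4 L m / (L^2 - m^2)^2, the summand of [Xi] up to the factor 4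
    m, in a form suited to shifts. *)
Definition od_ev_term (k j : nat) : R := / (ev j - od k) ^ 2 - / (ev j + od k) ^ 2.

Lemma od_ev_term_S k j : od_ev_term (S k) j =
  / (ev j - 2 - od k) ^ 2 - / (ev (S j) + od k) ^ 2.
Proof. unfold od_ev_term; rewrite od_S, ev_S; do 3 f_equal; ring. Qed.

(** Raising [k] by one moves the first fraction back and the second one forward by one index of [j].
    The change is a pair of telescoping series whose boundary terms are the increments of [hsum]. *)
Lemma is_series_od_ev k : is_series (od_ev_term k) (hsum k).
Proof.
  induction k as [|k IH].
  - apply (is_series_ext (fun j => / od j ^ 2 - / od (S j) ^ 2)).
    + intros j; unfold od_ev_term, ev, od; rewrite S_INR; simpl (INR 0).
      as_R; f_equal; [|f_equal]; do 2 f_equal; ring.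
    + replace (hsum 0) with (/ od 0 ^ 2) by (unfold od; simpl; field).
      apply (is_series_telescope (fun j => / od j ^ 2)), is_lim_seq_inv_linear_pow.
  - apply (is_series_ext (fun j => od_ev_term k j +
      (/ (ev j - 2 - od k) ^ 2 - / (ev (S j) - 2 - od k) ^ 2) +
      (/ (ev j + od k) ^ 2 - / (ev (S j) + od k) ^ 2))).
    + intros j; rewrite od_ev_term_S; unfold od_ev_term.
      replace (ev (S j) - 2 - od k) with (ev j - od k) by (rewrite ev_S; ring).
      as_R; ring.
    + rewrite hsum_S.
      replace (/ od k ^ 2) with (/ (ev 0 - 2 - od k) ^ 2)
        by (f_equal; unfold ev; simpl (INR 0); ring).
      replace (/ od (S k) ^ 2) with (/ (ev 0 + od k) ^ 2)
        by (f_equal; rewrite od_S; unfold ev; simpl (INR 0); ring).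
      apply is_series_Rplus; [apply is_series_Rplus; [exact IH|]|].
      * apply (is_series_telescope (fun j => / (ev j - 2 - od k) ^ 2)).
        apply (is_lim_seq_ext (fun j => / (2 * INR j + (- od k)) ^ 2)).
        -- intros j; unfold ev; f_equal; ring.
        -- apply is_lim_seq_inv_linear_pow.
      * apply (is_series_telescope (fun j => / (ev j + od k) ^ 2)).
        apply (is_lim_seq_ext (fun j => / (2 * INR j + (2 + od k)) ^ 2)).
        -- intros j; unfold ev; f_equal; ring.
        -- apply is_lim_seq_inv_linear_pow.
Qed.

Definition alt_tail (k : nat) : R := Series (fun i => (-1) ^ i * / od (S k + i) ^ 2).

Lemma od_shift_inv_sq_le k i : / od (k + i) ^ 2 <= / od i ^ 2.
Proof.
  pose proof (od_ge_1 i); pose proof (od_le i (k + i) ltac:(lia)).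
  apply Rinv_le_contravar; [apply pow_lt; lra | apply pow_incr; lra].
Qed.

Lemma Rabs_alt_tail_term_le k i : Rabs ((-1) ^ i * / od (k + i) ^ 2) <= / od i ^ 2.
Proof.
  rewrite Rabs_sign_mult, Rabs_pos_eq by (left; apply inv_od_sq_pos).
  apply od_shift_inv_sq_le.
Qed.

Lemma ex_series_alt_tail k : ex_series (fun i => (-1) ^ i * / od (k + i) ^ 2).
Proof.
  apply (ex_series_dominated _ _ ex_series_inv_od_sq), Rabs_alt_tail_term_le.
Qed.

Lemma Series_alt_od_incr k :
  Series (fun i => (-1) ^ i * / od (k + i) ^ 2) = / od k ^ 2 - alt_tail k.
Proof.
  rewrite Series_incr_1 by apply ex_series_alt_tail.
  rewrite Nat.add_0_r; unfold alt_tail, Rminus.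
  rewrite <- Series_opp; f_equal; [simpl; ring|].
  apply Series_ext; intros i; rewrite sign_S, Nat.add_succ_r; simpl Nat.add; ring.
Qed.

Lemma alt_tail_S k : alt_tail k = / od (S k) ^ 2 - alt_tail (S k).
Proof. unfold alt_tail at 1; apply Series_alt_od_incr. Qed.

Lemma is_lim_seq_alt_tail : is_lim_seq alt_tail 0.
Proof.
  replace (Finite 0) with (Finite (Series (fun _ => 0)))
    by (f_equal; apply is_series_unique, is_series_of_is_lim_seq;
        apply (is_lim_seq_ext (fun _ => 0)); [|apply is_lim_seq_const];
        intros n; symmetry; apply sum_n_zero; reflexivity).
  apply (tannery _ _ (fun i => / od i ^ 2) ex_series_inv_od_sq).
  - intros k i; apply Rabs_alt_tail_term_le.
  - intros i; replace (Finite 0) with (Finite ((-1) ^ i * 0)) by (f_equal; ring).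
    apply is_lim_seq_mult'; [apply is_lim_seq_const|].
    apply (is_lim_seq_ext (fun k => / (2 * INR k + (2 * INR i + 3)) ^ 2)).
    + intros k; unfold od; rewrite plus_INR, S_INR; f_equal; ring.
    + apply is_lim_seq_inv_linear_pow.
Qed.

(** The alternating counterpart of [hsum]. Being built from an infinite tail it tends to 0, which
    singles it out among the solutions of its first-order recurrence. *)
Definition alt_hsum (k : nat) : R := / od k ^ 2 - 2 * alt_tail k.

Lemma alt_hsum_S k : alt_hsum (S k) = / od k ^ 2 - / od (S k) ^ 2 - alt_hsum k.
Proof. unfold alt_hsum; rewrite (alt_tail_S k); ring. Qed.

Lemma is_lim_seq_alt_hsum : is_lim_seq alt_hsum 0.
Proof.
  replace (Finite 0) with (Finite (0 - 2 * 0)) by (f_equal; ring).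
  apply is_lim_seq_minus'; [apply is_lim_seq_inv_linear_pow|].
  apply is_lim_seq_mult'; [apply is_lim_seq_const | apply is_lim_seq_alt_tail].
Qed.

Lemma is_series_alt_od_ev k : is_series (fun j => (-1) ^ j * od_ev_term k j) (alt_hsum k).
Proof.
  induction k as [|k IH].
  - apply (is_series_ext (fun j => (-1) ^ j * / od (0 + j) ^ 2 - (-1) ^ j * / od (1 + j) ^ 2)).
    + intros j; unfold od_ev_term, ev, od; rewrite !plus_INR; simpl (INR 0); change (INR 1) with 1.
      as_R; rewrite <- Rmult_minus_distr_l; f_equal; f_equal; [|f_equal];
      do 2 f_equal; ring.
    + replace (alt_hsum 0) with (Series (fun i => (-1) ^ i * / od (0 + i) ^ 2) - alt_tail 0)
        by (rewrite Series_alt_od_incr; unfold alt_hsum; ring).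
      apply is_series_Rminus; apply Series_correct, ex_series_alt_tail.
  - apply (is_series_ext (fun j =>
      ((-1) ^ j * / (ev j - 2 - od k) ^ 2 - (-1) ^ S j * / (ev (S j) - 2 - od k) ^ 2) -
      ((-1) ^ j * / (ev j + od k) ^ 2 - (-1) ^ S j * / (ev (S j) + od k) ^ 2)
       - (-1) ^ j * od_ev_term k j)).
    + intros j; rewrite od_ev_term_S, sign_S; unfold od_ev_term.
      replace (ev (S j) - 2 - od k) with (ev j - od k) by (rewrite ev_S; ring).
      as_R; ring.
    + rewrite alt_hsum_S.
      replace (/ od k ^ 2) with ((-1) ^ 0 * / (ev 0 - 2 - od k) ^ 2)
        by (rewrite Rmult_1_l; f_equal; unfold ev; simpl (INR 0); ring).
      replace (/ od (S k) ^ 2) with ((-1) ^ 0 * / (ev 0 + od k) ^ 2)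
        by (rewrite Rmult_1_l; f_equal; rewrite od_S; unfold ev; simpl (INR 0); ring).
      apply is_series_Rminus; [apply is_series_Rminus|exact IH].
      * apply (is_series_telescope (fun j => (-1) ^ j * / (ev j - 2 - od k) ^ 2)).
        apply is_lim_seq_sign_mult_0.
        apply (is_lim_seq_ext (fun j => / (2 * INR j + (- od k)) ^ 2)).
        -- intros j; unfold ev; f_equal; ring.
        -- apply is_lim_seq_inv_linear_pow.
      * apply (is_series_telescope (fun j => (-1) ^ j * / (ev j + od k) ^ 2)).
        apply is_lim_seq_sign_mult_0.
        apply (is_lim_seq_ext (fun j => / (2 * INR j + (2 + od k)) ^ 2)).
        -- intros j; unfold ev; f_equal; ring.
        -- apply is_lim_seq_inv_linear_pow.
Qed.

(** By [omega_succ_b], the summand is the increment of [omega] in [b], divided by [od k ^ 2]. *)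
Lemma sum_omega_div_od_sq N k :
  sum_n (fun b => omega b k / od b ^ 2) N = omega N k / od k ^ 2.
Proof.
  induction N as [|N IH].
  - rewrite sum_O; destruct k as [|k]; [reflexivity|].
    rewrite omega_gt by lia; unfold Rdiv; as_R; ring.
  - rewrite sum_n_S_R, IH.
    pose proof (omega_succ_b N k) as E.
    pose proof (od_neq_0 k); pose proof (od_neq_0 (S N)).
    replace (omega N k) with (omega (S N) k * (od (S N) ^ 2 - od k ^ 2) / od (S N) ^ 2)
      by (rewrite E; field; assumption).
    as_R; field; auto.
Qed.

(** The counterpart of [sum_odd_prod_cube] for the last summation: [omega_succ_k] trades a factor
    [od k] for a factor [od b], which lowers the exponent 3 to 2. *)
Lemma omega_sum_rec N k :
  od k * omega_sum N k + od (S k) * omega_sum N (S k) =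
  omega N k / od k ^ 2 - omega N (S k) / od (S k) ^ 2.
Proof.
  rewrite <- !sum_omega_div_od_sq; unfold omega_sum.
  rewrite <- !sum_n_scal_R, <- sum_n_plus_R, <- sum_n_minus_R.
  apply sum_n_ext; intros b; as_R.
  pose proof (od_neq_0 b) as Hb.
  assert (E : od k * omega b k + od (S k) * omega b (S k) = od b * (omega b k - omega b (S k))).
  { pose proof (omega_succ_k b k); rewrite od_S; unfold od; nra. }
  replace (od k * (omega b k / od b ^ 3) + od (S k) * (omega b (S k) / od b ^ 3))
    with ((od k * omega b k + od (S k) * omega b (S k)) / od b ^ 3) by (field; exact Hb).
  rewrite E; field; exact Hb.
Qed.

Lemma omega_series_rec k :
  od k * omega_series k + od (S k) * omega_series (S k) = kap * (/ od k ^ 2 - / od (S k) ^ 2).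
Proof.
  assert (H1 : is_lim_seq (fun N => od k * omega_sum N k + od (S k) * omega_sum N (S k))
    (od k * omega_series k + od (S k) * omega_series (S k))).
  { apply is_lim_seq_plus'; (apply is_lim_seq_mult';
      [apply is_lim_seq_const | apply is_lim_seq_omega_sum]). }
  assert (H2 : is_lim_seq (fun N => od k * omega_sum N k + od (S k) * omega_sum N (S k))
    (kap * / od k ^ 2 - kap * / od (S k) ^ 2)).
  { apply (is_lim_seq_ext _ _ _ (fun N => eq_sym (omega_sum_rec N k))).
    unfold Rdiv; apply is_lim_seq_minus'; (apply is_lim_seq_mult';
      [apply is_lim_seq_omega | apply is_lim_seq_const]). }
  rewrite (is_lim_seq_unique_R _ _ _ H1 H2); ring.
Qed.

(** For k <= b the quotient od k / od b is at most 1, which gives a majorant independent of [k]; for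
    fixed [b] the term is 0 once k > b. *)
Lemma is_lim_seq_od_omega_series : is_lim_seq (fun k => od k * omega_series k) 0.
Proof.
  replace (Finite 0) with (Finite (Series (fun _ => 0)))
    by (f_equal; rewrite (Series_finite_support _ 0) by reflexivity; apply sum_O).
  unfold omega_series.
  apply (is_lim_seq_ext (fun k => Series (fun b => od k * (omega b k / od b ^ 3)))).
  { intros k; apply Series_scal_l. }
  apply (tannery _ _ _ ex_series_2_inv_od_sq).
  - intros k b; destruct (le_lt_dec k b) as [H|H].
    + pose proof (od_le k b H); pose proof (od_ge_1 k); pose proof (omega_nonneg b k).
      pose proof (inv_od_sq_pos b); pose proof (omega_le_2 b k).
      replace (od k * (omega b k / od b ^ 3)) with ((od k / od b * omega b k) * / od b ^ 2)
        by (field; lra).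
      assert (0 <= od k / od b <= 1).
      { split; [apply Rdiv_le_0_compat; lra|].
        apply Rmult_le_reg_r with (od b); [lra|]; unfold Rdiv.
        rewrite Rmult_assoc, Rinv_l by lra; lra. }
      rewrite Rabs_pos_eq by (apply Rmult_le_pos; [apply Rmult_le_pos|]; lra).
      apply Rmult_le_compat_r; [lra|nra].
    + rewrite omega_gt by exact H; unfold Rdiv.
      rewrite Rmult_0_l, Rmult_0_r, Rabs_R0; pose proof (inv_od_sq_pos b); lra.
  - intros b; apply (is_lim_seq_ext_loc (fun _ => 0)); [|apply is_lim_seq_const].
    exists (S b); intros k Hk; rewrite omega_gt by lia; unfold Rdiv; ring.
Qed.

(* Both sides satisfy the same recurrence u_k + u_(k+1) = known, so their difference
   alternates in sign with constant modulus; it vanishes because both tend to 0. *)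
Lemma od_omega_series k : od k * omega_series k = kap * alt_hsum k.
Proof.
  set (delta := fun k => od k * omega_series k - kap * alt_hsum k).
  assert (Hrec : forall k, delta k = (-1) ^ k * delta 0%nat).
  { intros i; induction i as [|i IH]; [simpl; ring|].
    rewrite sign_S; replace (delta (S i)) with (- delta i); [rewrite IH; ring|].
    unfold delta; pose proof (omega_series_rec i); rewrite alt_hsum_S.
    nra. }
  assert (Hlim : is_lim_seq delta 0).
  { replace (Finite 0) with (Finite (0 - kap * 0)) by (f_equal; ring).
    apply is_lim_seq_minus'; [apply is_lim_seq_od_omega_series|].
    apply is_lim_seq_mult'; [apply is_lim_seq_const | apply is_lim_seq_alt_hsum]. }
  assert (H0 : Rabs (delta 0%nat) = 0).
  { apply is_lim_seq_abs_0 in Hlim.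
    apply (is_lim_seq_ext _ (fun _ => Rabs (delta 0%nat))) in Hlim.
    - apply (is_lim_seq_unique_R _ _ _ (is_lim_seq_const _) Hlim).
    - intros i; rewrite Hrec; apply Rabs_sign_mult. }
  assert (E : delta k = 0).
  { rewrite Hrec; destruct (Req_dec (delta 0%nat) 0) as [->|Hne]; [ring|].
    apply Rabs_no_R0 in Hne; contradiction. }
  unfold delta in E; lra.
Qed.

(** * The secant as a partial fraction series *)

Definition off_poles (t : R) : Prop :=
  exists delta, 0 < delta /\ forall k, delta <= Rabs (od k ^ 2 - t).

Lemma off_poles_neq_0 t k : off_poles t -> od k ^ 2 - t <> 0.
Proof.
  intros [d [Hd H]] E; specialize (H k); rewrite E, Rabs_R0 in H; lra.
Qed.

Lemma off_poles_bound t : off_poles t ->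
  exists C, 0 < C /\ forall k, Rabs (/ (od k ^ 2 - t)) <= C * / od k ^ 2.
Proof.
  (* The constant comes from od k ^ 2 <= |od k ^ 2 - t| + |t| and |t| <= (|t| / d) |od k ^ 2 -
     t|. *)
  intros Ht; pose proof Ht as [d [Hd H]]; exists (1 + Rabs t / d).
  pose proof (Rabs_pos t).
  assert (0 <= Rabs t / d) by (apply Rdiv_le_0_compat; lra).
  split; [lra|]; intros k; specialize (H k).
  pose proof (off_poles_neq_0 t k Ht) as Hne.
  pose proof (od_ge_1 k) as Hk.
  assert (Hp : 0 < od k ^ 2) by nra.
  rewrite Rabs_inv.
  apply Rmult_le_reg_r with (Rabs (od k ^ 2 - t) * od k ^ 2);
    [apply Rmult_lt_0_compat; lra|].
  replace (/ Rabs (od k ^ 2 - t) * (Rabs (od k ^ 2 - t) * od k ^ 2)) with (od k ^ 2)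
    by (field; lra).
  replace ((1 + Rabs t / d) * / od k ^ 2 * (Rabs (od k ^ 2 - t) * od k ^ 2))
    with (Rabs (od k ^ 2 - t) + Rabs t / d * Rabs (od k ^ 2 - t)) by (field; lra).
  apply Rle_trans with (Rabs (od k ^ 2 - t) + Rabs t).
  - replace (od k ^ 2) with ((od k ^ 2 - t) + t) at 1 by ring.
    apply Rle_trans with (2 := Rabs_triang _ _).
    apply Rle_abs.
  - apply Rplus_le_compat_l.
    replace (Rabs t) with (Rabs t / d * d) at 1 by (field; lra).
    apply Rmult_le_compat_l; lra.
Qed.

Lemma off_poles_le t : t <= / 2 -> off_poles t.
Proof.
  intros H; exists (/ 2); split; [lra|]; intros k.
  pose proof (od_ge_1 k); rewrite Rabs_pos_eq; nra.
Qed.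

Lemma off_poles_ev j : off_poles (ev j ^ 2).
Proof.
  exists 1; split; [lra|]; intros k.
  replace (od k ^ 2 - ev j ^ 2) with (- ((ev j - od k) * (ev j + od k))) by ring.
  rewrite Rabs_Ropp, Rabs_mult.
  pose proof (ev_od_gap j k); pose proof (ev_ge_2 j); pose proof (od_ge_1 k).
  rewrite (Rabs_pos_eq (ev j + od k)) by lra; nra.
Qed.

Definition sec_term (t : R) (k : nat) : R := kap * ((-1) ^ k * / (od k * (od k ^ 2 - t))).

(* By Mittag-Leffler, [secant (x ^ 2)] is the secant of PI x / 2. *)
Definition secant (t : R) : R := 1 + t * Series (sec_term t).

(** The polar part of [secant] at [od k ^ 2] is [G k / (od k ^ 2 - t)]. The series of these
    converges only conditionally, whence the subtraction at t = 0 in [secant] and the divided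
    differences below. *)
Definition G (k : nat) : R := kap * ((-1) ^ k * od k).

Lemma Rabs_inv_od_mult_le k x : Rabs (/ (od k * x)) <= Rabs (/ x).
Proof.
  rewrite Rinv_mult, Rabs_mult.
  apply Rle_trans with (1 * Rabs (/ x)); [|lra].
  apply Rmult_le_compat_r; [apply Rabs_pos|].
  pose proof (od_ge_1 k); rewrite Rabs_inv, Rabs_pos_eq by lra.
  rewrite <- Rinv_1; apply Rinv_le_contravar; lra.
Qed.

Lemma sign_omega_term_le (t C : R) b k :
  (forall k, Rabs (/ (od k ^ 2 - t)) <= C * / od k ^ 2) -> Rabs b <= 2 ->
  Rabs (b * ((-1) ^ k * / (od k * (od k ^ 2 - t)))) <= 2 * C * / od k ^ 2.
Proof.
  intros HC Hb; rewrite Rabs_mult, Rabs_sign_mult, Rmult_assoc.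
  apply Rmult_le_compat; try apply Rabs_pos; [exact Hb|].
  apply Rle_trans with (1 := Rabs_inv_od_mult_le k _); apply HC.
Qed.

Lemma ex_series_C_inv_od_sq C : ex_series (fun k => C * / od k ^ 2).
Proof. apply ex_series_scal_R, ex_series_inv_od_sq. Qed.

Lemma ex_series_sec_term t : off_poles t -> ex_series (sec_term t).
Proof.
  intros Ht; destruct (off_poles_bound t Ht) as [C [HC0 HC]].
  apply (ex_series_dominated _ _ (ex_series_C_inv_od_sq (2 * C))).
  intros k; apply sign_omega_term_le; [exact HC | apply Rabs_kap_le].
Qed.

Lemma is_series_secant_diff a b : off_poles a -> off_poles b -> a <> b ->
  is_series (fun k => G k * / ((od k ^ 2 - a) * (od k ^ 2 - b)))
    ((secant a - secant b) / (a - b)).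
Proof.
  intros Ha Hb Hab.
  apply (is_series_ext (fun k => / (a - b) * (a * sec_term a k - b * sec_term b k))).
  - intros k; unfold sec_term, G.
    pose proof (off_poles_neq_0 a k Ha); pose proof (off_poles_neq_0 b k Hb).
    pose proof (od_neq_0 k); as_R; field; repeat split; trivial; lra.
  - replace ((secant a - secant b) / (a - b))
      with (/ (a - b) * (a * Series (sec_term a) - b * Series (sec_term b)))
      by (unfold secant; field; lra).
    apply is_series_Rscal, is_series_Rminus; apply is_series_Rscal, Series_correct,
      ex_series_sec_term; assumption.
Qed.

(** * Partial fractions of the reciprocal product, and values of the secant *)

Fixpoint odd_prod_sq (a : nat) (t : R) : R :=
  match a with
  | O => 1
  | S a' => odd_prod_sq a' t * (1 - t / od a' ^ 2)
  end.

Lemma odd_prod_eq a x : odd_prod a x = odd_prod_sq a (x ^ 2).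
Proof. induction a as [|a IH]; [reflexivity|]; rewrite odd_prod_S, IH; reflexivity. Qed.

Definition pole_sum (N b : nat) (t : R) : R :=
  sum_n (fun k => (-1) ^ k * omega b k * od k / (od k ^ 2 - t)) N.

(** In od (S b) ^ 2 - t = (od (S b) ^ 2 - od k ^ 2) + (od k ^ 2 - t) the first part lowers [b] in
    [omega], and the second cancels the denominator and sums to 0 by [sum_omega_odd]. *)
Lemma pole_sum_S N b t : off_poles t -> (S b <= N)%nat ->
  pole_sum N (S b) t * (1 - t / od (S b) ^ 2) = pole_sum N b t.
Proof.
  intros Ht H; unfold pole_sum.
  pose proof (sum_omega_odd b N H) as E.
  replace (sum_n (fun k => (-1) ^ k * omega b k * od k / (od k ^ 2 - t)) N) with
    (sum_n (fun k => (-1) ^ k * omega b k * od k / (od k ^ 2 - t)) N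
     + / od (S b) ^ 2 * sum_n (fun k => (-1) ^ k * omega (S b) k * od k) N)
    by (rewrite E; ring).
  rewrite Rmult_comm, <- !sum_n_scal_R, <- sum_n_plus_R.
  apply sum_n_ext; intros k; as_R.
  pose proof (off_poles_neq_0 t k Ht); pose proof (od_neq_0 (S b)).
  replace (omega b k) with (omega (S b) k * (od (S b) ^ 2 - od k ^ 2) / od (S b) ^ 2)
    by (rewrite omega_succ_b; field; assumption).
  field; auto.
Qed.

Lemma pole_sum_odd_prod_sq N b t : off_poles t -> (b <= N)%nat ->
  pole_sum N b t * odd_prod_sq (S b) t = 1.
Proof.
  intros Ht; induction b as [|b IH]; intros H.
  - unfold pole_sum; rewrite (sum_n_single _ 0 N H).
    + change (odd_prod_sq 1 t) with (1 * (1 - t / od 0 ^ 2)).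
      pose proof (off_poles_neq_0 t 0 Ht) as Hne.
      rewrite omega_0_0, od_0, pow1 in *; simpl pow; field; lra.
    + intros k _ Hk; rewrite omega_gt by lia; unfold Rdiv; ring.
  - specialize (IH ltac:(lia)); rewrite <- (pole_sum_S N b t Ht H) in IH.
    rewrite <- IH.
    change (odd_prod_sq (S (S b)) t) with (odd_prod_sq (S b) t * (1 - t / od (S b) ^ 2)).
    ring.
Qed.

(** The value at t = 0, which is 1 by Lagrange interpolation, is split off because the remaining
    terms have a summable majorant independent of [b]. *)
Lemma pole_sum_eq b t : off_poles t ->
  pole_sum b b t = 1 + t * Series (fun k => omega b k * ((-1) ^ k * / (od k * (od k ^ 2 - t)))).
Proof.
  intros Ht.
  rewrite (Series_finite_support _ b) by (intros k Hk; rewrite omega_gt by exact Hk; ring).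
  rewrite <- (sum_lagrange 0 b b) by lia.
  rewrite <- sum_n_scal_R, <- sum_n_plus_R.
  apply sum_n_ext; intros k; as_R; unfold lagrange_term; simpl odd_prod; simpl Nat.add.
  pose proof (off_poles_neq_0 t k Ht); pose proof (od_neq_0 k).
  field; auto.
Qed.

Lemma is_lim_seq_pole_sum t : off_poles t ->
  is_lim_seq (fun b => pole_sum b b t) (secant t).
Proof.
  intros Ht.
  apply (is_lim_seq_ext _ _ _ (fun b => eq_sym (pole_sum_eq b t Ht))).
  destruct (off_poles_bound t Ht) as [C [HC0 HC]].
  apply is_lim_seq_plus'; [apply is_lim_seq_const|].
  apply is_lim_seq_mult'; [apply is_lim_seq_const|].
  apply (tannery _ _ _ (ex_series_C_inv_od_sq (2 * C))).
  - intros b k; apply sign_omega_term_le; [exact HC | apply Rabs_omega_le].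
  - intros k; apply is_lim_seq_mult'; [apply is_lim_seq_omega | apply is_lim_seq_const].
Qed.

Lemma secant_mult_limit (t l : R) : off_poles t ->
  is_lim_seq (fun b => odd_prod_sq (S b) t) l -> secant t * l = 1.
Proof.
  intros Ht Hl.
  apply (is_lim_seq_unique_R (fun _ => 1)); [|apply is_lim_seq_const].
  apply (is_lim_seq_ext _ _ _ (fun b => pole_sum_odd_prod_sq b b t Ht (le_n b))).
  apply is_lim_seq_mult'; [apply is_lim_seq_pole_sum; exact Ht | exact Hl].
Qed.

(** The value cos (pi l): a shift of the argument by 2 multiplies the product by a ratio that tends
    to -1. *)
Lemma is_lim_seq_odd_prod_even l :
  is_lim_seq (fun a => odd_prod a (2 * INR l)) ((-1) ^ l).
Proof.
  induction l as [|l IH].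
  - apply (is_lim_seq_ext (fun _ => 1)); [|apply is_lim_seq_const].
    intros a; induction a as [|a IHa]; [reflexivity|].
    rewrite odd_prod_S, <- IHa; simpl; unfold Rdiv; ring.
  - apply (is_lim_seq_ext (fun a => odd_prod a (2 * INR l) *
      (- 1 - (2 * (2 * INR l) + 2) * / (2 * INR a + (- (2 * INR l) - 1)) ^ 1))).
    + intros a; pose proof (odd_prod_shift a (2 * INR l)) as E.
      pose proof (ev_sub_od_neq_0 l a) as Hne.
      replace (2 * INR (S l)) with (2 * INR l + 2) by (rewrite S_INR; ring).
      apply Rmult_eq_reg_r with (2 * INR l + 2 - od a); [|exact Hne].
      rewrite E; unfold ev, od in *; field; lra.
    + replace (Finite ((-1) ^ S l))
        with (Finite ((-1) ^ l * (-1 - (2 * (2 * INR l) + 2) * 0))) by (f_equal; simpl; ring).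
      apply is_lim_seq_mult'; [exact IH|].
      apply is_lim_seq_minus'; [apply is_lim_seq_const|].
      apply is_lim_seq_mult'; [apply is_lim_seq_const|].
      apply is_lim_seq_inv_linear_pow.
Qed.

Lemma sign_sqr k : (-1) ^ k * (-1) ^ k = 1.
Proof. rewrite <- Rpow_mult_distr; replace (-1 * -1) with 1 by ring; apply pow1. Qed.

Lemma secant_ev j : secant (ev j ^ 2) = (-1) ^ S j.
Proof.
  assert (H : secant (ev j ^ 2) * (-1) ^ S j = 1).
  { apply secant_mult_limit; [apply off_poles_ev|].
    apply (is_lim_seq_incr_1 (fun b => odd_prod_sq b (ev j ^ 2))).
    apply (is_lim_seq_ext (fun a => odd_prod a (2 * INR (S j)))).
    - intros a; rewrite odd_prod_eq; do 2 f_equal; unfold ev; rewrite S_INR; ring.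
    - apply is_lim_seq_odd_prod_even. }
  rewrite <- (Rmult_1_r (secant _)), <- (sign_sqr (S j)), <- Rmult_assoc, H; ring.
Qed.

(** From [l] to [l + 1] one family of fractions moves back and the other forward by one index, so
    the alternating sign flips. The hypothesis on [e], met by -1 for even and by 1 for odd
    exponents, makes the boundary terms cancel. *)
Lemma is_series_sign_shift (p : nat) (e s : R) :
  (forall y, / (- y) ^ S p + e * / y ^ S p = 0) ->
  is_series (fun k => (-1) ^ k * ((1 + e) * / od k ^ S p)) s ->
  forall l, is_series (fun k => (-1) ^ k * (/ (od k - 2 * INR l) ^ S p
                                  + e * / (od k + 2 * INR l) ^ S p)) ((-1) ^ l * s).
Proof.
  intros He Hs l; induction l as [|l IH].
  - apply (is_series_ext (fun k => (-1) ^ k * ((1 + e) * / od k ^ S p))).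
    + intros k; simpl (INR 0); rewrite Rmult_0_r, Rminus_0_r, Rplus_0_r; as_R; ring.
    + rewrite Rmult_1_l; exact Hs.
  - apply (is_series_ext (fun k =>
      ((-1) ^ k * / (od k - 2 * INR l - 2) ^ S p - (-1) ^ S k * / (od (S k) - 2 * INR l - 2) ^ S p)
      + e * ((-1) ^ k * / (od k + 2 * INR l) ^ S p - (-1) ^ S k * / (od (S k) + 2 * INR l) ^ S p)
      - (-1) ^ k * (/ (od k - 2 * INR l) ^ S p + e * / (od k + 2 * INR l) ^ S p))).
    + intros k; rewrite !sign_S, (S_INR l).
      replace (od (S k) - 2 * INR l - 2) with (od k - 2 * INR l) by (rewrite od_S; ring).
      replace (od k - 2 * (INR l + 1)) with (od k - 2 * INR l - 2) by ring.
      replace (od k + 2 * (INR l + 1)) with (od (S k) + 2 * INR l) by (rewrite od_S; ring).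
      as_R; ring.
    + replace ((-1) ^ S l * s) with (((-1) ^ 0 * / (od 0 - 2 * INR l - 2) ^ S p
        + e * ((-1) ^ 0 * / (od 0 + 2 * INR l) ^ S p)) - (-1) ^ l * s).
      * apply is_series_Rminus; [|exact IH].
        apply is_series_Rplus; [|apply is_series_Rscal].
        -- apply (is_series_telescope (fun k => (-1) ^ k * / (od k - 2 * INR l - 2) ^ S p)).
           apply is_lim_seq_sign_mult_0.
           apply (is_lim_seq_ext (fun k => / (2 * INR k + (1 - 2 * INR l - 2)) ^ S p)).
           ++ intros k; unfold od; do 2 f_equal; ring.
           ++ apply is_lim_seq_inv_linear_pow.
        -- apply (is_series_telescope (fun k => (-1) ^ k * / (od k + 2 * INR l) ^ S p)).
           apply is_lim_seq_sign_mult_0.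
           apply (is_lim_seq_ext (fun k => / (2 * INR k + (1 + 2 * INR l)) ^ S p)).
           ++ intros k; unfold od; do 2 f_equal; ring.
           ++ apply is_lim_seq_inv_linear_pow.
      * rewrite sign_S, !Rmult_1_l.
        replace (od 0 - 2 * INR l - 2) with (- (2 * INR l + 1)) by (unfold od; simpl (INR 0); ring).
        replace (od 0 + 2 * INR l) with (2 * INR l + 1) by (unfold od; simpl (INR 0); ring).
        rewrite He; ring.
Qed.

(** * Taylor coefficients of the secant at the even squares *)

Definition beta3 : R := Series (fun k => (-1) ^ k * / od k ^ 3).

Lemma inv_od_pow_le k p : (2 <= p)%nat -> Rabs (/ od k ^ p) <= / od k ^ 2.
Proof.
  intros Hp; pose proof (od_ge_1 k).
  rewrite Rabs_pos_eq by (left; apply Rinv_0_lt_compat, pow_lt; lra).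
  apply Rinv_le_contravar; [apply pow_lt; lra | apply Rle_pow; [lra|exact Hp]].
Qed.

Lemma ex_series_sign_inv_od_pow p : (2 <= p)%nat -> ex_series (fun k => (-1) ^ k * / od k ^ p).
Proof.
  intros Hp; apply (ex_series_dominated _ _ ex_series_inv_od_sq).
  intros k; rewrite Rabs_sign_mult; apply inv_od_pow_le; exact Hp.
Qed.

Lemma is_series_0 : is_series (fun _ => 0) 0.
Proof.
  apply is_series_of_is_lim_seq, (is_lim_seq_ext (fun _ => 0)); [|apply is_lim_seq_const].
  intros n; symmetry; apply sum_n_zero; reflexivity.
Qed.

Lemma Rinv_opp_even y p : / (- y) ^ (2 * p) = / y ^ (2 * p).
Proof. rewrite !pow_mult; do 2 f_equal; ring. Qed.

Lemma is_series_ev_diff j p :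
  is_series (fun k => (-1) ^ k * (/ (od k - ev j) ^ (2 * S p) - / (od k + ev j) ^ (2 * S p))) 0.
Proof.
  replace (2 * S p)%nat with (S (2 * p + 1)) by lia.
  apply (is_series_ext (fun k => (-1) ^ k * (/ (od k - 2 * INR (S j)) ^ S (2 * p + 1)
     + -1 * / (od k + 2 * INR (S j)) ^ S (2 * p + 1)))).
  - intros k; replace (2 * INR (S j)) with (ev j) by (unfold ev; rewrite S_INR; ring); as_R; ring.
  - replace 0 with ((-1) ^ S j * 0) by ring; apply is_series_sign_shift.
    + intros y; replace (S (2 * p + 1)) with (2 * S p)%nat by lia.
      rewrite Rinv_opp_even; ring.
    + apply (is_series_ext (fun _ => 0)); [|apply is_series_0].
      intros k; as_R; ring.
Qed.

Lemma is_series_ev_cube j :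
  is_series (fun k => (-1) ^ k * (/ (od k - ev j) ^ 3 + / (od k + ev j) ^ 3))
    ((-1) ^ S j * (2 * beta3)).
Proof.
  apply (is_series_ext (fun k => (-1) ^ k * (/ (od k - 2 * INR (S j)) ^ 3
     + 1 * / (od k + 2 * INR (S j)) ^ 3))).
  - intros k; replace (2 * INR (S j)) with (ev j) by (unfold ev; rewrite S_INR; ring); as_R; ring.
  - apply is_series_sign_shift.
    + intros y; replace ((- y) ^ 3) with (- y ^ 3) by ring; rewrite Rinv_opp; ring.
    + apply (is_series_ext (fun k => 2 * ((-1) ^ k * / od k ^ 3))).
      * intros k; as_R; ring.
      * apply is_series_Rscal, Series_correct, ex_series_sign_inv_od_pow; lia.
Qed.

(** Both sides are the coefficient of t in the product of the (1 - t / od j ^ 2)^-1 over j <= b,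
    once from its partial fractions and once from its factors. *)
Lemma sum_sign_omega_cube N b : (b <= N)%nat ->
  sum_n (fun k => omega b k * ((-1) ^ k * / od k ^ 3)) N = sum_n (fun j => / od j ^ 2) b.
Proof.
  induction b as [|b IH]; intros H.
  - rewrite (sum_n_single _ 0 N H), sum_O, omega_0_0.
    + unfold od; simpl; field.
    + intros k _ Hk; rewrite omega_gt by lia; ring.
  - rewrite sum_n_S_R, <- IH by lia.
    rewrite <- (Rmult_1_r (/ od (S b) ^ 2)), <- (sum_lagrange 0 (S b) N) by lia.
    rewrite <- sum_n_scal_R, <- sum_n_plus_R.
    apply sum_n_ext; intros k; as_R; unfold lagrange_term; simpl odd_prod; simpl Nat.add.
    pose proof (od_neq_0 k); pose proof (od_neq_0 (S b)).
    replace (omega b k) with (omega (S b) k * (od (S b) ^ 2 - od k ^ 2) / od (S b) ^ 2)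
      by (rewrite omega_succ_b; field; assumption).
    field; auto.
Qed.

Lemma kap_beta3 : kap * beta3 = lam.
Proof.
  unfold beta3; rewrite <- Series_scal_l.
  apply (is_lim_seq_unique_R (fun b => Series (fun k => omega b k * ((-1) ^ k * / od k ^ 3)))).
  - apply (tannery _ _ _ ex_series_2_inv_od_sq).
    + intros b k; rewrite Rabs_mult, Rabs_sign_mult.
      apply Rmult_le_compat; try apply Rabs_pos; [apply Rabs_omega_le|].
      apply inv_od_pow_le; lia.
    + intros k; apply is_lim_seq_mult'; [apply is_lim_seq_omega | apply is_lim_seq_const].
  - apply (is_lim_seq_ext (sum_n (fun j => / od j ^ 2))).
    + intros b; rewrite (Series_finite_support _ b).
      * symmetry; apply sum_sign_omega_cube; lia.
      * intros k Hk; rewrite omega_gt by exact Hk; ring.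
    + exact (Series_correct _ ex_series_inv_od_sq).
Qed.

Lemma od_sub_ev_neq_0 k j : od k - ev j <> 0.
Proof. pose proof (ev_sub_od_neq_0 j k); lra. Qed.

Lemma od_add_ev_neq_0 k j : od k + ev j <> 0.
Proof. pose proof (ev_add_od_neq_0 j k); lra. Qed.

Lemma ev_neq_0 j : ev j <> 0.
Proof. pose proof (ev_ge_2 j); lra. Qed.

Lemma od_sq_sub_ev_sq k j : od k ^ 2 - ev j ^ 2 = (od k - ev j) * (od k + ev j).
Proof. ring. Qed.

(** The first derivative of [secant] at [ev j ^ 2]. Partial fractions in [od k] turn the summand
    into a difference of even powers, to which [is_series_ev_diff] applies. *)
Lemma is_series_G_sq j : is_series (fun k => G k * / (od k ^ 2 - ev j ^ 2) ^ 2) 0.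
Proof.
  replace 0 with (kap / (4 * ev j) * 0) by ring.
  apply (is_series_ext (fun k => kap / (4 * ev j) *
    ((-1) ^ k * (/ (od k - ev j) ^ (2 * 1) - / (od k + ev j) ^ (2 * 1))))).
  - intros k; unfold G; rewrite od_sq_sub_ev_sq; simpl Nat.mul.
    pose proof (od_sub_ev_neq_0 k j); pose proof (od_add_ev_neq_0 k j); pose proof (ev_neq_0 j).
    as_R; field; auto.
  - apply is_series_Rscal, is_series_ev_diff.
Qed.

(** The second Taylor coefficient. The weights are those of od k / (od k ^ 2 - ev j ^ 2) ^ 3 in
    powers of 1 / (od k - ev j) and 1 / (od k + ev j); only the cubes contribute, through
    [kap_beta3]. *)
Lemma is_series_G_cube j :
  is_series (fun k => G k * / (od k ^ 2 - ev j ^ 2) ^ 3) ((-1) ^ S j * lam / (4 * ev j ^ 2)).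
Proof.
  pose proof (ev_neq_0 j).
  replace ((-1) ^ S j * lam / (4 * ev j ^ 2))
    with (kap / (8 * ev j ^ 2) * ((-1) ^ S j * (2 * beta3)) - kap / (16 * ev j ^ 3) * 0)
    by (rewrite <- kap_beta3; field; assumption).
  apply (is_series_ext (fun k => kap / (8 * ev j ^ 2) *
      ((-1) ^ k * (/ (od k - ev j) ^ 3 + / (od k + ev j) ^ 3))
    - kap / (16 * ev j ^ 3) *
      ((-1) ^ k * (/ (od k - ev j) ^ (2 * 1) - / (od k + ev j) ^ (2 * 1))))).
  - intros k; unfold G; rewrite od_sq_sub_ev_sq; simpl Nat.mul.
    pose proof (od_sub_ev_neq_0 k j); pose proof (od_add_ev_neq_0 k j).
    as_R; field; auto.
  - apply is_series_Rminus; apply is_series_Rscal;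
      [apply is_series_ev_cube | apply is_series_ev_diff].
Qed.

Lemma is_series_G_fourth j :
  is_series (fun k => G k * / (od k ^ 2 - ev j ^ 2) ^ 4)
    (- ((-1) ^ S j * lam / (8 * ev j ^ 4))).
Proof.
  pose proof (ev_neq_0 j).
  replace (- ((-1) ^ S j * lam / (8 * ev j ^ 4)))
    with (kap / (16 * ev j ^ 3) * 0 - kap / (16 * ev j ^ 4) * ((-1) ^ S j * (2 * beta3))
          + kap / (32 * ev j ^ 5) * 0)
    by (rewrite <- kap_beta3; field; assumption).
  apply (is_series_ext (fun k => kap / (16 * ev j ^ 3) *
      ((-1) ^ k * (/ (od k - ev j) ^ (2 * 2) - / (od k + ev j) ^ (2 * 2)))
    - kap / (16 * ev j ^ 4) *
      ((-1) ^ k * (/ (od k - ev j) ^ 3 + / (od k + ev j) ^ 3))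
    + kap / (32 * ev j ^ 5) *
      ((-1) ^ k * (/ (od k - ev j) ^ (2 * 1) - / (od k + ev j) ^ (2 * 1))))).
  - intros k; unfold G; rewrite od_sq_sub_ev_sq; simpl Nat.mul.
    pose proof (od_sub_ev_neq_0 k j); pose proof (od_add_ev_neq_0 k j).
    as_R; field; auto.
  - apply is_series_Rplus; [apply is_series_Rminus|]; apply is_series_Rscal;
      first [apply is_series_ev_cube | apply is_series_ev_diff].
Qed.

(** * Comparison with the hyperbolic cosine *)

Definition cosh_cos (x : R) (n : nat) (u : R) : R := cosh (x * u) * cos u ^ n.

(** The recurrence of these integrals in steps of 2 generates the product of the 1 + x^2 / od j ^ 2.
    Divided by their value at x = 0 they tend to 1, as high powers of the cosine concentrate at u =
    0. *)
Definition cosh_cos_int (x : R) (n : nat) : R := RInt (cosh_cos x n) 0 (PI / 2).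

Lemma continuous_cosh_cos x n u : continuous (cosh_cos x n) u.
Proof.
  apply (ex_derive_continuous (cosh_cos x n)).
  unfold cosh_cos, cosh; auto_derive; trivial.
Qed.

Lemma is_RInt_unique_R (f : R -> R) (a b l l' : R) :
  is_RInt f a b l -> is_RInt f a b l' -> l = l'.
Proof.
  intros H H'; rewrite <- (is_RInt_unique (V := R_CompleteNormedModule) f a b l H).
  apply (is_RInt_unique (V := R_CompleteNormedModule)); exact H'.
Qed.

Lemma is_RInt_cosh_cos x n : is_RInt (cosh_cos x n) 0 (PI / 2) (cosh_cos_int x n).
Proof.
  apply (RInt_correct (cosh_cos x n)), (ex_RInt_continuous (cosh_cos x n)).
  intros; apply continuous_cosh_cos.
Qed.

Lemma cosh_cos_int_1 x : (x ^ 2 + 1) * cosh_cos_int x 1 = cosh (x * (PI / 2)).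
Proof.
  set (W := fun u => x * sinh (x * u) * cos u + cosh (x * u) * sin u).
  assert (H1 : is_RInt (fun u => (x ^ 2 + 1) * cosh_cos x 1 u) 0 (PI / 2)
    (W (PI / 2) - W 0)).
  { apply (is_RInt_derive W).
    - intros u _; unfold W, cosh_cos, cosh, sinh; auto_derive; [trivial|].
      simpl; field.
    - intros u _; apply (continuous_scal_r (x ^ 2 + 1) (cosh_cos x 1)), continuous_cosh_cos. }
  pose proof (is_RInt_scal _ _ _ (x ^ 2 + 1) _ (is_RInt_cosh_cos x 1)) as H2.
  transitivity (W (PI / 2) - W 0).
  - exact (is_RInt_unique_R _ _ _ _ _ H2 H1).
  - unfold W; rewrite cos_PI2, sin_PI2, cos_0, sin_0, !Rmult_0_r, sinh_0; ring.
Qed.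

(** Two integrations by parts; [W] collects the boundary terms and vanishes at both ends. *)
Lemma cosh_cos_int_rec x m :
  (x ^ 2 + INR (m + 2) ^ 2) * cosh_cos_int x (m + 2) =
  INR (m + 2) * INR (m + 1) * cosh_cos_int x m.
Proof.
  set (W := fun u => x * sinh (x * u) * cos u ^ (m + 2)
                     + INR (m + 2) * cosh (x * u) * cos u ^ (m + 1) * sin u).
  assert (H1 : is_RInt (fun u => (x ^ 2 + INR (m + 2) ^ 2) * cosh_cos x (m + 2) u
      - INR (m + 2) * INR (m + 1) * cosh_cos x m u) 0 (PI / 2) (W (PI / 2) - W 0)).
  { apply (is_RInt_derive W).
    - intros u _; unfold W, cosh_cos, cosh, sinh; auto_derive; [trivial|].
      replace (Init.Nat.pred (m + 2)) with (m + 1)%nat by lia.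
      replace (Init.Nat.pred (m + 1)) with m by lia.
      replace (cos u ^ (m + 2)) with (cos u ^ m * cos u ^ 2) by (rewrite pow_add; ring).
      replace (cos u ^ (m + 1)) with (cos u ^ m * cos u) by (rewrite pow_add; ring).
      pose proof (sin2_cos2 u) as E; unfold Rsqr in E.
      (* The sides agree only modulo sin^2 + cos^2 = 1. The added multiple of 1 - (sin^2 + cos^2) is
         0 and makes them equal as polynomials. *)
      match goal with |- ?a = ?b => replace b with (b + (INR (m + 2) * INR (m + 1)
        * ((exp (x * u) + exp (- (x * u))) / 2 * cos u ^ m)) * (1 - (sin u * sin u + cos u * cos u))) by (rewrite E; ring) end.
      rewrite !plus_INR; simpl (INR 2); simpl (INR 1); field.
    - intros u _.
      apply (continuous_minus (fun u => (x ^ 2 + INR (m + 2) ^ 2) * cosh_cos x (m + 2) u)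
        (fun u => INR (m + 2) * INR (m + 1) * cosh_cos x m u)).
      + apply (continuous_scal_r (x ^ 2 + INR (m + 2) ^ 2) (cosh_cos x (m + 2))), continuous_cosh_cos.
      + apply (continuous_scal_r (INR (m + 2) * INR (m + 1)) (cosh_cos x m)), continuous_cosh_cos. }
  pose proof (is_RInt_minus _ _ _ _ _ _
    (is_RInt_scal _ _ _ (x ^ 2 + INR (m + 2) ^ 2) _ (is_RInt_cosh_cos x (m + 2)))
    (is_RInt_scal _ _ _ (INR (m + 2) * INR (m + 1)) _ (is_RInt_cosh_cos x m))) as H2.
  assert (E : (x ^ 2 + INR (m + 2) ^ 2) * cosh_cos_int x (m + 2)
     - INR (m + 2) * INR (m + 1) * cosh_cos_int x m = W (PI / 2) - W 0).
  { exact (is_RInt_unique_R _ _ _ _ _ H2 H1). }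
  assert (HW : W (PI / 2) - W 0 = 0).
  { unfold W; rewrite cos_PI2, sin_PI2, cos_0, sin_0, !Rmult_0_r, sinh_0, !pow_i by lia; ring. }
  lra.
Qed.

Lemma cosh_ge_1 u : 1 <= cosh u.
Proof.
  unfold cosh; pose proof (exp_ineq1_le u); pose proof (exp_ineq1_le (- u)); lra.
Qed.

(** From cosh u = 1 + 2 sinh (u / 2)^2 and sinh v <= v exp v. *)
Lemma cosh_le_quadratic u : 0 <= u -> cosh u <= 1 + u ^ 2 / 2 * exp u.
Proof.
  intros Hu; set (v := u / 2).
  assert (E : cosh u = 1 + (exp v - exp (- v)) ^ 2 / 2).
  { assert (Hv : exp v * exp (- v) = 1) by (rewrite <- exp_plus, Rplus_opp_r; apply exp_0).
    unfold cosh; replace u with (v + v) by (unfold v; field).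
    rewrite Ropp_plus_distr, !exp_plus.
    replace ((exp v - exp (- v)) ^ 2) with
      (exp v * exp v + exp (- v) * exp (- v) - 2 * (exp v * exp (- v))) by ring.
    rewrite Hv; field. }
  assert (Hd : 0 <= exp v - exp (- v) <= 2 * v * exp v).
  { split.
    - destruct (Req_dec v 0) as [->|Hv]; [rewrite Ropp_0; lra|].
      assert (exp (- v) < exp v) by (apply exp_increasing; unfold v in *; lra); lra.
    - replace (exp (- v)) with (exp v * exp (- (2 * v)))
        by (rewrite <- exp_plus; f_equal; ring).
      pose proof (exp_ineq1_le (- (2 * v))); pose proof (exp_pos v); nra. }
  rewrite E.
  replace (exp u) with (exp v * exp v) by (rewrite <- exp_plus; f_equal; unfold v; field).
  assert ((exp v - exp (- v)) ^ 2 <= (2 * v * exp v) ^ 2) by (apply pow_incr; exact Hd).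
  replace (u ^ 2 / 2 * (exp v * exp v)) with ((2 * v * exp v) ^ 2 / 2) by (unfold v; field).
  lra.
Qed.

Lemma mult_cos_le_sin u : 0 <= u <= PI / 2 -> u * cos u <= sin u.
Proof.
  intros Hu.
  destruct (MVT_gen (fun t => sin t - t * cos t) 0 u (fun t => t * sin t)) as [c [Hc E]].
  - intros t _; auto_derive; [trivial|]; ring.
  - intros t _; apply continuity_pt_filterlim.
    apply (ex_derive_continuous (fun t => sin t - t * cos t)); auto_derive; trivial.
  - rewrite Rmin_left, Rmax_right in Hc by lra.
    assert (0 <= sin c) by (apply sin_ge_0; pose proof PI_RGT_0; lra).
    rewrite sin_0, Rmult_0_l, !Rminus_0_r in E.
    assert (0 <= c * sin c * u) by (repeat apply Rmult_le_pos; lra).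
    lra.
Qed.

Lemma ex_RInt_cosh_cos x n : ex_RInt (cosh_cos x n) 0 (PI / 2).
Proof. eexists; apply is_RInt_cosh_cos. Qed.

Lemma cosh_cos_int_ge x n : cosh_cos_int 0 n <= cosh_cos_int x n.
Proof.
  pose proof PI_RGT_0.
  apply RInt_le; [lra | apply ex_RInt_cosh_cos | apply ex_RInt_cosh_cos |].
  intros u Hu; unfold cosh_cos; rewrite Rmult_0_l, cosh_0.
  apply Rmult_le_compat_r; [|apply cosh_ge_1].
  apply pow_le, cos_ge_0; lra.
Qed.

(** As u cos u <= sin u gives u^2 cos^2 u <= 1 - cos^2 u, the excess of cosh (x u) over 1 is paid
    for by the difference of the integrals at x = 0 for [m] and [m + 2]. By the recurrence that
    difference is 1 / (m + 1) times the integral for [m + 2]. *)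
Lemma cosh_cos_int_le x m : 0 <= x ->
  cosh_cos_int x (m + 2) <= cosh_cos_int 0 (m + 2)
    + x ^ 2 / 2 * exp (x * (PI / 2)) * (cosh_cos_int 0 m - cosh_cos_int 0 (m + 2)).
Proof.
  intros Hx; pose proof PI_RGT_0 as Hpi.
  set (C := x ^ 2 / 2 * exp (x * (PI / 2))).
  assert (HR : is_RInt (fun u => cosh_cos 0 (m + 2) u
     + C * (cosh_cos 0 m u - cosh_cos 0 (m + 2) u)) 0 (PI / 2)
     (cosh_cos_int 0 (m + 2) + C * (cosh_cos_int 0 m - cosh_cos_int 0 (m + 2)))).
  { apply (is_RInt_plus (cosh_cos 0 (m + 2))
      (fun u => C * (cosh_cos 0 m u - cosh_cos 0 (m + 2) u))); [apply is_RInt_cosh_cos|].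
    apply (is_RInt_scal (fun u => cosh_cos 0 m u - cosh_cos 0 (m + 2) u)).
    apply (is_RInt_minus (cosh_cos 0 m) (cosh_cos 0 (m + 2))); apply is_RInt_cosh_cos. }
  rewrite <- (is_RInt_unique (V := R_CompleteNormedModule) _ _ _ _ HR).
  apply RInt_le; [lra | apply ex_RInt_cosh_cos | eexists; exact HR |].
  intros u Hu; unfold cosh_cos; rewrite Rmult_0_l, cosh_0, !Rmult_1_l.
  assert (Hcos : 0 <= cos u) by (apply cos_ge_0; lra).
  assert (Hm : 0 <= cos u ^ m) by (apply pow_le; exact Hcos).
  rewrite pow_add.
  assert (H1 : cosh (x * u) <= 1 + x ^ 2 * u ^ 2 / 2 * exp (x * (PI / 2))).
  { apply Rle_trans with (1 := cosh_le_quadratic (x * u) ltac:(nra)).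
    rewrite Rpow_mult_distr; apply Rplus_le_compat_l, Rmult_le_compat_l.
    - pose proof (pow2_ge_0 x); pose proof (pow2_ge_0 u); nra.
    - destruct (Req_dec x 0) as [->|]; [rewrite !Rmult_0_l; lra|].
      left; apply exp_increasing, Rmult_lt_compat_l; lra. }
  assert (H2 : u ^ 2 * cos u ^ 2 <= 1 - cos u ^ 2).
  { pose proof (mult_cos_le_sin u ltac:(lra)) as H2.
    assert ((u * cos u) ^ 2 <= sin u ^ 2) by (apply pow_incr; split; [nra|exact H2]).
    pose proof (sin2_cos2 u) as E; unfold Rsqr in E; nra. }
  assert (HC : 0 <= C).
  { unfold C; pose proof (exp_pos (x * (PI / 2))); pose proof (pow2_ge_0 x); nra. }
  apply Rle_trans with ((1 + C * u ^ 2) * (cos u ^ m * cos u ^ 2)).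
  - apply Rmult_le_compat_r; [apply Rmult_le_pos; [exact Hm | apply pow2_ge_0]|].
    apply Rle_trans with (1 := H1); right; unfold C; field.
  - replace ((1 + C * u ^ 2) * (cos u ^ m * cos u ^ 2))
      with (cos u ^ m * cos u ^ 2 + C * cos u ^ m * (u ^ 2 * cos u ^ 2)) by ring.
    replace (C * (cos u ^ m - cos u ^ m * cos u ^ 2)) with (C * cos u ^ m * (1 - cos u ^ 2)) by ring.
    apply Rplus_le_compat_l, Rmult_le_compat_l; [apply Rmult_le_pos; assumption | exact H2].
Qed.

Lemma INR_2b3 b : INR (2 * b + 1 + 2) = od (S b).
Proof. rewrite !plus_INR, mult_INR, od_S; unfold od; simpl; ring. Qed.

Lemma INR_2b2 b : INR (2 * b + 1 + 1) = od (S b) - 1.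
Proof. rewrite !plus_INR, mult_INR, od_S; unfold od; simpl; ring. Qed.

Lemma cosh_cos_int_odd_pos b : 0 < cosh_cos_int 0 (2 * b + 1).
Proof.
  induction b as [|b IH].
  - pose proof (cosh_cos_int_1 0) as E; rewrite Rmult_0_l, cosh_0 in E; simpl Nat.mul; simpl Nat.add.
    lra.
  - replace (2 * S b + 1)%nat with (2 * b + 1 + 2)%nat by lia.
    pose proof (cosh_cos_int_rec 0 (2 * b + 1)) as E.
    rewrite INR_2b3, INR_2b2 in E; pose proof (od_ge_1 b); rewrite od_S in E.
    assert (0 < (od b + 2) * (od b + 2 - 1) * cosh_cos_int 0 (2 * b + 1))
      by (apply Rmult_lt_0_compat; [nra|exact IH]).
    nra.
Qed.

(** Each step of the recurrence, divided by the same step at x = 0, contributes one factor 1 + x^2 /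
    od j ^ 2. *)
Lemma cosh_cos_int_odd_prod x b :
  cosh_cos_int x (2 * b + 1) * odd_prod_sq (S b) (- x ^ 2) =
  cosh_cos_int 0 (2 * b + 1) * cosh (x * (PI / 2)).
Proof.
  induction b as [|b IH].
  - change (odd_prod_sq 1 (- x ^ 2)) with (1 * (1 - - x ^ 2 / od 0 ^ 2)).
    change (2 * 0 + 1)%nat with 1%nat.
    pose proof (cosh_cos_int_1 0) as E0; rewrite Rmult_0_l, cosh_0 in E0.
    rewrite <- cosh_cos_int_1, od_0.
    replace (cosh_cos_int 0 1) with 1 by lra; field.
  - replace (2 * S b + 1)%nat with (2 * b + 1 + 2)%nat by lia.
    change (odd_prod_sq (S (S b)) (- x ^ 2))
      with (odd_prod_sq (S b) (- x ^ 2) * (1 - - x ^ 2 / od (S b) ^ 2)).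
    pose proof (cosh_cos_int_rec 0 (2 * b + 1)) as E0.
    pose proof (cosh_cos_int_rec x (2 * b + 1)) as E.
    rewrite INR_2b3, INR_2b2 in E, E0.
    pose proof (od_neq_0 (S b)) as Hb.
    assert (H2 : od (S b) ^ 2 <> 0) by (apply pow_nonzero; exact Hb).
    apply Rmult_eq_reg_l with (od (S b) ^ 2); [|exact H2].
    replace (od (S b) ^ 2 * (cosh_cos_int x (2 * b + 1 + 2) *
       (odd_prod_sq (S b) (- x ^ 2) * (1 - - x ^ 2 / od (S b) ^ 2))))
      with ((x ^ 2 + od (S b) ^ 2) * cosh_cos_int x (2 * b + 1 + 2) * odd_prod_sq (S b) (- x ^ 2))
      by (field; exact Hb).
    replace (od (S b) ^ 2 * (cosh_cos_int 0 (2 * b + 1 + 2) * cosh (x * (PI / 2))))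
      with ((0 ^ 2 + od (S b) ^ 2) * cosh_cos_int 0 (2 * b + 1 + 2) * cosh (x * (PI / 2))) by ring.
    rewrite E, E0, !Rmult_assoc, IH; ring.
Qed.

Lemma is_lim_seq_cosh_cos_ratio x : 0 <= x ->
  is_lim_seq (fun b => cosh_cos_int x (2 * b + 1) / cosh_cos_int 0 (2 * b + 1)) 1.
Proof.
  intros Hx; apply is_lim_seq_incr_1.
  set (C := x ^ 2 / 2 * exp (x * (PI / 2))).
  apply (is_lim_seq_le_le (fun _ => 1) _ (fun b => 1 + C * / (2 * INR b + 2) ^ 1)).
  - intros b; pose proof (cosh_cos_int_odd_pos (S b)) as Hp.
    split.
    + apply Rmult_le_reg_r with (1 := Hp); unfold Rdiv.
      rewrite Rmult_assoc, Rinv_l by lra; rewrite Rmult_1_l, Rmult_1_r.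
      apply cosh_cos_int_ge.
    + pose proof (cosh_cos_int_le x (2 * b + 1) Hx) as H; fold C in H.
      pose proof (cosh_cos_int_rec 0 (2 * b + 1)) as E.
      rewrite INR_2b3, INR_2b2 in E.
      replace (2 * S b + 1)%nat with (2 * b + 1 + 2)%nat in * by lia.
      assert (Hb : 0 < 2 * INR b + 2) by (pose proof (pos_INR b); lra).
      assert (Hd : od (S b) - 1 = 2 * INR b + 2) by (rewrite od_S; unfold od; ring).
      rewrite Hd in E; replace (od (S b)) with (2 * INR b + 3) in E by lra.
      assert (E2 : cosh_cos_int 0 (2 * b + 1) - cosh_cos_int 0 (2 * b + 1 + 2)
        = cosh_cos_int 0 (2 * b + 1 + 2) * / (2 * INR b + 2)).
      { apply Rmult_eq_reg_l with ((2 * INR b + 3) * (2 * INR b + 2)); [|nra].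
        rewrite Rmult_minus_distr_l, <- E; field; lra. }
      rewrite E2 in H.
      apply Rmult_le_reg_r with (1 := Hp); unfold Rdiv.
      rewrite Rmult_assoc, Rinv_l by lra.
      rewrite Rmult_1_r, pow_1; apply Rle_trans with (1 := H); right; ring.
  - apply is_lim_seq_const.
  - replace (Finite 1) with (Finite (1 + C * 0)) by (f_equal; ring).
    apply is_lim_seq_plus'; [apply is_lim_seq_const|].
    apply is_lim_seq_mult'; [apply is_lim_seq_const | apply is_lim_seq_inv_linear_pow].
Qed.

Lemma secant_mult_cosh_pos x : 0 <= x -> secant (- x ^ 2) * cosh (x * (PI / 2)) = 1.
Proof.
  intros Hx; apply secant_mult_limit.
  - apply off_poles_le; pose proof (pow2_ge_0 x); lra.
  - apply (is_lim_seq_ext (fun b => cosh (x * (PI / 2)) /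
      (cosh_cos_int x (2 * b + 1) / cosh_cos_int 0 (2 * b + 1)))).
    + intros b; pose proof (cosh_cos_int_odd_pos b); pose proof (cosh_cos_int_ge x (2 * b + 1)).
      apply Rmult_eq_reg_l with (cosh_cos_int x (2 * b + 1)); [|lra].
      rewrite cosh_cos_int_odd_prod; field; lra.
    + replace (Finite (cosh (x * (PI / 2)))) with (Finite (cosh (x * (PI / 2)) / 1))
        by (f_equal; field).
      apply is_lim_seq_div'; [apply is_lim_seq_const | apply is_lim_seq_cosh_cos_ratio; exact Hx | lra].
Qed.

Lemma secant_mult_cosh x : secant (- x ^ 2) * cosh (x * (PI / 2)) = 1.
Proof.
  destruct (Rle_dec 0 x) as [H|H]; [apply secant_mult_cosh_pos; exact H|].
  rewrite <- (secant_mult_cosh_pos (- x)) by lra.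
  f_equal; [f_equal; ring|].
  unfold cosh; rewrite Ropp_mult_distr_l_reverse, Ropp_involutive; field.
Qed.

(** * Products of partial fractions *)

Definition ev_sum (e : nat -> R) (t : R) : R :=
  Series (fun j => e j * (ev j * / (ev j ^ 2 - t) ^ 2)).

Lemma is_series_ev_at_odd (e : nat -> R) k s :
  is_series (fun j => e j * od_ev_term k j) s ->
  is_series (fun j => e j * (ev j * / (ev j ^ 2 - od k ^ 2) ^ 2)) (s / (4 * od k)).
Proof.
  intros H; pose proof (od_neq_0 k) as Hk.
  replace (s / (4 * od k)) with (/ (4 * od k) * s) by (field; exact Hk).
  apply (is_series_ext (fun j => / (4 * od k) * (e j * od_ev_term k j))).
  - intros j; unfold od_ev_term.
    pose proof (ev_sub_od_neq_0 j k); pose proof (ev_add_od_neq_0 j k).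
    replace (ev j ^ 2 - od k ^ 2) with ((ev j - od k) * (ev j + od k)) by ring.
    as_R; field; auto.
  - apply is_series_Rscal; exact H.
Qed.

Lemma ev_div_pos k j : 0 <= ev j * / (ev j ^ 2 - od k ^ 2) ^ 2.
Proof.
  pose proof (ev_ge_2 j); apply Rmult_le_pos; [lra|].
  left; apply Rinv_0_lt_compat, pow2_gt_0.
  replace (ev j ^ 2 - od k ^ 2) with ((ev j - od k) * (ev j + od k)) by ring.
  apply Rmult_integral_contrapositive_currified;
    [apply ev_sub_od_neq_0 | apply ev_add_od_neq_0].
Qed.

Lemma is_series_ev_od k :
  is_series (fun j => ev j * / (ev j ^ 2 - od k ^ 2) ^ 2) (hsum k / (4 * od k)).
Proof.
  apply (is_series_ext (fun j => 1 * (ev j * / (ev j ^ 2 - od k ^ 2) ^ 2))).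
  - intros j; as_R; ring.
  - apply is_series_ev_at_odd, (is_series_ext (od_ev_term k)); [|apply is_series_od_ev].
    intros j; as_R; ring.
Qed.

Lemma ev_term_Rabs_le (e : nat -> R) k j : (forall i, Rabs (e i) <= 1) ->
  Rabs (e j * (ev j * / (ev j ^ 2 - od k ^ 2) ^ 2)) <= ev j * / (ev j ^ 2 - od k ^ 2) ^ 2.
Proof.
  intros He; pose proof (ev_div_pos k j) as H.
  rewrite Rabs_mult, (Rabs_pos_eq _ H).
  pose proof (Rmult_le_compat_r _ _ _ H (He j)); lra.
Qed.

Lemma Rabs_ev_sum_od_le (e : nat -> R) k : (forall i, Rabs (e i) <= 1) ->
  Rabs (ev_sum e (od k ^ 2)) <= 2 * / od k.
Proof.
  intros He.
  apply Rle_trans with (Series (fun j => ev j * / (ev j ^ 2 - od k ^ 2) ^ 2)).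
  - apply Series_dominated; [eexists; apply is_series_ev_od|].
    intros j; apply ev_term_Rabs_le; exact He.
  - rewrite (is_series_unique _ _ (is_series_ev_od k)).
    pose proof (hsum_le_5 k); pose proof (Rle_abs (hsum k)); pose proof (od_ge_1 k).
    assert (0 < / od k) by (apply Rinv_0_lt_compat; lra).
    replace (hsum k / (4 * od k)) with (hsum k / 4 * / od k) by (field; lra).
    apply Rmult_le_compat_r; lra.
Qed.

Lemma inv_od_mult_le (w : R) C k : 0 <= C -> Rabs w <= C * / od k ->
  Rabs w * (hsum k / (4 * od k)) <= 2 * C * / od k ^ 2.
Proof.
  intros HC Hw; pose proof (hsum_le_5 k); pose proof (hsum_bounds k); pose proof (od_ge_1 k).
  rewrite Rabs_pos_eq in H by lra.
  replace (2 * C * / od k ^ 2) with (C * / od k * (2 * / od k)) by (field; lra).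
  assert (0 < / od k) by (apply Rinv_0_lt_compat; lra).
  replace (hsum k / (4 * od k)) with (hsum k / 4 * / od k) by (field; lra).
  apply Rmult_le_compat; [apply Rabs_pos| |exact Hw|].
  - apply Rmult_le_pos; lra.
  - apply Rmult_le_compat_r; lra.
Qed.

(** For fixed [k] the absolute sum over the even integers is at most [hsum k / (4 * od k)], so
    weights of order 1 / od k lead to a majorant of order 1 / od k ^ 2. *)
Lemma Series_mult_ev_sum (e w : nat -> R) C : 0 <= C ->
  (forall i, Rabs (e i) <= 1) -> (forall k, Rabs (w k) <= C * / od k) ->
  is_series (fun j => e j * ev j * Series (fun k => w k * / (ev j ^ 2 - od k ^ 2) ^ 2))
    (Series (fun k => w k * ev_sum e (od k ^ 2))).
Proof.
  intros HC He Hw.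
  replace (Series (fun k => w k * ev_sum e (od k ^ 2))) with
    (Series (fun k => Series (fun j => w k * (e j * (ev j * / (ev j ^ 2 - od k ^ 2) ^ 2)))))
    by (apply Series_ext; intros k; apply Series_scal_l).
  apply (is_series_ext (fun j => Series (fun k =>
    w k * (e j * (ev j * / (ev j ^ 2 - od k ^ 2) ^ 2))))).
  - intros j; rewrite <- Series_scal_l; apply Series_ext; intros k; ring.
  - apply (fubini_series _ (fun k => 2 * C * / od k ^ 2)); [apply ex_series_C_inv_od_sq|].
    intros k N.
    apply Rle_trans with (Series (fun j => Rabs (w k) * (ev j * / (ev j ^ 2 - od k ^ 2) ^ 2))).
    + apply sum_n_Rabs_le_Series.
      * apply ex_series_scal_R; eexists; apply is_series_ev_od.
      * intros j; rewrite Rabs_mult; apply Rmult_le_compat_l; [apply Rabs_pos|].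
        apply ev_term_Rabs_le; exact He.
    + rewrite Series_scal_l, (is_series_unique _ _ (is_series_ev_od k)).
      apply inv_od_mult_le; [exact HC | apply Hw].
Qed.

(* Indicator of the [j] such that [(-1)^(ev j / 2) = s], for a sign [s]. *)
Definition parity (s : R) (j : nat) : R := (1 + s * (-1) ^ S j) / 2.

Lemma sign_cases k : (-1) ^ k = 1 \/ (-1) ^ k = -1.
Proof. induction k as [|k [IH|IH]]; [left; reflexivity| |]; rewrite sign_S, IH; [right|left]; ring. Qed.

Lemma parity_cases s j : s * s = 1 ->
  (s = (-1) ^ S j /\ parity s j = 1) \/ (s = - (-1) ^ S j /\ parity s j = 0).
Proof.
  intros Hs; assert (Hc : s = 1 \/ s = -1).
  { assert (E : (s - 1) * (s + 1) = 0) by (ring_simplify; lra).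
    apply Rmult_integral in E; destruct E; [left|right]; lra. }
  unfold parity; destruct (sign_cases (S j)) as [-> | ->], Hc as [-> | ->];
    [left|right|right|left]; split; field.
Qed.

Lemma Rabs_parity_le s j : s * s = 1 -> Rabs (parity s j) <= 1.
Proof.
  intros Hs; destruct (parity_cases s j Hs) as [[_ ->]|[_ ->]];
    [rewrite Rabs_R1 | rewrite Rabs_R0]; lra.
Qed.

Definition ev_par (s t : R) : R := ev_sum (parity s) t.

Lemma Rabs_G_le k : Rabs (G k) <= 2 * od k.
Proof.
  pose proof (od_ge_1 k); unfold G; rewrite Rabs_mult, Rabs_sign_mult, (Rabs_pos_eq (od k)) by lra.
  apply Rmult_le_compat_r; [lra | apply Rabs_kap_le].
Qed.

Lemma Rabs_G_mult_le t C k :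
  (forall i, Rabs (/ (od i ^ 2 - t)) <= C * / od i ^ 2) ->
  Rabs (G k * / (od k ^ 2 - t)) <= 2 * C * / od k.
Proof.
  intros HC; rewrite Rabs_mult; pose proof (od_ge_1 k).
  replace (2 * C * / od k) with (2 * od k * (C * / od k ^ 2)) by (field; lra).
  apply Rmult_le_compat; try apply Rabs_pos; [apply Rabs_G_le | apply HC].
Qed.

Lemma Rinv_sq_le t C k : 0 < C ->
  (forall i, Rabs (/ (od i ^ 2 - t)) <= C * / od i ^ 2) ->
  Rabs (/ (od k ^ 2 - t) ^ 2) <= C * C * / od k ^ 2.
Proof.
  intros HC0 HC; replace ((od k ^ 2 - t) ^ 2) with ((od k ^ 2 - t) * (od k ^ 2 - t)) by ring.
  rewrite Rinv_mult, Rabs_mult; pose proof (od_ge_1 k).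
  replace (C * C * / od k ^ 2) with ((C * / od k ^ 2) * (C * 1)) by ring.
  assert (/ od k ^ 2 <= 1).
  { rewrite <- Rinv_1; apply Rinv_le_contravar; nra. }
  apply Rmult_le_compat; try apply Rabs_pos; [apply HC|].
  apply Rle_trans with (1 := HC k); apply Rmult_le_compat_l; lra.
Qed.

Lemma Rabs_G_mult_sq_le t C k : 0 < C ->
  (forall i, Rabs (/ (od i ^ 2 - t)) <= C * / od i ^ 2) ->
  Rabs (G k * / (od k ^ 2 - t) ^ 2) <= 2 * (C * C) * / od k.
Proof.
  intros HC0 HC; rewrite Rabs_mult; pose proof (od_ge_1 k).
  replace (2 * (C * C) * / od k) with (2 * od k * (C * C * / od k ^ 2)) by (field; lra).
  apply Rmult_le_compat; try apply Rabs_pos; [apply Rabs_G_le | apply Rinv_sq_le; assumption].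
Qed.

Lemma ev_sq_sub_od_sq_neq_0 j k : od k ^ 2 - ev j ^ 2 <> 0.
Proof. apply off_poles_neq_0, off_poles_ev. Qed.

Lemma inv_sq_sub_sym a b : / (a - b) ^ 2 = / (b - a) ^ 2.
Proof. f_equal; ring. Qed.

(** Partial fractions in [od k ^ 2]: the double pole contributes the derivative of [secant] at
    [ev j ^ 2], which is 0, and a divided difference remains. *)
Lemma is_series_G_inner t j : off_poles t -> t <> ev j ^ 2 ->
  is_series (fun k => G k * / (od k ^ 2 - t) * / (ev j ^ 2 - od k ^ 2) ^ 2)
    ((secant t - (-1) ^ S j) / (ev j ^ 2 - t) ^ 2).
Proof.
  intros Ht Hne.
  replace ((secant t - (-1) ^ S j) / (ev j ^ 2 - t) ^ 2) with
    (/ (ev j ^ 2 - t) * 0 - / (ev j ^ 2 - t) * ((secant t - secant (ev j ^ 2)) / (t - ev j ^ 2)))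
    by (rewrite secant_ev; field; lra).
  apply (is_series_ext (fun k => / (ev j ^ 2 - t) * (G k * / (od k ^ 2 - ev j ^ 2) ^ 2)
    - / (ev j ^ 2 - t) * (G k * / ((od k ^ 2 - t) * (od k ^ 2 - ev j ^ 2))))).
  - intros k; rewrite (inv_sq_sub_sym (ev j ^ 2)).
    pose proof (off_poles_neq_0 t k Ht); pose proof (ev_sq_sub_od_sq_neq_0 j k).
    as_R; field; repeat split; trivial; lra.
  - apply is_series_Rminus; apply is_series_Rscal;
      [apply is_series_G_sq | apply is_series_secant_diff; trivial; apply off_poles_ev].
Qed.

Lemma ev_sq_neq i j : i <> j -> ev i ^ 2 <> ev j ^ 2.
Proof.
  intros Hij E; apply Hij, INR_eq.
  pose proof (ev_ge_2 i); pose proof (ev_ge_2 j).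
  assert (ev i = ev j) by nra; unfold ev in *; lra.
Qed.

(** With two double poles both derivatives of [secant] vanish and a divided difference is left; it
    is 0 when [i] and [j] have the same parity, the case in which it serves below. *)
Lemma is_series_G_inner_sq i j : i <> j ->
  is_series (fun k => G k * / (od k ^ 2 - ev i ^ 2) ^ 2 * / (ev j ^ 2 - od k ^ 2) ^ 2)
    (- (2 * ((-1) ^ S i - (-1) ^ S j)) / (ev i ^ 2 - ev j ^ 2) ^ 3).
Proof.
  intros Hij.
  pose proof (ev_sq_neq i j Hij) as Hne.
  set (D := ev i ^ 2 - ev j ^ 2).
  assert (HD : D <> 0) by (unfold D; lra).
  replace (- (2 * ((-1) ^ S i - (-1) ^ S j)) / D ^ 3) with
    (/ D ^ 2 * 0 + / D ^ 2 * 0 - 2 / D ^ 2 * ((secant (ev i ^ 2) - secant (ev j ^ 2)) / D))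
    by (rewrite !secant_ev; field; exact HD).
  apply (is_series_ext (fun k => / D ^ 2 * (G k * / (od k ^ 2 - ev i ^ 2) ^ 2)
    + / D ^ 2 * (G k * / (od k ^ 2 - ev j ^ 2) ^ 2)
    - 2 / D ^ 2 * (G k * / ((od k ^ 2 - ev i ^ 2) * (od k ^ 2 - ev j ^ 2))))).
  - intros k; rewrite (inv_sq_sub_sym (ev j ^ 2)).
    pose proof (ev_sq_sub_od_sq_neq_0 i k); pose proof (ev_sq_sub_od_sq_neq_0 j k).
    unfold D in *; as_R; field; auto.
  - apply is_series_Rminus; [apply is_series_Rplus|]; apply is_series_Rscal;
      try apply is_series_G_sq.
    apply is_series_secant_diff; trivial; apply off_poles_ev.
Qed.

(** The polar coefficient at [od k ^ 2] of the product of [ev_par s] and [secant - s]. *)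
Definition par_coef (s : R) (k : nat) : R := G k * ev_par s (od k ^ 2).

Lemma Rabs_par_coef_le s k : s * s = 1 -> Rabs (par_coef s k) <= 4.
Proof.
  intros Hs; unfold par_coef; rewrite Rabs_mult; pose proof (od_ge_1 k).
  replace 4 with (2 * od k * (2 * / od k)) by (field; lra).
  apply Rmult_le_compat; try apply Rabs_pos; [apply Rabs_G_le|].
  apply Rabs_ev_sum_od_le; intros; apply Rabs_parity_le; exact Hs.
Qed.

(** The double zeros of [secant - s] cancel the double poles of [ev_par s], so the product is the
    sum of its polar parts at the odd squares. *)
Lemma Series_par_coef s t : s * s = 1 -> t <= / 2 ->
  Series (fun k => par_coef s k * / (od k ^ 2 - t)) = ev_par s t * (secant t - s).
Proof.
  intros Hs Hle; pose proof (off_poles_le t Hle) as Ht.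
  destruct (off_poles_bound t Ht) as [C [HC0 HC]].
  pose proof (Series_mult_ev_sum (parity s) (fun k => G k * / (od k ^ 2 - t)) (2 * C)
    ltac:(lra) (fun i => Rabs_parity_le s i Hs) (fun k => Rabs_G_mult_le t C k HC)) as H.
  apply is_series_unique in H.
  transitivity (Series (fun k => G k * / (od k ^ 2 - t) * ev_sum (parity s) (od k ^ 2))).
  - apply Series_ext; intros k; unfold par_coef, ev_par; ring.
  - rewrite <- H; unfold ev_par, ev_sum; rewrite <- Series_scal_r.
    apply Series_ext; intros j.
    assert (Hne : t <> ev j ^ 2) by (pose proof (ev_ge_2 j); nra).
    rewrite (is_series_unique _ _ (is_series_G_inner t j Ht Hne)).
    destruct (parity_cases s j Hs) as [[<- ->]|[_ ->]]; field; lra.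
Qed.

(** The value of that product at the removable singularity [ev i ^ 2]: the terms j <> i of the same
    parity vanish there, and j = i gives [ev i] times the second Taylor coefficient of [secant]. The
    factor [parity s i] restricts the claim to the poles of [ev_par s]. *)
Lemma Series_par_coef_ev s i : s * s = 1 ->
  parity s i * Series (fun k => par_coef s k * / (od k ^ 2 - ev i ^ 2)) =
  parity s i * (s * lam / (4 * ev i)).
Proof.
  intros Hs; destruct (parity_cases s i Hs) as [[Hi Hp]|[_ ->]]; [|ring].
  f_equal; pose proof (off_poles_ev i) as Ht.
  destruct (off_poles_bound _ Ht) as [C [HC0 HC]].
  pose proof (Series_mult_ev_sum (parity s) (fun k => G k * / (od k ^ 2 - ev i ^ 2)) (2 * C)
    ltac:(lra) (fun i => Rabs_parity_le s i Hs) (fun k => Rabs_G_mult_le _ C k HC)) as H.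
  apply is_series_unique in H.
  transitivity (Series (fun k => G k * / (od k ^ 2 - ev i ^ 2) * ev_sum (parity s) (od k ^ 2))).
  - apply Series_ext; intros k; unfold par_coef, ev_par; ring.
  - rewrite <- H; rewrite (Series_single _ i).
    + rewrite Hp, (is_series_unique _ ((-1) ^ S i * lam / (4 * ev i ^ 2))).
      * rewrite <- Hi; pose proof (ev_neq_0 i); field; assumption.
      * apply (is_series_ext (fun k => G k * / (od k ^ 2 - ev i ^ 2) ^ 3)); [|apply is_series_G_cube].
        intros k; rewrite (inv_sq_sub_sym (ev i ^ 2)).
        pose proof (ev_sq_sub_od_sq_neq_0 i k); as_R; field; assumption.
    + intros j Hj.
      destruct (parity_cases s j Hs) as [[Hj' ->]|[_ ->]]; [|ring].
      rewrite (is_series_unique _ _ (is_series_G_inner (ev i ^ 2) j Ht (ev_sq_neq i j (not_eq_sym Hj)))).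
      rewrite secant_ev, <- Hi, <- Hj'; unfold Rdiv; ring.
Qed.

(** The derivative at the same point, which is [ev i] times the third Taylor coefficient. *)
Lemma Series_par_coef_ev_sq s i : s * s = 1 ->
  parity s i * Series (fun k => par_coef s k * / (od k ^ 2 - ev i ^ 2) ^ 2) =
  parity s i * (- (s * lam / (8 * ev i ^ 3))).
Proof.
  intros Hs; destruct (parity_cases s i Hs) as [[Hi Hp]|[_ ->]]; [|ring].
  f_equal; pose proof (off_poles_ev i) as Ht.
  destruct (off_poles_bound _ Ht) as [C [HC0 HC]].
  pose proof (Series_mult_ev_sum (parity s) (fun k => G k * / (od k ^ 2 - ev i ^ 2) ^ 2)
    (2 * (C * C)) ltac:(nra) (fun i => Rabs_parity_le s i Hs)
    (fun k => Rabs_G_mult_sq_le _ C k HC0 HC)) as H.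
  apply is_series_unique in H.
  transitivity (Series (fun k => G k * / (od k ^ 2 - ev i ^ 2) ^ 2 * ev_sum (parity s) (od k ^ 2))).
  - apply Series_ext; intros k; unfold par_coef, ev_par; ring.
  - rewrite <- H; rewrite (Series_single _ i).
    + rewrite Hp, (is_series_unique _ (- ((-1) ^ S i * lam / (8 * ev i ^ 4)))).
      * rewrite <- Hi; pose proof (ev_neq_0 i); field; assumption.
      * apply (is_series_ext (fun k => G k * / (od k ^ 2 - ev i ^ 2) ^ 4)); [|apply is_series_G_fourth].
        intros k; rewrite (inv_sq_sub_sym (ev i ^ 2)).
        pose proof (ev_sq_sub_od_sq_neq_0 i k); as_R; field; assumption.
    + intros j Hj.
      destruct (parity_cases s j Hs) as [[Hj' ->]|[_ ->]]; [|ring].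
      rewrite (is_series_unique _ _ (is_series_G_inner_sq i j (not_eq_sym Hj))).
      rewrite <- Hi, <- Hj'; unfold Rdiv; ring.
Qed.

Lemma ex_series_par_coef s t : s * s = 1 -> off_poles t ->
  ex_series (fun k => par_coef s k * / (od k ^ 2 - t)).
Proof.
  intros Hs Ht; destruct (off_poles_bound _ Ht) as [C [HC0 HC]].
  apply (ex_series_dominated _ _ (ex_series_C_inv_od_sq (4 * C))); intros k.
  rewrite Rabs_mult, Rmult_assoc.
  apply Rmult_le_compat; try apply Rabs_pos; [apply Rabs_par_coef_le; exact Hs | apply HC].
Qed.

Lemma ex_series_par_coef_sq s t : s * s = 1 -> off_poles t ->
  ex_series (fun k => par_coef s k * / (od k ^ 2 - t) ^ 2).
Proof.
  intros Hs Ht; destruct (off_poles_bound _ Ht) as [C [HC0 HC]].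
  apply (ex_series_dominated _ _ (ex_series_C_inv_od_sq (4 * (C * C)))); intros k.
  rewrite Rabs_mult, Rmult_assoc.
  apply Rmult_le_compat; try apply Rabs_pos; [apply Rabs_par_coef_le; exact Hs|].
  apply Rinv_sq_le; assumption.
Qed.

Lemma inv_ev_sq_sub_bounds t j : t <= / 2 -> 0 < / (ev j ^ 2 - t) <= 2 * / ev j ^ 2.
Proof.
  intros Ht; pose proof (ev_ge_2 j).
  assert (0 < ev j ^ 2 / 2) by nra.
  split; [apply Rinv_0_lt_compat; nra|].
  replace (2 * / ev j ^ 2) with (/ (ev j ^ 2 / 2)) by (field; lra).
  apply Rinv_le_contravar; nra.
Qed.

Lemma inv_ev_sq_le j : 0 < / ev j ^ 2 <= / od j ^ 2.
Proof.
  pose proof (od_ge_1 j); assert (ev j = od j + 1) by (unfold ev, od; ring).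
  split; [apply Rinv_0_lt_compat; nra | apply Rinv_le_contravar; nra].
Qed.

Lemma ex_series_ev_sum (e : nat -> R) t : (forall i, Rabs (e i) <= 1) -> t <= / 2 ->
  ex_series (fun j => e j * (ev j * / (ev j ^ 2 - t) ^ 2)).
Proof.
  intros He Ht; apply (ex_series_dominated _ _ (ex_series_C_inv_od_sq 2)); intros j.
  pose proof (inv_ev_sq_sub_bounds t j Ht); pose proof (inv_ev_sq_le j); pose proof (ev_ge_2 j).
  replace (ev j * / (ev j ^ 2 - t) ^ 2) with
    ((ev j * / (ev j ^ 2 - t)) * / (ev j ^ 2 - t)) by (field; nra).
  assert (0 <= ev j * / (ev j ^ 2 - t) <= 1).
  { split; [nra|].
    apply Rle_trans with (ev j * (2 * / ev j ^ 2)); [apply Rmult_le_compat_l; lra|].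
    replace (ev j * (2 * / ev j ^ 2)) with (2 / ev j) by (field; lra).
    apply Rmult_le_reg_r with (ev j); [lra|]; unfold Rdiv.
    rewrite Rmult_assoc, Rinv_l by lra; lra. }
  rewrite Rabs_mult, (Rabs_pos_eq (_ * _)) by (apply Rmult_le_pos; lra).
  replace (2 * / od j ^ 2) with (1 * (1 * (2 * / od j ^ 2))) by ring.
  apply Rmult_le_compat; [apply Rabs_pos | apply Rmult_le_pos; lra | apply He |].
  apply Rmult_le_compat; lra.
Qed.

(** What the double pole at [ev j ^ 2] of a second factor [ev_par s] picks up: [ev j] times the
    derivative and the value just computed, over the first and second power of ev j ^ 2 - t, with
    [- s * lam] taken out. *)
Definition pole_corr (t : R) (j : nat) : R :=
  / (8 * (ev j ^ 2 * (ev j ^ 2 - t))) + / (4 * (ev j ^ 2 - t) ^ 2).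

Lemma ex_series_pole_corr (e : nat -> R) t : (forall i, Rabs (e i) <= 1) -> t <= / 2 ->
  ex_series (fun j => e j * pole_corr t j).
Proof.
  intros He Ht; apply (ex_series_dominated _ _ (ex_series_C_inv_od_sq 2)); intros j.
  pose proof (inv_ev_sq_sub_bounds t j Ht); pose proof (inv_ev_sq_le j); pose proof (ev_ge_2 j).
  assert (/ ev j ^ 2 <= / 4) by (apply Rinv_le_contravar; nra).
  assert (E : pole_corr t j = (/ 8 * / ev j ^ 2 + / 4 * / (ev j ^ 2 - t)) * / (ev j ^ 2 - t)).
  { unfold pole_corr; field; nra. }
  rewrite E, Rabs_mult, (Rabs_pos_eq (_ * _)) by (apply Rmult_le_pos; lra).
  replace (2 * / od j ^ 2) with (1 * (1 * (2 * / od j ^ 2))) by ring.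
  apply Rmult_le_compat; [apply Rabs_pos | apply Rmult_le_pos; lra | apply He |].
  apply Rmult_le_compat; lra.
Qed.

(* The product of the partial fraction expansions of [ev_par] and of the previous series:
   the pole of [ev_par] at [ev j ^ 2] only picks up the two Taylor coefficients computed above. *)
Lemma Series_par_coef_mult s t : s * s = 1 -> t <= / 2 ->
  Series (fun k => par_coef s k * ev_par s (od k ^ 2) * / (od k ^ 2 - t)) =
  ev_par s t ^ 2 * (secant t - s) - s * lam * Series (fun j => parity s j * pole_corr t j).
Proof.
  intros Hs Hle; pose proof (off_poles_le t Hle) as Ht.
  destruct (off_poles_bound t Ht) as [C [HC0 HC]].
  assert (Hw : forall k, Rabs (par_coef s k * / (od k ^ 2 - t)) <= 4 * C * / od k).
  { intros k; rewrite Rabs_mult, Rmult_assoc; pose proof (od_ge_1 k).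
    apply Rmult_le_compat; try apply Rabs_pos; [apply Rabs_par_coef_le; exact Hs|].
    apply Rle_trans with (1 := HC k), Rmult_le_compat_l; [lra|].
    apply Rinv_le_contravar; nra. }
  pose proof (Series_mult_ev_sum (parity s) (fun k => par_coef s k * / (od k ^ 2 - t)) (4 * C)
    ltac:(lra) (fun i => Rabs_parity_le s i Hs) Hw) as H.
  apply is_series_unique in H.
  transitivity (Series (fun k => par_coef s k * / (od k ^ 2 - t) * ev_sum (parity s) (od k ^ 2))).
  { apply Series_ext; intros k; unfold ev_par; ring. }
  rewrite <- H; clear H.
  set (f := Series (fun k => par_coef s k * / (od k ^ 2 - t))).
  apply is_series_unique.
  replace (ev_par s t ^ 2 * (secant t - s)) with (f * ev_par s t)
    by (unfold f; rewrite Series_par_coef by assumption; ring).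
  apply (is_series_ext (fun j => f * (parity s j * (ev j * / (ev j ^ 2 - t) ^ 2))
    - s * lam * (parity s j * pole_corr t j))).
  - intros j.
    assert (Hne : ev j ^ 2 - t <> 0) by (pose proof (ev_ge_2 j); nra).
    pose proof (ev_neq_0 j) as Hev.
    (* Partial fractions in [od k ^ 2]: the double pole yields the derivative and the value at
       [ev j ^ 2] of the function whose value at [t] is [f]. *)
    assert (E : Series (fun k => par_coef s k * / (od k ^ 2 - t) * / (ev j ^ 2 - od k ^ 2) ^ 2) =
      / (ev j ^ 2 - t) * Series (fun k => par_coef s k * / (od k ^ 2 - ev j ^ 2) ^ 2)
      - / (ev j ^ 2 - t) ^ 2 * Series (fun k => par_coef s k * / (od k ^ 2 - ev j ^ 2))
      + / (ev j ^ 2 - t) ^ 2 * f).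
    { apply is_series_unique.
      apply (is_series_ext (fun k =>
        / (ev j ^ 2 - t) * (par_coef s k * / (od k ^ 2 - ev j ^ 2) ^ 2)
        - / (ev j ^ 2 - t) ^ 2 * (par_coef s k * / (od k ^ 2 - ev j ^ 2))
        + / (ev j ^ 2 - t) ^ 2 * (par_coef s k * / (od k ^ 2 - t)))).
      - intros k; rewrite (inv_sq_sub_sym (ev j ^ 2) (od k ^ 2)).
        pose proof (off_poles_neq_0 t k Ht); pose proof (ev_sq_sub_od_sq_neq_0 j k).
        as_R; field; auto.
      - apply is_series_Rplus; [apply is_series_Rminus|]; apply is_series_Rscal, Series_correct;
          first [apply ex_series_par_coef_sq | apply ex_series_par_coef];
          first [exact Hs | exact Ht | apply off_poles_ev]. }
    rewrite E.
    pose proof (Series_par_coef_ev s j Hs) as E1.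
    pose proof (Series_par_coef_ev_sq s j Hs) as E2.
    (* [parity s j] is moved next to each series, because [E1] and [E2] give their values only under
       that factor. *)
    match goal with |- _ = parity s j * ev j * (?x * ?A - ?y * ?B + ?z) =>
      transitivity (ev j * (x * (parity s j * A) - y * (parity s j * B) + parity s j * z)) end;
      [|as_R; ring].
    rewrite E1, E2; unfold pole_corr; as_R; field; auto.
  - apply is_series_Rminus; apply is_series_Rscal, Series_correct.
    + apply ex_series_ev_sum; [intros i; apply Rabs_parity_le; exact Hs | exact Hle].
    + apply ex_series_pole_corr; [intros i; apply Rabs_parity_le; exact Hs | exact Hle].
Qed.

(** * The generating function of the coefficients *)

Definition Xi (t : R) : R := ev_sum (fun _ => 1) t.
Definition Eta (t : R) : R := ev_sum (fun j => (-1) ^ j) t.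

Lemma parity_add j : parity (-1) j + parity 1 j = 1.
Proof. unfold parity; field. Qed.

Lemma parity_sub j : parity (-1) j - parity 1 j = (-1) ^ j.
Proof. unfold parity; rewrite sign_S; field. Qed.

Lemma ev_par_add_sub t :
  (forall e, (forall i, Rabs (e i) <= 1) ->
     ex_series (fun j => e j * (ev j * / (ev j ^ 2 - t) ^ 2))) ->
  ev_par (-1) t + ev_par 1 t = Xi t /\ ev_par (-1) t - ev_par 1 t = Eta t.
Proof.
  intros Hex.
  assert (H1 : ex_series (fun j => parity (-1) j * (ev j * / (ev j ^ 2 - t) ^ 2)))
    by (apply Hex; intros; apply Rabs_parity_le; ring).
  assert (H2 : ex_series (fun j => parity 1 j * (ev j * / (ev j ^ 2 - t) ^ 2)))
    by (apply Hex; intros; apply Rabs_parity_le; ring).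
  unfold ev_par, Xi, Eta, ev_sum; split; symmetry; apply is_series_unique.
  - apply (is_series_ext (fun j => parity (-1) j * (ev j * / (ev j ^ 2 - t) ^ 2)
      + parity 1 j * (ev j * / (ev j ^ 2 - t) ^ 2))).
    + intros j; rewrite <- Rmult_plus_distr_r, parity_add; reflexivity.
    + apply is_series_Rplus; apply Series_correct; assumption.
  - apply (is_series_ext (fun j => parity (-1) j * (ev j * / (ev j ^ 2 - t) ^ 2)
      - parity 1 j * (ev j * / (ev j ^ 2 - t) ^ 2))).
    + intros j; rewrite <- Rmult_minus_distr_r, parity_sub; reflexivity.
    + apply is_series_Rminus; apply Series_correct; assumption.
Qed.

Lemma Xi_od k : Xi (od k ^ 2) = hsum k / (4 * od k).
Proof.
  apply is_series_unique, is_series_ev_at_odd, (is_series_ext (od_ev_term k));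
    [|apply is_series_od_ev].
  intros j; as_R; ring.
Qed.

Lemma Eta_od k : Eta (od k ^ 2) = alt_hsum k / (4 * od k).
Proof. apply is_series_unique, is_series_ev_at_odd, is_series_alt_od_ev. Qed.

Definition tstar_coef (k : nat) : R := (-1) ^ k * hsum k * omega_series k.

(** The product of [Xi] and [Eta] at [od k ^ 2] as a difference of squares; the 16 makes up for the
    4 in each of their values there. *)
Lemma tstar_coef_eq k : tstar_coef k =
  16 * (par_coef (-1) k * ev_par (-1) (od k ^ 2) - par_coef 1 k * ev_par 1 (od k ^ 2)).
Proof.
  destruct (ev_par_add_sub (od k ^ 2)) as [Ha Hs].
  { intros e He; apply (ex_series_dominated _ (fun j => ev j * / (ev j ^ 2 - od k ^ 2) ^ 2)).
    - eexists; apply is_series_ev_od.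
    - intros j; apply ev_term_Rabs_le; exact He. }
  unfold par_coef.
  replace (16 * (G k * ev_par (-1) (od k ^ 2) * ev_par (-1) (od k ^ 2)
      - G k * ev_par 1 (od k ^ 2) * ev_par 1 (od k ^ 2)))
    with (16 * G k * (ev_par (-1) (od k ^ 2) + ev_par 1 (od k ^ 2))
      * (ev_par (-1) (od k ^ 2) - ev_par 1 (od k ^ 2))) by ring.
  rewrite Ha, Hs, Xi_od, Eta_od; unfold tstar_coef, G.
  pose proof (od_neq_0 k).
  replace (omega_series k) with (kap * alt_hsum k / od k)
    by (rewrite <- od_omega_series; field; assumption).
  field; assumption.
Qed.

Lemma ex_series_par_coef_mult s t : s * s = 1 -> off_poles t ->
  ex_series (fun k => par_coef s k * ev_par s (od k ^ 2) * / (od k ^ 2 - t)).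
Proof.
  intros Hs Ht; destruct (off_poles_bound _ Ht) as [C [HC0 HC]].
  apply (ex_series_dominated _ _ (ex_series_C_inv_od_sq (8 * C))); intros k.
  rewrite !Rabs_mult.
  assert (Rabs (ev_par s (od k ^ 2)) <= 2).
  { apply Rle_trans with (2 * / od k).
    - apply Rabs_ev_sum_od_le; intros; apply Rabs_parity_le; exact Hs.
    - pose proof (od_ge_1 k).
      assert (/ od k <= 1) by (rewrite <- Rinv_1; apply Rinv_le_contravar; lra); lra. }
  replace (8 * C * / od k ^ 2) with (4 * 2 * (C * / od k ^ 2)) by ring.
  apply Rmult_le_compat; [apply Rmult_le_pos; apply Rabs_pos | apply Rabs_pos | | apply HC].
  apply Rmult_le_compat; try apply Rabs_pos; [apply Rabs_par_coef_le; exact Hs | assumption].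
Qed.

(** The product is written twice, as [Xi t * Eta t + Eta t * Xi t], so that its Cauchy coefficients
    show the symmetric factor 2 - 2^(-2r) - 2^(-2s) term by term. *)
Lemma tstar_generating_function t : t <= / 2 ->
  Series (fun k => tstar_coef k * / (od k ^ 2 - t)) =
  8 * (Xi t + Eta t) ^ 2 + 8 * (Xi t * Eta t + Eta t * Xi t) * (t * Series (sec_term t))
  + 16 * lam * Series (pole_corr t).
Proof.
  intros Ht; pose proof (off_poles_le t Ht) as Hp.
  destruct (ev_par_add_sub t) as [Ha Hs].
  { intros e He; apply ex_series_ev_sum; assumption. }
  assert (E1 : Series (pole_corr t) = Series (fun j => parity (-1) j * pole_corr t j)
                                    + Series (fun j => parity 1 j * pole_corr t j)).
  { rewrite <- Series_plus_R.
    - apply Series_ext; intros j; rewrite <- Rmult_plus_distr_r, parity_add; ring.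
    - apply ex_series_pole_corr; [intros; apply Rabs_parity_le; ring | exact Ht].
    - apply ex_series_pole_corr; [intros; apply Rabs_parity_le; ring | exact Ht]. }
  assert (E2 : Series (fun k => tstar_coef k * / (od k ^ 2 - t)) =
    16 * (Series (fun k => par_coef (-1) k * ev_par (-1) (od k ^ 2) * / (od k ^ 2 - t))
        - Series (fun k => par_coef 1 k * ev_par 1 (od k ^ 2) * / (od k ^ 2 - t)))).
  { apply is_series_unique.
    apply (is_series_ext (fun k => 16 * (par_coef (-1) k * ev_par (-1) (od k ^ 2) * / (od k ^ 2 - t)
      - par_coef 1 k * ev_par 1 (od k ^ 2) * / (od k ^ 2 - t)))).
    - intros k; rewrite tstar_coef_eq; as_R; ring.
    - apply is_series_Rscal, is_series_Rminus; apply Series_correct, ex_series_par_coef_mult;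
        first [exact Hp | ring]. }
  rewrite E2, E1, !Series_par_coef_mult by first [exact Ht | ring].
  rewrite <- Ha, <- Hs; unfold secant; ring.
Qed.

(** * Power series expansions *)

Lemma is_series_geom_div b t : 0 < b -> Rabs t < b ->
  is_series (fun n => t ^ n * / b ^ S n) (/ (b - t)).
Proof.
  intros Hb Ht.
  assert (Hq : Rabs (t / b) < 1).
  { unfold Rdiv; rewrite Rabs_mult, Rabs_inv, (Rabs_pos_eq b) by lra.
    apply Rmult_lt_reg_r with b; [exact Hb|].
    rewrite Rmult_assoc, Rinv_l by lra; lra. }
  assert (Htb : t < b) by (pose proof (Rle_abs t); lra).
  replace (/ (b - t)) with (/ b * / (1 - t / b)) by (field; lra).
  apply (is_series_ext (fun n => / b * (t / b) ^ n)).
  - intros n; unfold Rdiv; rewrite Rpow_mult_distr, pow_inv.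
    change (b ^ S n) with (b * b ^ n); rewrite Rinv_mult; as_R; ring.
  - apply is_series_Rscal, is_series_geom; exact Hq.
Qed.

(** Cauchy square of the geometric series: all n + 1 terms of the convolution are equal. *)
Lemma is_series_geom_div_sq b t : 0 < b -> Rabs t < b ->
  is_series (fun n => (INR n + 1) * (t ^ n * / b ^ (n + 2))) (/ (b - t) ^ 2).
Proof.
  intros Hb Ht.
  pose proof (is_series_geom_div b t Hb Ht) as H.
  assert (Habs : ex_series (fun n => Rabs (t ^ n * / b ^ S n))).
  { exists (/ (b - Rabs t)).
    apply (is_series_ext (fun n => Rabs t ^ n * / b ^ S n)).
    - intros n; rewrite Rabs_mult, RPow_abs, (Rabs_pos_eq (/ b ^ S n)); [reflexivity|].
      left; apply Rinv_0_lt_compat, pow_lt, Hb.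
    - apply is_series_geom_div; [exact Hb | rewrite Rabs_Rabsolu; exact Ht]. }
  pose proof (is_series_mult _ _ _ _ H H Habs Habs) as HM.
  replace (/ (b - t) ^ 2) with (/ (b - t) * / (b - t)) by (rewrite <- Rinv_mult; f_equal; ring).
  apply is_series_ext with (2 := HM); intros n; simpl; as_R.
  rewrite (sum_eq _ (fun _ => t ^ n * / b ^ (n + 2))).
  - rewrite sum_cte, S_INR; ring.
  - intros i Hi.
    replace (t ^ n) with (t ^ i * t ^ (n - i)) by (rewrite <- pow_add; f_equal; lia).
    replace (b ^ (n + 2)) with ((b * b ^ i) * (b * b ^ (n - i))).
    + rewrite !Rinv_mult; ring.
    + replace (n + 2)%nat with (S i + S (n - i))%nat by lia.
      rewrite pow_add; reflexivity.
Qed.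

Definition has_expansion (a : nat -> R) (f : R -> R) : Prop :=
  locally 0 (fun t => is_pseries a t (f t)).

Lemma locally_0_Rabs_lt (d : R) : 0 < d -> locally 0 (fun t : R => Rabs t < d).
Proof.
  intros Hd; exists (mkposreal d Hd); intros t H.
  unfold ball in H; simpl in H; unfold AbsRing_ball, abs, minus, plus, opp in H; simpl in H.
  rewrite Ropp_0, Rplus_0_r in H; exact H.
Qed.

Lemma has_expansion_intro a f d : 0 < d ->
  (forall t, Rabs t < d -> is_series (fun n => a n * t ^ n) (f t)) -> has_expansion a f.
Proof.
  intros Hd H.
  unfold has_expansion; apply (filter_imp (fun t => Rabs t < d)); [|apply locally_0_Rabs_lt; exact Hd].
  intros t Ht; apply is_pseries_R, H, Ht.
Qed.

Lemma has_expansion_radius a f : has_expansion a f ->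
  exists d, 0 < d /\ forall t, Rabs t < d -> Rbar_lt (Rabs t) (CV_radius a).
Proof.
  (* The series converges at d / 2, so its radius of convergence is at least d / 2. *)
  intros [[d Hd] H]; exists (d / 2); split; [lra|]; intros t Ht.
  simpl in H.
  assert (Hb : ball 0 d (d / 2)).
  { unfold ball; simpl; unfold AbsRing_ball, abs, minus, plus, opp; simpl.
    rewrite Ropp_0, Rplus_0_r, Rabs_pos_eq; lra. }
  specialize (H _ Hb); apply is_pseries_R in H.
  destruct (Rbar_lt_dec (Rabs t) (CV_radius a)) as [Hlt|Hge]; [exact Hlt|exfalso].
  apply Rbar_not_lt_le in Hge.
  apply (CV_disk_outside a (d / 2)).
  - apply Rbar_le_lt_trans with (1 := Hge); simpl; rewrite (Rabs_pos_eq (d / 2)); lra.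
  - apply (ex_series_lim_0 (fun n => a n * (d / 2) ^ n)); eexists; exact H.
Qed.

Lemma has_expansion_unique a b f : has_expansion a f -> has_expansion b f ->
  forall n, a n = b n.
Proof.
  intros Ha Hb n.
  destruct (has_expansion_radius _ _ Ha) as [da [Hda Ra]].
  destruct (has_expansion_radius _ _ Hb) as [db [Hdb Rb]].
  apply PSeries_ext_recip.
  - rewrite <- Rabs_R0; apply Ra; rewrite Rabs_R0; exact Hda.
  - rewrite <- Rabs_R0; apply Rb; rewrite Rabs_R0; exact Hdb.
  - unfold has_expansion; apply (filter_imp (fun t => is_pseries a t (f t) /\ is_pseries b t (f t))).
    + intros t [H1 H2]; rewrite (is_pseries_unique _ _ _ H1), (is_pseries_unique _ _ _ H2).
      reflexivity.
    + apply filter_and; assumption.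
Qed.

Lemma has_expansion_ext a f g : locally 0 (fun t => f t = g t) ->
  has_expansion a f -> has_expansion a g.
Proof.
  intros He Ha; unfold has_expansion; apply (filter_imp (fun t => f t = g t /\ is_pseries a t (f t))).
  - intros t [<- H]; exact H.
  - apply filter_and; assumption.
Qed.

Lemma has_expansion_mult a b f g : has_expansion a f -> has_expansion b g ->
  has_expansion (PS_mult a b) (fun t => f t * g t).
Proof.
  intros Ha Hb.
  destruct (has_expansion_radius _ _ Ha) as [da [Hda Ra]].
  destruct (has_expansion_radius _ _ Hb) as [db [Hdb Rb]].
  unfold has_expansion; apply (filter_imp (fun t => (is_pseries a t (f t) /\ is_pseries b t (g t))
    /\ (Rabs t < da /\ Rabs t < db))).
  - intros t [[H1 H2] [H3 H4]]; apply is_pseries_mult; auto.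
  - apply filter_and; apply filter_and; try assumption; apply locally_0_Rabs_lt; assumption.
Qed.

Lemma has_expansion_plus a b f g : has_expansion a f -> has_expansion b g ->
  has_expansion (fun n => a n + b n) (fun t => f t + g t).
Proof.
  intros Ha Hb.
  unfold has_expansion; apply (filter_imp (fun t => is_pseries a t (f t) /\ is_pseries b t (g t))).
  - intros t [H1 H2]; exact (is_pseries_plus a b t _ _ H1 H2).
  - apply filter_and; assumption.
Qed.

Lemma has_expansion_scal c a f : has_expansion a f ->
  has_expansion (fun n => c * a n) (fun t => c * f t).
Proof.
  intros Ha; unfold has_expansion; apply (filter_imp (fun t => is_pseries a t (f t))); [|exact Ha].
  intros t H; apply is_pseries_R in H; apply is_pseries_R.
  apply (is_series_ext (fun n => c * (a n * t ^ n))).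
  - intros n; as_R; ring.
  - apply is_series_Rscal; exact H.
Qed.

Lemma has_expansion_incr a f : has_expansion a f ->
  has_expansion (PS_incr_1 a) (fun t => t * f t).
Proof.
  intros Ha; unfold has_expansion; apply (filter_imp (fun t => is_pseries a t (f t))); [|exact Ha].
  intros t H; exact (is_pseries_incr_1 a t _ H).
Qed.

(** Each term is expanded geometrically and the sums are exchanged; for |t| < 1 / 2 the majorant
    comes from b k - |t| >= b k / 2. *)
Lemma has_expansion_inv (a b : nat -> R) :
  (forall k, 1 <= b k) -> ex_series (fun k => Rabs (a k) * / b k) ->
  has_expansion (fun n => Series (fun k => a k * / b k ^ S n))
                (fun t => Series (fun k => a k * / (b k - t))).
Proof.
  intros Hb Ha; apply (has_expansion_intro _ _ (/ 2)); [lra|]; intros t Ht.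
  assert (Hlt : forall k, Rabs t < b k) by (intros k; specialize (Hb k); lra).
  assert (Hpos : forall k, 0 < b k) by (intros k; specialize (Hb k); lra).
  replace (Series (fun k => a k * / (b k - t))) with
    (Series (fun k => Series (fun n => a k * (t ^ n * / b k ^ S n)))).
  - apply (is_series_ext (fun n => Series (fun k => a k * (t ^ n * / b k ^ S n)))).
    { intros n; rewrite <- Series_scal_r; apply Series_ext; intros k; as_R; ring. }
    apply (fubini_series _ (fun k => 2 * (Rabs (a k) * / b k))); [apply ex_series_scal_R, Ha|].
    intros k N.
    assert (HT : Rabs (Rabs t) < b k) by (rewrite Rabs_Rabsolu; apply Hlt).
    pose proof (is_series_Rscal (Rabs (a k)) _ _ (is_series_geom_div (b k) (Rabs t) (Hpos k) HT)) as H.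
    apply Rle_trans with (Series (fun n => Rabs (a k) * (Rabs t ^ n * / b k ^ S n))).
    + apply sum_n_Rabs_le_Series; [eexists; exact H|].
      intros n; rewrite !Rabs_mult, RPow_abs, (Rabs_pos_eq (/ b k ^ S n)); [apply Rle_refl|].
      left; apply Rinv_0_lt_compat, pow_lt, Hpos.
    + rewrite (is_series_unique _ _ H).
      replace (2 * (Rabs (a k) * / b k)) with (Rabs (a k) * (/ (b k / 2)))
        by (specialize (Hb k); field; lra).
      apply Rmult_le_compat_l; [apply Rabs_pos|].
      specialize (Hb k); apply Rinv_le_contravar; lra.
  - apply Series_ext; intros k; rewrite Series_scal_l; f_equal.
    apply is_series_unique, is_series_geom_div; auto.
Qed.

Lemma has_expansion_inv_sq (a b : nat -> R) :
  (forall k, 1 <= b k) -> ex_series (fun k => Rabs (a k) * / b k ^ 2) ->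
  has_expansion (fun n => (INR n + 1) * Series (fun k => a k * / b k ^ (n + 2)))
                (fun t => Series (fun k => a k * / (b k - t) ^ 2)).
Proof.
  intros Hb Ha; apply (has_expansion_intro _ _ (/ 2)); [lra|]; intros t Ht.
  assert (Hlt : forall k, Rabs t < b k) by (intros k; specialize (Hb k); lra).
  assert (Hpos : forall k, 0 < b k) by (intros k; specialize (Hb k); lra).
  replace (Series (fun k => a k * / (b k - t) ^ 2)) with
    (Series (fun k => Series (fun n => a k * ((INR n + 1) * (t ^ n * / b k ^ (n + 2)))))).
  - apply (is_series_ext (fun n => Series (fun k =>
      a k * ((INR n + 1) * (t ^ n * / b k ^ (n + 2)))))).
    { intros n; rewrite <- Series_scal_l, <- Series_scal_r.
      apply Series_ext; intros k; as_R; ring. }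
    apply (fubini_series _ (fun k => 4 * (Rabs (a k) * / b k ^ 2))); [apply ex_series_scal_R, Ha|].
    intros k N.
    assert (HT : Rabs (Rabs t) < b k) by (rewrite Rabs_Rabsolu; apply Hlt).
    pose proof (is_series_Rscal (Rabs (a k)) _ _
      (is_series_geom_div_sq (b k) (Rabs t) (Hpos k) HT)) as H.
    apply Rle_trans with (Series (fun n =>
      Rabs (a k) * ((INR n + 1) * (Rabs t ^ n * / b k ^ (n + 2))))).
    + apply sum_n_Rabs_le_Series; [eexists; exact H|].
      intros n; rewrite !Rabs_mult, RPow_abs, (Rabs_pos_eq (/ b k ^ (n + 2))).
      * rewrite (Rabs_pos_eq (INR n + 1)); [apply Rle_refl | pose proof (pos_INR n); lra].
      * left; apply Rinv_0_lt_compat, pow_lt, Hpos.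
    + rewrite (is_series_unique _ _ H).
      replace (4 * (Rabs (a k) * / b k ^ 2)) with (Rabs (a k) * (/ (b k / 2) ^ 2))
        by (specialize (Hb k); field; lra).
      apply Rmult_le_compat_l; [apply Rabs_pos|].
      specialize (Hb k); apply Rinv_le_contravar; [apply pow_lt; lra | apply pow_incr; lra].
  - apply Series_ext; intros k; rewrite Series_scal_l; f_equal.
    apply is_series_unique, is_series_geom_div_sq; auto.
Qed.

Definition ev_coef (e : nat -> R) (n : nat) : R :=
  (INR n + 1) * Series (fun j => e j * / ev j ^ (2 * n + 3)).

Lemma inv_ev_pow_le j p : (2 <= p)%nat -> 0 < / ev j ^ p <= / od j ^ 2.
Proof.
  intros Hp; pose proof (ev_ge_2 j); pose proof (inv_ev_sq_le j).
  split; [apply Rinv_0_lt_compat, pow_lt; lra|].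
  apply Rle_trans with (/ ev j ^ 2); [|lra].
  apply Rinv_le_contravar; [apply pow_lt; lra | apply Rle_pow; [lra|exact Hp]].
Qed.

Lemma has_expansion_ev_sum e : (forall i, Rabs (e i) <= 1) ->
  has_expansion (ev_coef e) (ev_sum e).
Proof.
  intros He.
  assert (H : has_expansion
    (fun n => (INR n + 1) * Series (fun j => e j * ev j * / (ev j ^ 2) ^ (n + 2)))
    (fun t => Series (fun j => e j * ev j * / (ev j ^ 2 - t) ^ 2))).
  { apply (has_expansion_inv_sq (fun j => e j * ev j) (fun j => ev j ^ 2)).
    - intros j; pose proof (ev_ge_2 j); nra.
    - apply (ex_series_dominated _ _ ex_series_inv_od_sq); intros j.
      pose proof (inv_ev_pow_le j 3 ltac:(lia)); pose proof (ev_ge_2 j).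
      replace (Rabs (e j * ev j) * / (ev j ^ 2) ^ 2) with (Rabs (e j) * / ev j ^ 3).
      + rewrite Rabs_mult, Rabs_Rabsolu, (Rabs_pos_eq (/ ev j ^ 3)) by lra.
        pose proof (He j); pose proof (Rabs_pos (e j)); nra.
      + rewrite Rabs_mult, (Rabs_pos_eq (ev j)) by lra; field; lra. }
  unfold has_expansion; apply (filter_imp (fun t => is_pseries
     (fun n => (INR n + 1) * Series (fun j => e j * ev j * / (ev j ^ 2) ^ (n + 2))) t
     (Series (fun j => e j * ev j * / (ev j ^ 2 - t) ^ 2)))); [|exact H].
  intros t Ht.
  replace (ev_sum e t) with (Series (fun j => e j * ev j * / (ev j ^ 2 - t) ^ 2))
    by (apply Series_ext; intros j; ring).
  apply is_pseries_ext with (2 := Ht); intros n; unfold ev_coef; as_R; f_equal.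
  apply Series_ext; intros j; rewrite <- pow_mult.
  replace (2 * (n + 2))%nat with (S (2 * n + 3)) by lia.
  change (ev j ^ S (2 * n + 3)) with (ev j * ev j ^ (2 * n + 3)).
  pose proof (ev_neq_0 j); assert (ev j ^ (2 * n + 3) <> 0) by (apply pow_nonzero; assumption).
  field; auto.
Qed.

Lemma has_expansion_eq a b f : (forall n, a n = b n) -> has_expansion a f -> has_expansion b f.
Proof.
  intros H Ha; unfold has_expansion; apply (filter_imp (fun t => is_pseries a t (f t))); [|exact Ha].
  intros t Ht; apply is_pseries_ext with (2 := Ht); exact H.
Qed.

Definition ev_zeta (p : nat) : R := Series (fun j => / ev j ^ p).

Lemma has_expansion_pole_corr :
  has_expansion (fun n => (2 * INR n + 3) / 8 * ev_zeta (2 * n + 4)) (fun t => Series (pole_corr t)).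
Proof.
  assert (Hb : forall k, 1 <= ev k ^ 2) by (intros j; pose proof (ev_ge_2 j); nra).
  assert (H1 : has_expansion
    (fun n => Series (fun j => / (8 * ev j ^ 2) * / (ev j ^ 2) ^ S n))
    (fun t => Series (fun j => / (8 * ev j ^ 2) * / (ev j ^ 2 - t)))).
  { apply (has_expansion_inv (fun j => / (8 * ev j ^ 2)) (fun j => ev j ^ 2) Hb).
    apply (ex_series_dominated _ _ ex_series_inv_od_sq); intros j.
    pose proof (inv_ev_sq_le j); pose proof (ev_ge_2 j).
    assert (/ (8 * ev j ^ 2) <= 1)
      by (rewrite <- Rinv_1; apply Rinv_le_contravar; specialize (Hb j); nra).
    assert (0 < / (8 * ev j ^ 2)) by (apply Rinv_0_lt_compat; specialize (Hb j); nra).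
    rewrite (Rabs_pos_eq (/ (8 * ev j ^ 2))), Rabs_pos_eq by nra; nra. }
  assert (H2 : has_expansion
    (fun n => (INR n + 1) * Series (fun j => / 4 * / (ev j ^ 2) ^ (n + 2)))
    (fun t => Series (fun j => / 4 * / (ev j ^ 2 - t) ^ 2))).
  { apply (has_expansion_inv_sq (fun j => / 4) (fun j => ev j ^ 2) Hb).
    apply (ex_series_dominated _ _ ex_series_inv_od_sq); intros j.
    pose proof (inv_ev_pow_le j 4 ltac:(lia)) as H4.
    replace ((ev j ^ 2) ^ 2) with (ev j ^ 4) by ring.
    rewrite (Rabs_pos_eq (/ 4)), Rabs_pos_eq by lra; lra. }
  pose proof (has_expansion_plus _ _ _ _ H1 H2) as H; clear H1 H2.
  apply (has_expansion_ext _ _ (fun t => Series (pole_corr t))) in H.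
  - apply has_expansion_eq with (2 := H); intros n.
    unfold ev_zeta; rewrite <- !Series_scal_l, <- Series_plus_R.
    + apply Series_ext; intros j.
      rewrite <- !pow_mult.
      replace (2 * S n)%nat with (2 * n + 2)%nat by lia.
      replace (2 * (n + 2))%nat with (2 * n + 2 + 2)%nat by lia.
      replace (2 * n + 4)%nat with (2 * n + 2 + 2)%nat by lia.
      rewrite (pow_add (ev j) (2 * n + 2) 2).
      pose proof (ev_neq_0 j); assert (ev j ^ (2 * n + 2) <> 0) by (apply pow_nonzero; assumption).
      field; auto.
    + apply (ex_series_dominated _ _ ex_series_inv_od_sq); intros j.
      rewrite <- pow_mult; pose proof (inv_ev_pow_le j (2 * S n) ltac:(lia)).
      assert (0 < / (8 * ev j ^ 2) <= 1).
      { split; [apply Rinv_0_lt_compat; specialize (Hb j); nra|].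
        rewrite <- Rinv_1; apply Rinv_le_contravar; specialize (Hb j); nra. }
      rewrite Rabs_pos_eq by nra; nra.
    + apply ex_series_scal_R, (ex_series_dominated _ _ ex_series_inv_od_sq); intros j.
      rewrite <- pow_mult; pose proof (inv_ev_pow_le j (2 * (n + 2)) ltac:(lia)).
      rewrite Rabs_pos_eq by lra; lra.
  - unfold has_expansion; apply (filter_imp (fun t => Rabs t < / 2)); [|apply locally_0_Rabs_lt; lra].
    intros t Ht; assert (Ht' : t <= / 2) by (pose proof (Rle_abs t); lra).
    rewrite <- Series_plus_R.
    + apply Series_ext; intros j; unfold pole_corr; rewrite !Rinv_mult; ring.
    + apply (ex_series_dominated _ _ (ex_series_C_inv_od_sq 2)); intros j.
      pose proof (inv_ev_sq_sub_bounds t j Ht'); pose proof (inv_ev_sq_le j).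
      assert (0 < / (8 * ev j ^ 2) <= 1).
      { split; [apply Rinv_0_lt_compat; specialize (Hb j); nra|].
        rewrite <- Rinv_1; apply Rinv_le_contravar; specialize (Hb j); nra. }
      rewrite Rabs_pos_eq by nra; nra.
    + apply (ex_series_dominated _ _ (ex_series_C_inv_od_sq 2)); intros j.
      pose proof (inv_ev_sq_sub_bounds t j Ht'); pose proof (inv_ev_sq_le j).
      assert (/ ev j ^ 2 <= / 4) by (apply Rinv_le_contravar; pose proof (ev_ge_2 j); nra).
      replace ((ev j ^ 2 - t) ^ 2) with ((ev j ^ 2 - t) * (ev j ^ 2 - t)) by ring.
      rewrite Rinv_mult, Rabs_pos_eq by nra; nra.
Qed.

(** The coefficients of [secant t - 1]; the one at index 0 is 0, which is the origin of the
    condition q >= 1. *)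
Definition sec_coef : nat -> R :=
  PS_incr_1 (fun n => Series (fun k => kap * ((-1) ^ k * / od k) * / (od k ^ 2) ^ S n)).

Lemma od_sq_ge_1 k : 1 <= od k ^ 2.
Proof. pose proof (od_ge_1 k); nra. Qed.

Lemma has_expansion_sec : has_expansion sec_coef (fun t => t * Series (sec_term t)).
Proof.
  apply has_expansion_incr.
  apply (has_expansion_ext _ (fun t => Series (fun k =>
    kap * ((-1) ^ k * / od k) * / (od k ^ 2 - t)))).
  - exists (mkposreal 1 Rlt_0_1); intros t _; apply Series_ext; intros k.
    unfold sec_term; rewrite Rinv_mult; ring.
  - apply (has_expansion_inv (fun k => kap * ((-1) ^ k * / od k)) (fun k => od k ^ 2));
      [apply od_sq_ge_1|].
    apply (ex_series_dominated _ _ ex_series_2_inv_od_sq); intros k.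
    pose proof (inv_od_sq_pos k) as Hp; pose proof (od_ge_1 k) as Hk.
    rewrite Rabs_mult, Rabs_Rabsolu, (Rabs_pos_eq (/ od k ^ 2)) by lra.
    apply Rmult_le_compat_r; [lra|].
    rewrite Rabs_mult, Rabs_sign_mult.
    pose proof Rabs_kap_le; pose proof (Rabs_pos kap).
    assert (0 < / od k <= 1).
    { split; [apply Rinv_0_lt_compat; lra|].
      rewrite <- Rinv_1; apply Rinv_le_contravar; lra. }
    rewrite (Rabs_pos_eq (/ od k)) by lra; nra.
Qed.

Lemma has_expansion_const c : has_expansion (fun n => if Nat.eqb n 0 then c else 0) (fun _ => c).
Proof.
  apply (has_expansion_intro _ _ 1); [lra|]; intros t _.
  replace (is_series (fun n => (if Nat.eqb n 0 then c else 0) * t ^ n) c)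
    with (is_series (fun n => (if Nat.eqb n 0 then c else 0) * t ^ n)
            ((if Nat.eqb 0 0 then c else 0) * t ^ 0)) by (f_equal; simpl; ring).
  apply (is_series_single (fun n => (if Nat.eqb n 0 then c else 0) * t ^ n) 0).
  intros j Hj; destruct (Nat.eqb_spec j 0); [contradiction|ring].
Qed.

(** The coefficients in x of f (- x ^ 2), if those of f are [a]. *)
Definition even_expansion (a : nat -> R) (n : nat) : R :=
  if Nat.even n then (-1) ^ (Nat.div2 n) * a (Nat.div2 n) else 0.

Lemma even_expansion_even a q : even_expansion a (2 * q) = (-1) ^ q * a q.
Proof.
  unfold even_expansion; rewrite Nat.even_even, Nat.div2_double; reflexivity.
Qed.

Lemma even_expansion_odd a q : even_expansion a (2 * q + 1) = 0.
Proof. unfold even_expansion; rewrite Nat.even_odd; reflexivity. Qed.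

Lemma has_expansion_opp_sq a f : has_expansion a f ->
  has_expansion (even_expansion a) (fun x => f (- x ^ 2)).
Proof.
  intros [[d Hd] H].
  assert (Hm : 0 < Rmin 1 d) by (apply Rmin_glb_lt; lra).
  unfold has_expansion; apply (filter_imp (fun x => Rabs x < Rmin 1 d));
    [|apply locally_0_Rabs_lt; exact Hm].
  intros x Hx.
  assert (Hx2 : Rabs (- x ^ 2) < d).
  { rewrite Rabs_Ropp, <- RPow_abs; pose proof (Rabs_pos x).
    pose proof (Rmin_l 1 d); pose proof (Rmin_r 1 d); nra. }
  assert (Hp : is_pseries a (- x ^ 2) (f (- x ^ 2))).
  { apply H; unfold ball; simpl; unfold AbsRing_ball, abs, minus, plus, opp; simpl.
    rewrite Ropp_0, Rplus_0_r; simpl in Hx2; exact Hx2. }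
  replace (f (- x ^ 2)) with (f (- x ^ 2) + x * 0) by ring.
  apply is_pseries_odd_even.
  - apply is_pseries_R in Hp; apply is_pseries_R.
    apply is_series_ext with (2 := Hp); intros q.
    rewrite even_expansion_even.
    replace (- x ^ 2) with (-1 * x ^ 2) by ring; rewrite Rpow_mult_distr; as_R; ring.
  - apply is_pseries_R, (is_series_ext (fun _ => 0)); [|apply is_series_0].
    intros q; rewrite even_expansion_odd; as_R; ring.
Qed.

Lemma has_expansion_sech E : is_euler_numbers E ->
  has_expansion (fun n => E n / INR (fact n) * (PI / 2) ^ n) (fun x => / cosh (x * (PI / 2))).
Proof.
  intros [[d Hd] H].
  (* Half of [d] suffices because PI / 2 <= 2. *)
  apply (has_expansion_intro _ _ (d / 2)); [lra|]; intros x Hx.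
  assert (Hz : Rabs (x * (PI / 2)) < d).
  { pose proof PI_RGT_0; pose proof PI_4; pose proof (Rabs_pos x).
    rewrite Rabs_mult, (Rabs_pos_eq (PI / 2)) by lra; nra. }
  assert (Hp : is_pseries (fun n => E n / INR (fact n)) (x * (PI / 2)) (/ cosh (x * (PI / 2)))).
  { apply H; unfold ball; simpl; unfold AbsRing_ball, abs, minus, plus, opp; simpl.
    rewrite Ropp_0, Rplus_0_r; exact Hz. }
  apply is_pseries_R in Hp; apply is_series_ext with (2 := Hp); intros n.
  rewrite Rpow_mult_distr; as_R; ring.
Qed.

Lemma sec_coef_euler E q : is_euler_numbers E -> (1 <= q)%nat ->
  sec_coef q = (-1) ^ q * (E (2 * q)%nat * PI ^ (2 * q) / INR (fact (2 * q))) * (1 / 4) ^ q.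
Proof.
  intros HE Hq.
  pose proof (has_expansion_plus _ _ _ _ (has_expansion_const 1) has_expansion_sec) as H1.
  apply has_expansion_opp_sq in H1.
  pose proof (has_expansion_sech E HE) as H2.
  apply (has_expansion_ext _ _ (fun x => / cosh (x * (PI / 2)))) in H1.
  - pose proof (has_expansion_unique _ _ _ H1 H2 (2 * q)%nat) as H.
    rewrite even_expansion_even in H.
    destruct (Nat.eqb_spec q 0); [lia|]; rewrite Rplus_0_l in H.
    replace (sec_coef q) with ((-1) ^ q * ((-1) ^ q * sec_coef q))
      by (rewrite <- Rmult_assoc, sign_sqr; ring).
    rewrite H; unfold Rdiv; rewrite !Rpow_mult_distr, !pow_inv, pow1.
    replace (2 ^ (2 * q)) with (4 ^ q) by (rewrite pow_mult; f_equal; ring).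
    ring.
  - exists (mkposreal 1 Rlt_0_1); intros x _.
    pose proof (secant_mult_cosh x) as Hs; unfold secant in Hs.
    pose proof (cosh_ge_1 (x * (PI / 2))) as Hc.
    apply Rmult_eq_reg_r with (cosh (x * (PI / 2))); [|lra].
    rewrite Hs, Rinv_l by lra; reflexivity.
Qed.

(** * Sums over even integers as zeta values *)

Lemma ev_INR j : ev j = 2 * INR (S j).
Proof. unfold ev; rewrite S_INR; ring. Qed.

Lemma ev_zeta_eq p : ev_zeta p = / 2 ^ p * zeta p.
Proof.
  unfold ev_zeta, zeta; rewrite <- Series_scal_l; apply Series_ext; intros j.
  rewrite ev_INR, Rpow_mult_distr, Rinv_mult; reflexivity.
Qed.

Lemma ex_series_zeta p : (2 <= p)%nat -> ex_series (fun j => / INR (S j) ^ p).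
Proof.
  intros Hp.
  apply (ex_series_ext (fun j => 2 ^ p * / ev j ^ p)).
  - intros j; rewrite ev_INR, Rpow_mult_distr, Rinv_mult.
    assert (2 ^ p <> 0) by (apply pow_nonzero; lra).
    pose proof (not_0_INR (S j) ltac:(lia)) as Hj.
    assert (INR (S j) ^ p <> 0) by (apply pow_nonzero; exact Hj).
    as_R; field; auto.
  - apply ex_series_scal_R, (ex_series_dominated _ _ ex_series_inv_od_sq).
    intros j; pose proof (inv_ev_pow_le j p Hp); rewrite Rabs_pos_eq; lra.
Qed.

Lemma Series_pairs (a : nat -> R) : ex_series a ->
  Series a = Series (fun i => a (2 * i)%nat + a (2 * i + 1)%nat).
Proof.
  intros Ha; symmetry; apply is_series_unique, is_series_of_is_lim_seq.
  apply (is_lim_seq_ext (fun n => sum_n a (2 * n + 1))).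
  - intros n; induction n as [|n IH].
    + simpl; rewrite sum_n_S_R, !sum_O; reflexivity.
    + replace (2 * S n + 1)%nat with (S (S (2 * n + 1))) by lia.
      rewrite !sum_n_S_R, IH; replace (2 * S n)%nat with (S (2 * n + 1)) by lia.
      replace (S (2 * n + 1) + 1)%nat with (S (S (2 * n + 1))) by lia; ring.
  - apply (is_lim_seq_subseq (sum_n a) _ (fun n => (2 * n + 1)%nat)).
    + apply eventually_subseq; intros n; lia.
    + exact (Series_correct _ Ha).
Qed.

Lemma INR_double_S i : INR (S (2 * i + 1)) = 2 * INR (S i).
Proof. rewrite !S_INR, plus_INR, mult_INR; simpl; ring. Qed.

(** Zeta minus its alternating version is twice the sum over the even integers. *)
Lemma Series_alt_zeta p : (2 <= p)%nat ->
  Series (fun j => (-1) ^ j * / INR (S j) ^ p) = (1 - 2 / 2 ^ p) * zeta p.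
Proof.
  intros Hp; pose proof (ex_series_zeta p Hp) as Hz.
  assert (Ha : ex_series (fun j => (-1) ^ j * / INR (S j) ^ p)).
  { apply (ex_series_dominated _ _ Hz); intros j; rewrite Rabs_sign_mult.
    rewrite Rabs_pos_eq; [lra|].
    left; apply Rinv_0_lt_compat, pow_lt, lt_0_INR; lia. }
  assert (E : zeta p - Series (fun j => (-1) ^ j * / INR (S j) ^ p) = 2 / 2 ^ p * zeta p).
  { unfold zeta at 1; rewrite <- Series_minus by assumption.
    rewrite Series_pairs.
    - unfold zeta; rewrite <- Series_scal_l; apply Series_ext; intros i.
      rewrite pow_mult, pow_add, pow_mult, INR_double_S, Rpow_mult_distr, Rinv_mult.
      replace ((-1) ^ 2) with 1 by ring; rewrite pow1, pow_1; unfold Rdiv; ring.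
    - apply (ex_series_minus (fun j => / INR (S j) ^ p)); assumption. }
  lra.
Qed.

Lemma lam_eq : lam = 3 / 4 * zeta 2.
Proof.
  assert (E : zeta 2 = lam + / 4 * zeta 2).
  { unfold zeta at 1; rewrite Series_pairs by (apply ex_series_zeta; lia).
    unfold lam, zeta; rewrite <- Series_scal_l, <- Series_plus_R.
    - apply Series_ext; intros i; rewrite INR_double_S, Rpow_mult_distr, Rinv_mult.
      replace (INR (S (2 * i))) with (od i) by (unfold od; rewrite S_INR, mult_INR; simpl; ring).
      replace (2 ^ 2) with 4 by ring; reflexivity.
    - apply ex_series_inv_od_sq.
    - apply ex_series_scal_R, ex_series_zeta; lia. }
  lra.
Qed.

(** * Coefficients *)

Definition weighted_zeta (r : nat) : R := INR r * zeta (2 * r + 1).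

Lemma pow_quarter n : (1 / 4) ^ n = / 2 ^ (2 * n).
Proof. rewrite pow_mult, <- pow_inv; f_equal; field. Qed.

Lemma ev_coef_one n :
  ev_coef (fun _ => 1) n = weighted_zeta (S n) * ((1 / 4) ^ S n / 2).
Proof.
  unfold ev_coef, weighted_zeta; rewrite <- S_INR.
  rewrite (Series_ext _ (fun j => / ev j ^ (2 * n + 3))) by (intros; ring).
  fold (ev_zeta (2 * n + 3)); rewrite ev_zeta_eq.
  replace (2 * S n + 1)%nat with (2 * n + 3)%nat by lia.
  rewrite pow_quarter; replace (2 * n + 3)%nat with (S (2 * S n)) at 1 by lia.
  change (2 ^ S (2 * S n)) with (2 * 2 ^ (2 * S n)); rewrite Rinv_mult; unfold Rdiv; ring.
Qed.

Lemma ev_coef_sign n :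
  ev_coef (fun j => (-1) ^ j) n =
  weighted_zeta (S n) * ((1 / 4) ^ S n / 2) * (1 - / 2 ^ (2 * S n)).
Proof.
  unfold ev_coef, weighted_zeta; rewrite <- S_INR.
  rewrite (Series_ext _ (fun j => / 2 ^ (2 * n + 3) * ((-1) ^ j * / INR (S j) ^ (2 * n + 3)))).
  - rewrite Series_scal_l, Series_alt_zeta by lia.
    replace (2 * S n + 1)%nat with (2 * n + 3)%nat by lia.
    rewrite pow_quarter; replace (2 ^ (2 * n + 3)) with (2 * 2 ^ (2 * S n))
      by (replace (2 * n + 3)%nat with (S (2 * S n)) by lia; reflexivity).
    assert (2 ^ (2 * S n) <> 0) by (apply pow_nonzero; lra).
    field; assumption.
  - intros j; rewrite ev_INR, Rpow_mult_distr, Rinv_mult; ring.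
Qed.

Lemma sum_n_shrink (a : nat -> R) p N : (p <= N)%nat ->
  (forall k, (p < k)%nat -> a k = 0) -> sum_n a N = sum_n a p.
Proof.
  intros Hp H; induction Hp as [|N Hp IH]; [reflexivity|].
  rewrite sum_n_S_R, IH, H by lia; apply Rplus_0_r.
Qed.

Lemma sum_n_m_1 (f : nat -> R) n : sum_n_m f 1 (S n) = sum_n (fun i => f (S i)) n.
Proof. symmetry; apply sum_n_m_S. Qed.

Lemma sum_compositions2_eq n f :
  sum_compositions2 (n + 2) f = sum_n (fun i => f (S i) (S (n - i))) n.
Proof.
  unfold sum_compositions2; replace (n + 2)%nat with (S (S n)) by lia.
  rewrite sum_n_m_1.
  rewrite (sum_n_ext _ (fun i => if Nat.leb i n then f (S i) (S (n - i)) else 0)).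
  - rewrite (sum_n_shrink _ n) by first [lia |
      intros k Hk; destruct (Nat.leb_spec k n); [lia|reflexivity]].
    apply sum_n_ext_le; intros i Hi; destruct (Nat.leb_spec i n); [reflexivity|lia].
  - intros i; rewrite sum_n_m_1; as_R; destruct (Nat.leb_spec i n).
    + rewrite (sum_n_single _ (n - i)) by first [lia |
        intros k Hk Hne; destruct (Nat.eqb_spec (S i + S k) (S (S n))); [lia|reflexivity]].
      destruct (Nat.eqb_spec (S i + S (n - i)) (S (S n))); [reflexivity|lia].
    + apply sum_n_zero; intros k Hk.
      destruct (Nat.eqb_spec (S i + S k) (S (S n))); [lia|reflexivity].
Qed.

(** Grouping by p = r + s - 2, hence q = n - p, gives the shape of a nested Cauchy product. The
    index p = n, excluded by q >= 1, is kept with the value 0. *)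
Lemma sum_compositions3_eq n f :
  sum_compositions3 (n + 2) f =
  sum_n (fun p => if Nat.eqb p n then 0
                  else sum_n (fun i => f (S i) (S (p - i)) (n - p)%nat) p) n.
Proof.
  unfold sum_compositions3; replace (n + 2)%nat with (S (S n)) by lia.
  rewrite sum_n_m_1.
  (* The sum over q is replaced by a sum over [p] with an indicator, so that [p] can be exchanged to
     the outside. *)
  transitivity (sum_n (fun i => sum_n (fun j => sum_n (fun p =>
    if andb (Nat.eqb (i + j) p) (Nat.ltb p n) then f (S i) (S j) (n - p)%nat else 0) n) (S n)) (S n)).
  - apply sum_n_ext; intros i; rewrite sum_n_m_1; apply sum_n_ext; intros j; rewrite sum_n_m_1.
    as_R; destruct (le_lt_dec n (i + j)) as [H|H].
    + rewrite !sum_n_zero; [reflexivity| |].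
      * intros p Hp; destruct (Nat.eqb_spec (i + j) p), (Nat.ltb_spec p n); try reflexivity; lia.
      * intros k Hk; destruct (Nat.eqb_spec (S i + S j + S k) (S (S n))); [lia|reflexivity].
    + rewrite (sum_n_single _ (n - 1 - i - j)), (sum_n_single _ (i + j) n); try lia.
      * destruct (Nat.eqb_spec (S i + S j + S (n - 1 - i - j)) (S (S n))); [|lia].
        rewrite Nat.eqb_refl; destruct (Nat.ltb_spec (i + j) n); [|lia].
        simpl andb; cbv iota; f_equal; lia.
      * intros p Hp Hne; destruct (Nat.eqb_spec (i + j) p); [lia|reflexivity].
      * intros k Hk Hne; destruct (Nat.eqb_spec (S i + S j + S k) (S (S n))); [lia|reflexivity].
  - rewrite (sum_n_ext _ (fun i => sum_n (fun p => sum_n (fun j =>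
      if andb (Nat.eqb (i + j) p) (Nat.ltb p n) then f (S i) (S j) (n - p)%nat else 0) (S n)) n))
      by (intros i; apply sum_n_switch).
    rewrite sum_n_switch; apply sum_n_ext_le; intros p Hp; as_R.
    destruct (Nat.eqb_spec p n) as [->|Hne].
    + apply sum_n_zero; intros i _; apply sum_n_zero; intros j _.
      destruct (Nat.ltb_spec n n); [lia|]; rewrite Bool.andb_false_r; reflexivity.
    + rewrite (sum_n_shrink _ p) by first [lia |
        intros i Hi; apply sum_n_zero; intros j _;
        destruct (Nat.eqb_spec (i + j) p); [lia|reflexivity]].
      apply sum_n_ext_le; intros i Hi.
      rewrite (sum_n_single _ (p - i)).
      * destruct (Nat.eqb_spec (i + (p - i)) p); [|lia].
        destruct (Nat.ltb_spec p n); [reflexivity|lia].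
      * lia.
      * intros j _ Hj; destruct (Nat.eqb_spec (i + j) p); [lia|reflexivity].
Qed.

Lemma has_expansion_tstar :
  has_expansion (fun n => Series (fun k => tstar_coef k * / (od k ^ 2) ^ S n))
                (fun t => Series (fun k => tstar_coef k * / (od k ^ 2 - t))).
Proof.
  apply has_expansion_inv; [apply od_sq_ge_1|].
  apply (ex_series_dominated _ _ (ex_series_C_inv_od_sq (5 * (2 * lam)))); intros k.
  assert (H : Rabs (omega_series k) <= 2 * lam).
  { apply (Rabs_limit_le _ _ _ (is_lim_seq_omega_sum k)); intros N; apply Rabs_omega_sum_le. }
  pose proof (Rabs_hsum_mult_div_le k 0 _ _ H) as Hk; simpl Nat.mul in Hk; simpl Nat.add in Hk.
  fold (tstar_coef k) in Hk; unfold Rdiv in Hk; rewrite Rabs_mult in Hk.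
  rewrite Rabs_mult, Rabs_Rabsolu; exact Hk.
Qed.

Lemma tstar_coefficients n :
  Series (fun k => tstar_coef k * / (od k ^ 2) ^ S n) =
  8 * PS_mult (fun i => ev_coef (fun _ => 1) i + ev_coef (fun j => (-1) ^ j) i)
              (fun i => ev_coef (fun _ => 1) i + ev_coef (fun j => (-1) ^ j) i) n
  + 8 * PS_mult (fun p => PS_mult (ev_coef (fun _ => 1)) (ev_coef (fun j => (-1) ^ j)) p
                        + PS_mult (ev_coef (fun j => (-1) ^ j)) (ev_coef (fun _ => 1)) p) sec_coef n
  + 16 * lam * ((2 * INR n + 3) / 8 * ev_zeta (2 * n + 4)).
Proof.
  assert (HX : has_expansion (ev_coef (fun _ => 1)) Xi).
  { apply has_expansion_ev_sum; intros; rewrite Rabs_R1; lra. }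
  assert (HH : has_expansion (ev_coef (fun j => (-1) ^ j)) Eta).
  { apply has_expansion_ev_sum; intros i; rewrite pow_1_abs; lra. }
  pose proof (has_expansion_plus _ _ _ _ HX HH) as HS.
  pose proof (has_expansion_plus _ _ _ _
    (has_expansion_plus _ _ _ _
      (has_expansion_scal 8 _ _ (has_expansion_mult _ _ _ _ HS HS))
      (has_expansion_scal 8 _ _ (has_expansion_mult _ _ _ _
         (has_expansion_plus _ _ _ _
           (has_expansion_mult _ _ _ _ HX HH) (has_expansion_mult _ _ _ _ HH HX))
         has_expansion_sec)))
    (has_expansion_scal (16 * lam) _ _ has_expansion_pole_corr)) as HR.
  refine (has_expansion_unique _ _ _ has_expansion_tstar (has_expansion_ext _ _ _ _ HR) n).
  apply (filter_imp (fun t => Rabs t < / 2)); [|apply locally_0_Rabs_lt; lra].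
  intros t Ht; rewrite tstar_generating_function by (pose proof (Rle_abs t); lra); ring.
Qed.

Lemma pow_quarter_split i n : (i <= n)%nat ->
  (1 / 4) ^ (n + 2) = (1 / 4) ^ S i * (1 / 4) ^ S (n - i).
Proof. intros H; rewrite <- pow_add; f_equal; lia. Qed.

(** The coefficients of [Xi + Eta] carry the factor (2 - 2^(-2r)) / 2, and 8 times the two halves is
    the 2 of the formula. *)
Lemma coefficient_square n :
  8 * PS_mult (fun i => ev_coef (fun _ => 1) i + ev_coef (fun j => (-1) ^ j) i)
              (fun i => ev_coef (fun _ => 1) i + ev_coef (fun j => (-1) ^ j) i) n =
  (1 / 4) ^ (n + 2) * sum_compositions2 (n + 2) (fun r s =>
          2 * INR r * INR s * (2 - / 2 ^ (2 * r)) * (2 - / 2 ^ (2 * s))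
          * zeta (2 * r + 1) * zeta (2 * s + 1)).
Proof.
  rewrite sum_compositions2_eq; unfold PS_mult.
  rewrite <- sum_n_Reals, <- !sum_n_scal_R.
  apply sum_n_ext_le; intros i Hi.
  rewrite !ev_coef_one, !ev_coef_sign, (pow_quarter_split i n Hi); unfold weighted_zeta.
  field; split; apply pow_nonzero; lra.
Qed.

Lemma coefficient_secant E n : is_euler_numbers E ->
  8 * PS_mult (fun p => PS_mult (ev_coef (fun _ => 1)) (ev_coef (fun j => (-1) ^ j)) p
                      + PS_mult (ev_coef (fun j => (-1) ^ j)) (ev_coef (fun _ => 1)) p) sec_coef n =
  (1 / 4) ^ (n + 2) * sum_compositions3 (n + 2) (fun r s q =>
          2 * INR r * INR s * (2 - / 2 ^ (2 * r) - / 2 ^ (2 * s))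
          * zeta (2 * r + 1) * zeta (2 * s + 1)
          * ((-1) ^ q * (E (2 * q)%nat * PI ^ (2 * q) / INR (fact (2 * q))))).
Proof.
  intros HE; rewrite sum_compositions3_eq; unfold PS_mult at 1.
  rewrite <- sum_n_Reals, <- !sum_n_scal_R.
  apply sum_n_ext_le; intros p Hp.
  destruct (Nat.eqb_spec p n) as [->|Hne].
  - rewrite Nat.sub_diag; change (sec_coef 0) with 0; ring.
  - rewrite (sec_coef_euler E (n - p) HE) by lia.
    unfold PS_mult; rewrite <- !sum_n_Reals, <- sum_n_plus_R, <- Rmult_assoc.
    rewrite (Rmult_comm (8 * _)), <- !sum_n_scal_R.
    apply sum_n_ext_le; intros i Hi.
    rewrite !ev_coef_one, !ev_coef_sign; unfold weighted_zeta.
    replace ((1 / 4) ^ (n + 2)) with ((1 / 4) ^ S i * (1 / 4) ^ S (p - i) * (1 / 4) ^ (n - p))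
      by (rewrite <- !pow_add; f_equal; lia).
    field; repeat split; try (apply pow_nonzero; lra); apply INR_fact_neq_0.
Qed.

Theorem mainTheorem7 (E : nat -> R) (hE : is_euler_numbers E) (n : nat) :
  tstar (3%nat :: repeat 2%nat n ++ 3%nat :: nil) =
  Finite
    ((1 / 4) ^ (n + 2) *
     ((9 + 6 * INR n) / 2 * zeta 2 * zeta (2 * n + 4)
      + sum_compositions3 (n + 2) (fun r s q =>
          2 * INR r * INR s * (2 - / 2 ^ (2 * r) - / 2 ^ (2 * s))
          * zeta (2 * r + 1) * zeta (2 * s + 1)
          * ((-1) ^ q * (E (2 * q)%nat * PI ^ (2 * q) / INR (fact (2 * q)))))
      + sum_compositions2 (n + 2) (fun r s =>
          2 * INR r * INR s * (2 - / 2 ^ (2 * r)) * (2 - / 2 ^ (2 * s))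
          * zeta (2 * r + 1) * zeta (2 * s + 1)))).
Proof.
  rewrite tstar_eq_Series; f_equal.
  transitivity (Series (fun k => tstar_coef k * / (od k ^ 2) ^ S n)).
  { apply Series_ext; intros k; rewrite <- pow_mult.
    replace (2 * S n)%nat with (2 * n + 2)%nat by lia; reflexivity. }
  (* With lam = 3/4 zeta(2), the constant is 12 (2 n + 3) / 8 = (9 + 6 n) / 2. *)
  assert (HA : 16 * lam * ((2 * INR n + 3) / 8 * ev_zeta (2 * n + 4)) =
    (1 / 4) ^ (n + 2) * ((9 + 6 * INR n) / 2 * zeta 2 * zeta (2 * n + 4))).
  { rewrite lam_eq, ev_zeta_eq, pow_quarter.
    replace (2 * (n + 2))%nat with (2 * n + 4)%nat by lia.
    assert (2 ^ (2 * n + 4) <> 0) by (apply pow_nonzero; lra).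
    field; assumption. }
  rewrite tstar_coefficients, HA, coefficient_square, (coefficient_secant E n hE); ring.
Qed.
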